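(* Let $\alpha > -1$ and $0 < \sigma < \alpha +1$. Let $a,b \in \mathbb{R}$ and assume that $1\le p,q \le \infty$. (i) $L^p(x^{ap}dx) \subset \mathrm{Dom}\, \mathcal{I}^{\alpha,\sigma}$ if and only if $$2\sigma-\frac{1}p - \alpha - \frac{1}2 < a < \frac{1}{p'} + \alpha + \frac{1}2 \qquad \text{(both inequalities being $\le$ when $p=1$)}.$$ (ii) The estimate $$\big\|x^{-b}\mathcal{I}^{\alpha,\sigma} f\big\|_{L^q(dx)}\lesssim \big\|x^af\big\|_{L^p(dx)}$$ holds uniformly in $f \in L^p(x^{ap}dx)$ if and only if the following conditions are satisfied: (a) $p \le q$, (b) $\frac{1}{q} = \frac{1}p + a+b-2\sigma$, (c) $a < \frac{1}{p'} + \alpha + \frac{1}2$ ($\le$ when $p = q'= 1$), (d) $b < \frac{1}q + \alpha + \frac{1}2$ ($\le$ when $p = q'=1$), (e) $a+b \ge 0$ ($>$ when $p=1$ or $q=\infty$).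
   Context: For $\alpha>-1$ let $I_\alpha$ denote the modified Bessel function of the first kind of order $\alpha$, and for $t,x,y>0$ let $$\mathcal W_t^{\alpha}(x,y)=\frac{(xy)^{1/2}}{2t}\exp\Big(-\frac{x^2+y^2}{4t}\Big)I_\alpha\Big(\frac{xy}{2t}\Big).$$ For $\sigma>0$ define $$\mathcal K^{\alpha,\sigma}(x,y)=\frac1{\Gamma(\sigma)}\int_0^\infty \mathcal W_t^\alpha(x,y)\,t^{\sigma-1}\,dt,\qquad \mathcal I^{\alpha,\sigma}f(x)=\int_0^\infty \mathcal K^{\alpha,\sigma}(x,y)f(y)\,dy,\qquad x,y>0.$$ The natural domain $\mathrm{Dom}\,\mathcal I^{\alpha,\sigma}$ consists of those functions $f$ on $\mathbb{R}_+=(0,\infty)$ for which the last integral converges for a.e. $x>0$. All $L^p$ spaces are over $\mathbb{R}_+$; $L^p(x^{ap}dx)$ denotes the space of measurable $f$ with $x^af\in L^p(dx)$, also for $p=\infty$. $p'$ is the conjugate exponent, $1/p+1/p'=1$, and $1/\infty=0$. $X\lesssim Y$ means $X\le CY$ with a constant $C>0$ independent of $f$. *)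

(* Defs.v *)
From HB Require Import structures.
From mathcomp Require Import all_boot all_order all_algebra.
From mathcomp Require Import all_classical all_reals all_analysis.

Set Implicit Arguments.
Unset Strict Implicit.
Unset Printing Implicit Defensive.
Import Order.TTheory GRing.Theory Num.Theory.
Import numFieldNormedType.Exports.

Local Open Scope classical_set_scope.
Local Open Scope ring_scope.

Section HankelPotential.
Context {R : realType}.
Implicit Types (x y z s t a alpha sigma : R) (f : R -> R).

Local Notation mu := (@lebesgue_measure R).

Definition Rplus : set R := `]0, +oo[.

Definition Gamma s : R := \int[mu]_(t in Rplus) (t `^ (s - 1) * expR (- t)).

(* Modified Bessel function of the first kind, by its series
   sum_m (z/2)^(2m + alpha) / (m! Gamma(m + alpha + 1)), for z > 0. *)
Definition besselI alpha z : R :=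
  limn (series (fun m : nat =>
    (z / 2) `^ (2 * m%:R + alpha) / (m`!%:R * Gamma (m%:R + alpha + 1)))).

Definition heat_kernel alpha t x y : R :=
  (x * y) `^ 2^-1 / (2 * t) * expR (- ((x ^+ 2 + y ^+ 2) / (4 * t)))
  * besselI alpha (x * y / (2 * t)).

(* Extended-real valued: the integral is +oo on the diagonal x = y when
   sigma <= 1/2. *)
Definition potential_kernel alpha sigma x y : \bar R :=
  ((Gamma sigma)^-1%:E
   * \int[mu]_(t in Rplus) (heat_kernel alpha t x y * t `^ (sigma - 1))%:E)%E.

Definition potential alpha sigma f x : \bar R :=
  (\int[mu]_(y in Rplus) (potential_kernel alpha sigma x y * (f y)%:E))%E.

(* Functions on Rplus are represented by total functions whose values outside
   Rplus are irrelevant; convergence means absolute (Lebesgue) convergence. *)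
Definition Dom alpha sigma : set (R -> R) :=
  [set f | \forall x \ae mu, Rplus x ->
    mu.-integrable Rplus
      (fun y => (potential_kernel alpha sigma x y * (f y)%:E)%E)].

(* Norm of L^p(Rplus, dx), computed on the extension by zero to the line. *)
Definition Lpnorm (p : \bar R) (g : R -> \bar R) : \bar R :=
  'N[mu]_p[g \_ Rplus].

Definition weightedLp (p : \bar R) a : set (R -> R) :=
  [set f | measurable_fun Rplus f /\
    (Lpnorm p (fun x => (x `^ a * f x)%:E) < +oo)%E].

(* The reciprocal 1/p, with 1/oo = 0. *)
Definition recip (p : \bar R) : R := fine (p^-1)%E.

End HankelPotential.

(* Main.v *)
From HB Require Import structures.
Require Import Defs.
From mathcomp Require Import all_boot all_order all_algebra.
From mathcomp Require Import all_classical all_reals all_analysis.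
From mathcomp Require Import measurable_realfun ess_sup_inf ring lra.
Import Order.TTheory GRing.Theory Num.Theory.
Import numFieldNormedType.Exports.
Local Open Scope classical_set_scope.
Local Open Scope ring_scope.
Set Implicit Arguments.
Unset Strict Implicit.
Unset Printing Implicit Defensive.

(** In logarithmic coordinates the potential is a convolution on the line.
The Bessel series has nonnegative terms, so it may be integrated term by term
in t, and each term is a Gamma integral.  With beta = alpha + 1 - sigma this gives
  K(e^s, e^u) = e^((sigma - 1/2) (s + u)) H(s - u),
  H(v) = sum_m D_m (cosh v)^(- 2m - beta),  D_m > 0
(potential_kernel_exp).  Put c = a + 1/p and F(u) = e^(c u) |f(e^u)|.  Then
|| x^a f ||_p is the norm of F in L^p(du), and x^(-b) times the potential of
|f| has in L^q(dx) the norm in L^q(ds) of e^(theta s) (k * F)(s), where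
  k(v) = e^(- eta v) H(v),  eta = sigma + 1/2 - c,
  theta = 2 sigma - c - b + 1/q
(abs_potentialE, Lpnorm_expR).  Hence (i) asks when k * F is finite almost
everywhere for all F in L^p, and (ii) when F -> e^(theta s) (k * F)(s) is
bounded from L^p to L^q.

The size of H comes from the recurrence of D_m, which is hypergeometric with
D_m of order m^(- sigma - 1/2); comparison with the coefficients of
(1 - rho)^(- delta) at rho = 1 / cosh^2 v shows that H(v) decays like
e^(- beta |v|) and that near 0 it is like |v|^(2 sigma - 1) if sigma < 1/2,
unbounded if sigma = 1/2 and bounded if sigma > 1/2 (line_kernel_ub,
line_kernel_lb, line_kernel_lb_singular, line_kernel_blowup,
line_kernel_ub_bounded).

All conditions can now be read off.  The kernel k is integrable at infinity
when |eta| < beta, and bounded there when |eta| = beta, which is enough for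
L^1 in (i), and in (ii) if moreover q = oo; these are the conditions of (i) and
(c), (d) of (ii).  Translating F shows that theta = 0, which is (b); spreading F
over long intervals gives (a).  By (b), a + b = 2 sigma - 1/p + 1/q, and (e)
says that the singularity of k at 0 is admissible.  Indeed, if a + b > 0 then k
is in L^r with 1/r = 1 + 1/q - 1/p, and Young's inequality applies (young), or
Hoelder's if q = oo; if a + b = 0 the singularity is the endpoint one, which
the Hardy-Littlewood-Sobolev inequality allows for 1 < p and q < oo
(hardy_littlewood_sobolev).  At the endpoint with p = 1 or q = oo, and for
a + b < 0, profiles concentrated or singular at 0 contradict boundedness. *)

(** * Lebesgue integrals in logarithmic coordinates *)

Section LineIntegral.
Context {R : realType}.
Local Notation mu := (@lebesgue_measure R).
Implicit Types (g : R -> \bar R) (c s u x : R).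

Lemma measurable_Rplus : measurable (@Rplus R).
Proof. exact: measurable_itv. Qed.

Let expR_nd : nondecreasing (@expR R).
Proof. by move=> x y xy; rewrite ler_expR. Qed.
Let expR_rc : right_continuous (@expR R).
Proof. by apply: right_continuousW; exact: continuous_expR. Qed.
(** The Stieltjes measure of exp gives mass e^b - e^a to ]a, b], and connects the
image of dx under ln with e^s ds. *)
HB.instance Definition _ := isCumulative.Build R _ R (@expR R) expR_nd expR_rc.

Import HBNNSimple.

(** A weighted integral of g o phi is determined by the weighted masses of the
level sets of the simple functions that approximate g.  Two such integrals
therefore agree as soon as the masses do, which reduces a change of variables
to an equality of measures. *)
Lemma weighted_pushforward d (T : measurableType d) (m : {measure set T -> \bar R})
    (phi : T -> R) (w : T -> R) g (mg : measurable_fun setT g) :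
  measurable_fun setT phi -> measurable_fun setT w -> (forall t, 0 <= w t) ->
  (forall s, 0 <= g s)%E ->
  (\int[m]_t (g (phi t) * (w t)%:E) =
   limn (fun n => \sum_(k \in range (nnsfun_approx measurableT mg n)) k%:E *
     \int[m]_t ((\1_(nnsfun_approx measurableT mg n @^-1` [set k]) (phi t))%:E * (w t)%:E)))%E.
Proof.
move=> mphi mw w0 g0.
set h := nnsfun_approx measurableT mg.
transitivity (limn (fun n => \int[m]_t ((h n (phi t))%:E * (w t)%:E)))%E.
  rewrite -monotone_convergence//.
  - apply: eq_integral => t _; apply/esym/cvg_lim => //.
    by apply: cvgeZr => //; exact: cvg_nnsfun_approx.
  - move=> n; apply: emeasurable_funM; apply/measurable_EFinP => //.
    exact: (measurableT_comp (measurable_funP (h n))).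
  - by move=> n t _; rewrite mule_ge0// lee_fin.
  - move=> t _ a b ab; rewrite lee_wpmul2r ?lee_fin//.
    exact/lefP/nd_nnsfun_approx.
congr (limn _); apply/funext => n.
have mi (k : R) : measurable_fun setT (fun t => (\1_(h n @^-1` [set k]) (phi t))%:E * (w t)%:E)%E.
  apply: emeasurable_funM; apply/measurable_EFinP => //.
  exact: measurableT_comp.
transitivity (\int[m]_t (\sum_(k \in range (h n))
    (k%:E * ((\1_(h n @^-1` [set k]) (phi t))%:E * (w t)%:E))))%E.
  apply: eq_integral => t _.
  rewrite [in LHS](fimfunE (h n) (phi t)) -fsumEFin// ge0_mule_fsuml; last first.
    by move=> k; exact: nnfun_muleindic_ge0.
  by apply: eq_fsbigr => k _; rewrite EFinM muleA.
rewrite ge0_integral_fsum//; last 2 first.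
- by move=> k; exact: measurable_funeM.
- move=> k t _; rewrite muleA mule_ge0 ?lee_fin//; exact: nnfun_muleindic_ge0.
- apply: eq_fsbigr => k; rewrite inE => -[t _ <-].
  rewrite ge0_integralZl//; first by move=> ? _; rewrite mule_ge0// lee_fin.
  by rewrite lee_fin.
Qed.

Lemma ln_Rplus_itv (a b : R) :
  @Rplus R `&` (@ln R) @^-1` `]a, b] = `]expR a, expR b]%classic.
Proof.
apply/seteqP; split => x /=; rewrite /Rplus /= !in_itv/= ?andbT.
  move=> [x0 /andP[ax xb]]; rewrite -[x]lnK ?posrE// ltr_expR ler_expR.
  by rewrite ax xb.
move=> /andP[ax xb]; have x0 : 0 < x by rewrite (lt_trans _ ax) ?expR_gt0.
split => //.
by rewrite -ltr_expR -[_ <= b]ler_expR lnK// ax xb.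
Qed.

Lemma integral_expR_itv (a b : R) : a <= b ->
  (\int[mu]_(s in `]a, b]) (expR s)%:E = (expR b - expR a)%:E)%E.
Proof.
rewrite le_eqVlt => /predU1P[->|ab].
  by rewrite set_itvoc0// integral_set0 subrr.
rewrite integral_itv_obnd_cbnd//; last first.
  by apply/measurable_EFinP/measurable_funTS.
rewrite (@continuous_FTC2 _ _ expR)//.
- apply: continuous_subspaceT; exact: continuous_expR.
- split.
  + by move=> x _; exact: derivable_expR.
  + by apply: cvg_at_right_filter; exact: continuous_expR.
  + by apply: cvg_at_left_filter; exact: continuous_expR.
- by move=> x _; rewrite derive1E; exact: (congr1 (@^~ x) (derive_expR R)).
Qed.

Definition exp_density (B : set (measurableTypeR R)) : \bar R := (\int[mu]_(s in B) (expR s)%:E)%E.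

Let exp_density0 : exp_density set0 = 0%E.
Proof. by rewrite /exp_density integral_set0. Qed.

Let exp_density_ge0 B : (0 <= exp_density B)%E.
Proof. by apply: integral_ge0 => x _; rewrite lee_fin expR_ge0. Qed.

Let exp_density_sigma_additive : semi_sigma_additive exp_density.
Proof.
move=> /= F mF tF mUF; rewrite /exp_density; apply: cvg_toP.
  apply: ereal_nondecreasing_is_cvgn => m n mn.
  apply: lee_sum_nneg_natr => // k _ _; apply: integral_ge0 => /= x Fkx.
  by rewrite lee_fin expR_ge0.
rewrite ge0_integral_bigcup//=.
by apply/measurable_EFinP/measurable_funTS.
Qed.

HB.instance Definition _ := isMeasure.Build _ _ _
  exp_density exp_density0 exp_density_ge0 exp_density_sigma_additive.

(** The image of dx under ln and the measure e^s ds both give mass e^b - e^a to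
]a, b]; they agree on Borel sets because this mass characterizes the Stieltjes
measure of exp. *)
Lemma measure_exp_image (B : set (measurableTypeR R)) : measurable B ->
  mu (@Rplus R `&` (@ln R) @^-1` B) = (\int[mu]_(s in B) (expR s)%:E)%E.
Proof.
move=> mB.
have mln : measurable_fun setT (@ln R : measurableTypeR R -> measurableTypeR R).
  exact: measurable_ln.
pose nu0 : {measure set (measurableTypeR R) -> \bar R} :=
  pushforward (mrestr mu measurable_Rplus) (@ln R : measurableTypeR R -> measurableTypeR R).
pose nu := nu0 mln.
have nuE A : nu A = mu (@Rplus R `&` (@ln R) @^-1` A).
  by rewrite /nu /= /pushforward /mrestr setIC.
pose f : cumulative R R := @expR R.
have fE (a b : R) : a <= b -> lebesgue_stieltjes_measure f `]a, b]%classic = (expR b - expR a)%:E.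
  move=> ab; rewrite /lebesgue_stieltjes_measure /measure_extension.
  by rewrite measurable_mu_extE/= ?wlength_itv_bnd//; exact: is_ocitv.
have ocitvW (X : set R) : ocitv X -> exists a b, a <= b /\ X = `]a, b]%classic.
  move=> [[a b] _ <-] /=; have [ab|ba] := leP a b; first by exists a, b.
  by exists 0, 0; rewrite set_itvoc0 set_itv_ge// bnd_simp -leNgt ltW.
rewrite -nuE; transitivity (lebesgue_stieltjes_measure f B).
  apply/esym; apply: (@lebesgue_stieltjes_measure_unique R f nu) => //.
  move=> _ /ocitvW[a [b [ab ->]]]; rewrite fE// nuE ln_Rplus_itv.
  rewrite lebesgue_measure_itv/= lte_fin ltr_expR; case: ltgtP ab => // -> _.
  by rewrite subrr.
apply: (@lebesgue_stieltjes_measure_unique R f exp_density) => //.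
move=> _ /ocitvW[a [b [ab ->]]]; rewrite fE//.
by rewrite [RHS]integral_expR_itv.
Qed.

Lemma integral_ln_Rplus g : measurable_fun setT g -> (forall s, 0 <= g s)%E ->
  (\int[mu]_(x in Rplus) g (ln x) = \int[mu]_s (g s * (expR s)%:E))%E.
Proof.
move=> mg g0.
transitivity (\int[mu]_x (g (ln x) * (\1_(@Rplus R) x)%:E))%E.
  rewrite integral_mkcond; apply: eq_integral => x _.
  by rewrite epatch_indic.
rewrite (weighted_pushforward mu mg (@measurable_ln R))//; last first.
  by apply: measurable_indic; exact: measurable_Rplus.
rewrite [RHS](weighted_pushforward mu mg (@measurable_id _ _ setT))//.
congr (limn _); apply/funext => n; apply: eq_fsbigr => k _; congr (_ * _)%E.
have mB : measurable (nnsfun_approx measurableT mg n @^-1` [set k]) by [].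
set B := _ @^-1` [set k] in mB *.
transitivity (mu (@Rplus R `&` (@ln R) @^-1` B)).
  rewrite -[RHS]mul1e -integral_cst; last first.
    apply: measurableI; first exact: measurable_Rplus.
    by rewrite -[X in measurable X]setTI; exact: measurable_ln.
  rewrite [RHS]integral_mkcond; apply: eq_integral => x _.
  rewrite epatch_indic/= mul1e -EFinM setIC indicI; congr ((_ * _)%:E).
rewrite (measure_exp_image mB) [LHS]integral_mkcond; apply: eq_integral => x _.
by rewrite epatch_indic muleC.
Qed.

Lemma integral_Rplus_expR g : measurable_fun (@Rplus R) g ->
  (forall x, 0 < x -> (0 <= g x)%E) ->
  (\int[mu]_(x in Rplus) g x = \int[mu]_s (g (expR s) * (expR s)%:E))%E.
Proof.
move=> mg g0.
have e0 s : @Rplus R (expR s) by rewrite /Rplus/= in_itv/= expR_gt0.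
rewrite -(@integral_ln_Rplus (g \o expR)).
- apply: eq_integral => x; rewrite inE /Rplus/= in_itv/= andbT => x0.
  by rewrite lnK.
- apply: (measurable_comp measurable_Rplus) => //.
  by move=> _ [s _ <-]; exact: e0.
- by move=> s; apply: g0; exact: expR_gt0.
Qed.

Lemma integral_affine (e c : R) g : e = 1 \/ e = -1 -> measurable_fun setT g ->
  (forall s, 0 <= g s)%E -> (\int[mu]_s g (e * s + c)%R = \int[mu]_s g s)%E.
Proof.
move=> e1 mg g0.
have mphi : measurable_fun setT ((fun s => e * s + c) : measurableTypeR R -> measurableTypeR R).
  apply: measurable_funD => //; exact: measurable_funM.
pose nu0 : {measure set (measurableTypeR R) -> \bar R} :=
  pushforward mu ((fun s => e * s + c) : measurableTypeR R -> measurableTypeR R).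
pose nu := nu0 mphi.
transitivity (\int[nu]_s g s)%E.
  by rewrite /nu ge0_integral_pushforward.
apply: eq_measure_integral => A mA _; apply/esym.
apply: lebesgue_measure_unique mA => _ [[a b] _ <-] /=.
rewrite /nu /pushforward.
have [e1E|e1E] : (fun s => e * s + c) @^-1` `]a, b] = `]a - c, b - c]%classic \/
  (fun s => e * s + c) @^-1` `]a, b] = `[c - b, c - a[%classic.
- case: e1 => ->; [left|right]; apply/seteqP; split => x /=; rewrite !in_itv/=; lra.
- rewrite [X in _ = mu X]e1E !lebesgue_measure_itv/= !lte_fin ltrD2r.
  by case: ifP => // _; rewrite -!EFinB; congr (_%:E); ring.
- rewrite [X in _ = mu X]e1E !lebesgue_measure_itv/= !lte_fin ltrD2l ltrN2.
  by case: ifP => // _; rewrite -!EFinB; congr (_%:E); ring.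
Qed.

Lemma integral_even (g : R -> \bar R) : measurable_fun setT g -> (forall s, 0 <= g s)%E ->
  (\int[mu]_s g `|s|%R = 2%:E * \int[mu]_(x in Rplus) g x)%E.
Proof.
move=> mg g0.
have mga : measurable_fun setT (fun s : R => g `|s|) by exact: measurableT_comp.
have E1 : (\int[mu]_(x in Rplus) g `|x|%R = \int[mu]_(x in Rplus) g x)%E.
  apply: eq_integral => x; rewrite inE /Rplus/= in_itv/= andbT => x0.
  by rewrite gtr0_norm.
have E2 : (\int[mu]_(x in `]-oo, 0%R]) g `|x|%R = \int[mu]_(x in Rplus) g x)%E.
  rewrite -integral_itv_bndo_bndc//; last exact: measurable_funTS.
  rewrite -E1 integral_mkcond [RHS]integral_mkcond.
  rewrite -(@integral_affine (-1) 0 ((fun x => g `|x|%R) \_ Rplus)).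
  - apply: eq_integral => x _; rewrite /patch addr0 mulN1r normrN.
    by rewrite !mem_setE /Rplus !in_itv/= oppr_gt0 andbT.
  - by right.
  - apply/(measurable_restrictT _ _).1; first exact: measurable_Rplus.
    exact: measurable_funTS.
  - by move=> x; apply: erestrict_ge0.
rewrite -(setUv (`]-oo, 0%R] : set R)) ge0_integral_setU//=; last 3 first.
- exact: measurableC.
- exact: measurable_funTS.
- exact/disj_setPCl.
by rewrite E2 setCitvl E1 mule_natl mule2n.
Qed.

(** Up to the factor c, the integrand is an exponential density, reflected and
moved to end at x. *)
Lemma integral_expR_ltail (c x : R) : 0 < c ->
  (\int[mu]_s (\1_`]-oo, x] s * expR (c * s))%:E = (c^-1 * expR (c * x))%:E)%E.
Proof.
move=> c0; have := integral_exponential_pdf c0.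
have mp : measurable_fun setT (fun s => (exponential_pdf c s)%:E).
  by apply/measurable_EFinP; exact: measurable_exponential_pdf.
have p0 s : (0 <= (exponential_pdf c s)%:E)%E.
  by rewrite lee_fin exponential_pdf_ge0// ltW.
rewrite -(@integral_affine (-1) x)//; last by right.
move=> E; rewrite -[RHS]mule1 -[in RHS]E -ge0_integralZl//; first last.
- by rewrite lee_fin mulr_ge0 ?expR_ge0// invr_ge0 ltW.
- apply: (measurableT_comp mp); apply: measurable_funD => //.
- apply: eq_integral => s _; rewrite -EFinM; congr (_%:E).
  rewrite /exponential_pdf patchE indicE !mem_setE !in_itv/= andbT.
  rewrite mulN1r addrC subr_ge0; case: ifPn => _; last by rewrite mulr0 mul0r.
  by rewrite mul1r mulrACA mulVf ?gt_eqF// mul1r -expRD; congr expR; ring.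
Qed.

Lemma integral_expR_rtail (c x : R) : 0 < c ->
  (\int[mu]_s (\1_`[x, +oo[ s * expR (- c * s))%:E = (c^-1 * expR (- c * x))%:E)%E.
Proof.
move=> c0; rewrite mulNr -mulrN -(@integral_expR_ltail c (- x) c0).
rewrite -(@integral_affine (-1) 0); last 3 first.
- by right.
- apply/measurable_EFinP; apply: measurable_funM => //.
  by apply: measurableT_comp => //; exact: measurable_funM.
- by move=> s; rewrite lee_fin mulr_ge0 ?expR_ge0.
apply: eq_integral => s _; rewrite addr0 mulN1r mulrNN.
by rewrite !indicE !mem_setE !in_itv/= lerNr andbT.
Qed.

Lemma integral_expR_abs (c : R) : 0 < c ->
  (\int[mu]_s (expR (- c * `|s|))%:E = (2 / c)%:E)%E.
Proof.
move=> c0; rewrite (@integral_even (fun s => (expR (- c * s))%:E)).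
- rewrite EFinM; congr (_ * _)%E.
  have := integral_expR_rtail 0 c0; rewrite mulr0 expR0 mulr1 => <-.
  rewrite /Rplus integral_itv_obnd_cbnd; last first.
    apply/measurable_EFinP; apply/measurable_funTS.
    by apply: measurableT_comp => //; exact: measurable_funM.
  rewrite integral_mkcond; apply: eq_integral => s _.
  by rewrite epatch_indic/= muleC.
- by apply/measurable_EFinP/measurableT_comp => //; exact: measurable_funM.
- by move=> s; rewrite lee_fin expR_ge0.
Qed.

Lemma powR_expR (x y : R) : expR x `^ y = expR (y * x).
Proof. by rewrite -expRM mulrC. Qed.

(** Substituting |v| = e^s turns the power into the exponential e^(c s). *)
Lemma integral_powR_near (c d : R) : 0 < c -> 0 < d ->
  (\int[mu]_v (\1_`]-oo, d] `|v|%R * `|v| `^ (c - 1))%:E = (2 / c * d `^ c)%:E)%E.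
Proof.
move=> c0 d0; have dE : d = expR (ln d) by rewrite lnK.
have m1 : measurable_fun setT (fun v : R => (\1_`]-oo, d] v * v `^ (c - 1))%:E).
  by apply/measurable_EFinP; apply: measurable_funM => //; exact: measurable_powR.
rewrite (@integral_even (fun v => (\1_`]-oo, d] v * v `^ (c - 1))%:E))//; last first.
  by move=> s; rewrite lee_fin mulr_ge0 ?powR_ge0.
rewrite integral_Rplus_expR; last 2 first.
- exact: measurable_funTS.
- by move=> s _; rewrite lee_fin mulr_ge0 ?powR_ge0.
rewrite -mulrA EFinM; congr (_ * _)%E.
rewrite dE powR_expR -(integral_expR_ltail (ln d) c0).
apply: eq_integral => s _; rewrite -EFinM -mulrA; congr ((_ * _)%:E).
  by rewrite !indicE !mem_setE !in_itv/= ler_expR.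
by rewrite powR_expR -expRD; congr expR; ring.
Qed.

Lemma integral_powR_far (c d : R) : 0 < c -> 0 < d ->
  (\int[mu]_v (\1_`[d, +oo[ `|v|%R * `|v| `^ (- c - 1))%:E = (2 / c * d `^ (- c))%:E)%E.
Proof.
move=> c0 d0; have dE : d = expR (ln d) by rewrite lnK.
have m1 : measurable_fun setT (fun v : R => (\1_`[d, +oo[ v * v `^ (- c - 1))%:E).
  by apply/measurable_EFinP; apply: measurable_funM => //; exact: measurable_powR.
rewrite (@integral_even (fun v => (\1_`[d, +oo[ v * v `^ (- c - 1))%:E))//; last first.
  by move=> s; rewrite lee_fin mulr_ge0 ?powR_ge0.
rewrite integral_Rplus_expR; last 2 first.
- exact: measurable_funTS.
- by move=> s _; rewrite lee_fin mulr_ge0 ?powR_ge0.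
rewrite -mulrA EFinM; congr (_ * _)%E.
rewrite dE powR_expR -(integral_expR_rtail (ln d) c0).
apply: eq_integral => s _; rewrite -EFinM -mulrA; congr ((_ * _)%:E).
  by rewrite !indicE !mem_setE !in_itv/= ler_expR.
by rewrite powR_expR -expRD; congr expR; ring.
Qed.

End LineIntegral.

(** * The Gamma function *)

Lemma measurable_indic_itv (R : realType) d (T : measurableType d) (f : T -> R)
    (i : interval R) : measurable_fun setT f ->
  measurable_fun setT (fun x => \1_([set` i]) (f x) : R).
Proof.
move=> mf; apply: (@measurableT_comp _ _ _ _ _ _ (\1_[set` i] : R -> R)) => //.
Qed.

(** Measurability of expressions built from measurable functions in the context by
ring operations, exp, ln, real powers, absolute values and indicators of
intervals. *)
Ltac solve_measurable := repeat first
  [ match goal with H : ?P |- ?P => exact H end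
  | lazymatch goal with
    | |- measurable_fun _ (fun _ => ?c) => exact: measurable_cst
    | |- measurable_fun _ (fun x => x) => exact: measurable_id
    | |- measurable_fun _ (fun x => (@?f x * @?g x)%R) => apply: measurable_funM
    | |- measurable_fun _ (fun x => (@?f x - @?g x)%R) => apply: measurable_funB
    | |- measurable_fun _ (fun x => (@?f x + @?g x)%R) => apply: measurable_funD
    | |- measurable_fun _ (fun x => (- @?f x)%R) => apply: measurable_funN
    | |- measurable_fun _ (fun x => expR (@?f x)) =>
        apply: (measurableT_comp (@measurable_expR _))
    | |- measurable_fun _ (fun x => ln (@?f x)) => apply: (measurableT_comp (@measurable_ln _))
    | |- measurable_fun _ (fun x => (@?f x) `^ ?p) =>
        apply: (measurableT_comp (@measurable_powR _ _))
    | |- measurable_fun _ (fun x => `|@?f x|%R) =>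
        apply: (measurableT_comp (@normr_measurable _ _))
    end
  | assumption
  | match goal with H : measurable_fun _ ?k |- measurable_fun _ (fun x => ?k _) =>
      apply: (measurableT_comp H) end
  | match goal with H : forall v, measurable_fun _ (?k v) |- measurable_fun _ (fun x => ?k _ _) =>
      apply: (measurableT_comp (H _)) end
  | exact: measurable_fst | exact: measurable_snd
  | exact: measurable_expR | exact: measurable_ln | exact: measurable_powR
  | apply: measurable_indic_itv ].

Section GammaFunction.
Context {R : realType}.
Local Notation mu := (@lebesgue_measure R).

Lemma tonelli (f : R -> R -> R) :
  measurable_fun setT (fun z : R * R => f z.1 z.2) -> (forall x y, 0 <= f x y) ->
  (\int[mu]_x \int[mu]_y (f x y)%:E = \int[mu]_y \int[mu]_x (f x y)%:E)%E.
Proof.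
move=> mf f0.
have := @fubini_tonelli _ _ _ _ _ mu mu (fun z : R * R => (f z.1 z.2)%:E).
apply; first exact/measurable_EFinP.
by move=> z; rewrite lee_fin.
Qed.

Lemma integral_ge_itv (g : R -> \bar R) (l w m : R) : 0 <= w -> 0 <= m ->
  measurable_fun setT g -> (forall s, 0 <= g s)%E ->
  (forall s, l <= s <= l + w -> (m%:E <= g s)%E) -> ((m * w)%:E <= \int[mu]_s g s)%E.
Proof.
move=> w0 m0 mg g0 mlg.
apply: (@le_trans _ _ (\int[mu]_s (m * \1_`[l, l + w] s)%:E)%E); last first.
  apply: ge0_le_integral => //.
  - by move=> s _; rewrite lee_fin mulr_ge0.
  - by apply/measurable_EFinP; solve_measurable.
  - move=> s _; rewrite indicE mem_setE in_itv/=.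
    have [sI|_] := boolP (l <= s <= l + w); first by rewrite mulr1 mlg.
    by rewrite mulr0.
under eq_integral do rewrite EFinM.
rewrite ge0_integralZl_EFin//; last first.
  by apply/measurable_EFinP; solve_measurable.
rewrite integral_indic//= setIT lebesgue_measure_itv/= lte_fin -EFinB.
rewrite ltrDl; case: ltgtP w0 => // [w0 _|<- _].
  by rewrite -EFinM lee_fin addrAC subrr add0r.
by rewrite mulr0 mule0.
Qed.

(** The integrand of Gamma s after t = e^u, Jacobian included. *)
Definition Gamma_integrand (s u : R) := expR (s * u - expR u).

Lemma measurable_Gamma_integrand s : measurable_fun setT (Gamma_integrand s).
Proof. by rewrite /Gamma_integrand; solve_measurable. Qed.

Lemma Gamma_integrandE s u :
  (expR u `^ (s - 1) * expR (- expR u)) * expR u = Gamma_integrand s u.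
Proof. by rewrite powR_expR -!expRD; congr expR; ring. Qed.

(** For u <= 0 the exponent is at most s u.  For u > 0 the tangent of exp at
ln (s + 1) gives e^u >= (s + 1) (1 + u - ln (s + 1)), so the exponent is at
most K - u. *)
Lemma integral_Gamma_lty (s : R) : 0 < s ->
  (\int[mu]_u (Gamma_integrand s u)%:E < +oo)%E.
Proof.
move=> s0; pose K := (s + 1) * ln (s + 1).
pose e := Num.min s 1.
have e0 : 0 < e by rewrite lt_min s0/=.
have es : e <= s by rewrite ge_min lexx.
have e1 : e <= 1 by rewrite ge_min lexx orbT.
have K0 : 0 <= K by rewrite mulr_ge0// ?ln_ge0//; lra.
apply: (@le_lt_trans _ _ (\int[mu]_u ((expR K)%:E * (expR (- e * `|u|))%:E))%E).
  apply: ge0_le_integral => //.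
  - by move=> u _; rewrite lee_fin expR_ge0.
  - by apply/measurable_EFinP; exact: measurable_Gamma_integrand.
  - by apply: emeasurable_funM => //; apply/measurable_EFinP; solve_measurable.
  move=> u _; rewrite -EFinM lee_fin -expRD ler_expR.
  have [u0|u0] := leP u 0.
    rewrite ler0_norm//; have := expR_gt0 u; nra.
  rewrite gtr0_norm//.
  have s1 : 0 < s + 1 by lra.
  have : (s + 1) * (1 + (u - ln (s + 1))) <= expR u.
    rewrite -[leRHS](_ : (s + 1) * expR (u - ln (s + 1)) = _).
      by rewrite ler_wpM2l ?expR_ge1Dx// ltW.
    by rewrite expRB lnK ?posrE// mulrC divfK// gt_eqF.
  rewrite /K; nra.
rewrite ge0_integralZl_EFin//.
- by rewrite integral_expR_abs// -EFinM ltry.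
- by apply/measurable_EFinP; solve_measurable.
Qed.

Lemma Gamma_line (s : R) : 0 < s -> ((Gamma s)%:E = \int[mu]_u (Gamma_integrand s u)%:E)%E.
Proof.
move=> s0; rewrite /Gamma /Rintegral.
have -> : (\int[mu]_(t in Rplus) (t `^ (s - 1) * expR (- t))%:E =
  \int[mu]_u (Gamma_integrand s u)%:E)%E.
  rewrite integral_Rplus_expR.
  - by apply: eq_integral => u _; rewrite -EFinM Gamma_integrandE.
  - by apply/measurable_EFinP/measurable_funTS; solve_measurable.
  - by move=> x _; rewrite lee_fin mulr_ge0 ?powR_ge0 ?expR_ge0.
rewrite fineK// ge0_fin_numE ?integral_Gamma_lty//.
by apply: integral_ge0 => u _; rewrite lee_fin expR_ge0.
Qed.

Lemma Gamma_gt0 (s : R) : 0 < s -> 0 < Gamma s.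
Proof.
move=> s0; rewrite -lte_fin Gamma_line//.
apply: (@lt_le_trans _ _ (expR (- expR 1) * 1)%:E).
  by rewrite lte_fin mulr1 expR_gt0.
apply: (@integral_ge_itv _ 0) => //; rewrite ?expR_ge0//.
- by apply/measurable_EFinP; exact: measurable_Gamma_integrand.
- by move=> u; rewrite lee_fin expR_ge0.
- move=> u /andP[u0 u1]; rewrite lee_fin ler_expR.
  have : expR u <= expR 1 by rewrite ler_expR; lra.
  nra.
Qed.

(** This is e^(- x) = int_x^oo e^(- t) dt at x = e^u; it replaces integration by
parts in GammaS. *)
Lemma Gamma_tail (u : R) :
  (\int[mu]_v (\1_`[0, +oo[ (v - u) * Gamma_integrand 1 v)%:E = (expR (- expR u))%:E)%E.
Proof.
have := integral_expR_rtail (expR u) (@ltr01 R).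
rewrite invr1 mul1r mulN1r => <-.
transitivity (\int[mu]_(t in Rplus) (\1_`[expR u, +oo[ t * expR (- 1 * t))%:E)%E.
  rewrite integral_Rplus_expR.
  - apply: eq_integral => v _; rewrite -EFinM -mulrA; congr ((_ * _)%:E).
      by rewrite !indicE !mem_setE !in_itv/= ler_expR subr_ge0.
    by rewrite -expRD /Gamma_integrand; congr expR; ring.
  - by apply/measurable_EFinP/measurable_funTS; solve_measurable.
  - by move=> x _; rewrite lee_fin mulr_ge0 ?expR_ge0.
rewrite integral_mkcond; apply: eq_integral => t _.
rewrite patchE mem_setE /Rplus in_itv/= andbT; case: ifPn => //.
rewrite -leNgt indicE mem_setE in_itv/= andbT => t0.
by rewrite leNgt (le_lt_trans t0 (expR_gt0 u)) mul0r.
Qed.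

(** Gamma_tail writes e^(- e^u) as an integral over v >= u.  After exchanging the
integrals the inner one is that of s e^(s u) over u <= v, that is e^(s v), and
no boundary terms appear. *)
Lemma GammaS (s : R) : 0 < s -> Gamma (s + 1) = s * Gamma s.
Proof.
move=> s0; apply: EFin_inj; rewrite EFinM !Gamma_line//; last by lra.
pose f u v := (s * expR (s * u)) * (\1_`[0, +oo[ (v - u) * Gamma_integrand 1 v).
have f0 u v : 0 <= f u v by rewrite !mulr_ge0 ?expR_ge0// ltW.
have mf : measurable_fun setT (fun z : R * R => f z.1 z.2).
  rewrite /f /Gamma_integrand/=; solve_measurable.
transitivity (\int[mu]_u \int[mu]_v (f u v)%:E)%E; last first.
  rewrite -ge0_integralZl_EFin//; last 3 first.
  - by move=> u _; rewrite lee_fin expR_ge0.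
  - by apply/measurable_EFinP; exact: measurable_Gamma_integrand.
  - exact: ltW.
  apply: eq_integral => u _.
  under eq_integral do rewrite /f EFinM.
  rewrite ge0_integralZl_EFin//.
  - rewrite Gamma_tail -!EFinM -mulrA -expRD; congr ((_ * _)%:E).
  - by move=> v _; rewrite lee_fin mulr_ge0 ?expR_ge0.
  - by apply/measurable_EFinP; rewrite /Gamma_integrand; solve_measurable.
  - by rewrite mulr_ge0 ?expR_ge0// ltW.
rewrite tonelli//; apply: eq_integral => v _.
transitivity (\int[mu]_u ((s * Gamma_integrand 1 v)%:E * (\1_`]-oo, v] u * expR (s * u))%:E))%E.
  rewrite ge0_integralZl_EFin//.
  - rewrite integral_expR_ltail// -EFinM; congr (_%:E).
    rewrite mulrACA divff ?gt_eqF// mul1r -expRD; congr expR; ring.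
  - by apply/measurable_EFinP; solve_measurable.
  - by rewrite mulr_ge0 ?expR_ge0// ltW.
apply: eq_integral => u _; rewrite -EFinM; congr (_%:E).
rewrite /f !indicE !mem_setE !in_itv/= subr_ge0 andbT.
ring.
Qed.

End GammaFunction.

(** * The kernel in logarithmic coordinates *)

#[local] Opaque Gamma.

Section KernelFormula.
Context {R : realType}.
Local Notation mu := (@lebesgue_measure R).
Implicit Types (alpha sigma s u v z x y : R).

Lemma measurable_inv : measurable_fun setT (@GRing.inv R).
Proof.
rewrite (_ : GRing.inv = fun t : R => t * (t * t) `^ (-1)); first by solve_measurable.
apply/funext => t; rewrite powR_inv1 -?expr2 ?sqr_ge0//.
have [->|t0] := eqVneq t 0; first by rewrite mul0r invr0.
by rewrite expr2 invfM mulrA divff// mul1r.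
Qed.

Lemma nneseries_EFin (w : nat -> R) : cvgn (series w) ->
  ((limn (series w))%:E = \sum_(m <oo) (w m)%:E)%E.
Proof.
move=> cw; rewrite -EFin_lim//; congr (limn _); apply/funext => n /=.
by rewrite /series/= sumEFin.
Qed.

Definition besselI_term alpha (m : nat) z : R :=
  (z / 2) `^ (2 * m%:R + alpha) / (m`!%:R * Gamma (m%:R + alpha + 1)).

Lemma Gamma_leS x : 1 <= x -> Gamma x <= Gamma (x + 1).
Proof.
move=> x1; have x0 : 0 < x := lt_le_trans ltr01 x1.
by rewrite GammaS// ler_peMl// ltW// Gamma_gt0.
Qed.

(** Gamma x <= Gamma (x + 1) = x Gamma x holds for x >= 1 only, so that the first
two values enter the bound separately. *)
Lemma Gamma_bounded_below alpha : -1 < alpha ->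
  exists2 c : R, 0 < c & forall m : nat, c <= Gamma (m%:R + alpha + 1).
Proof.
move=> a1.
have g1 : 0 < Gamma (alpha + 1) by apply: Gamma_gt0; lra.
have g2 : 0 < (alpha + 1) * Gamma (alpha + 1) by apply: mulr_gt0 => //; lra.
exists (Num.min (Gamma (alpha + 1)) ((alpha + 1) * Gamma (alpha + 1))).
  by rewrite lt_min g1 g2.
case=> [|m]; first by rewrite (add0r alpha) ge_min lexx.
elim: m => [|m IH].
  rewrite (_ : 1%:R + alpha + 1 = alpha + 1 + 1); last by rewrite (addrC 1).
  by rewrite [leRHS]GammaS; [rewrite ge_min lexx orbT|lra].
have m0 : 0 <= m%:R :> R by [].
have E1 : m.+1%:R = m%:R + 1 :> R by rewrite natr1.
have E2 : m.+2%:R = m%:R + 1 + 1 :> R by rewrite !natr1.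
rewrite (_ : m.+2%:R + alpha + 1 = m.+1%:R + alpha + 1 + 1); last by rewrite E2 E1; ring.
have m1 : 1 <= m.+1%:R + alpha + 1 by rewrite E1; clear -m0 a1; lra.
exact: (le_trans IH (Gamma_leS m1)).
Qed.

Lemma besselI_term_ge0 alpha m z : -1 < alpha -> 0 <= besselI_term alpha m z.
Proof.
move=> a1; rewrite divr_ge0 ?powR_ge0// mulr_ge0//; apply/ltW/Gamma_gt0.
by have : 0 <= m%:R :> R by []; lra.
Qed.

(** The series converges, because Gamma is bounded below along it and an
exponential series dominates it; its limit is then the extended real sum, to
which monotone convergence applies. *)
Lemma besselI_series alpha z : -1 < alpha -> 0 < z ->
  ((besselI alpha z)%:E = \sum_(m <oo) (besselI_term alpha m z)%:E)%E.
Proof.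
move=> a1 z0; rewrite -nneseries_EFin//.
have [c c0 Gc] := Gamma_bounded_below a1.
pose C := (z / 2) `^ alpha / c.
have z20 : 0 < z / 2 by rewrite divr_gt0.
apply: (@series_le_cvg _ _ (fun m => C * exp_coeff ((z / 2) ^+ 2) m)).
- by move=> m; exact: besselI_term_ge0.
- by move=> m; rewrite !mulr_ge0 ?powR_ge0 ?invr_ge0 ?exprn_ge0// ltW.
- move=> m; rewrite /besselI_term /C /exp_coeff/=.
  rewrite (addrC (2 * _)) powRD; last by apply/implyP => _; rewrite gt_eqF.
  rewrite powRrM powR_mulrn ?(ltW z20)// powR_mulrn ?exprn_ge0 ?(ltW z20)//.
  rewrite [leRHS](_ : _ = (z / 2) `^ alpha * (z / 2) ^+ 2 ^+ m * (m`!%:R^-1 * c^-1)); last by ring.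
  rewrite invfM; apply: ler_pM => //.
  + by rewrite mulr_ge0 ?powR_ge0// !exprn_ge0 ?ltW.
  + by rewrite mulr_ge0 ?invr_ge0// ltW// (lt_le_trans c0).
  + by rewrite ler_wpM2l ?invr_ge0// lef_pV2 ?posrE// (lt_le_trans c0).
- have -> : series (fun m => C * exp_coeff ((z / 2) ^+ 2) m) =
     (fun n => C * series (exp_coeff ((z / 2) ^+ 2)) n).
    by apply/funext => n; rewrite /series/= mulr_sumr.
  apply: is_cvgMr; exact: is_cvg_series_exp_coeff.
Qed.

Definition lncosh v : R := ln ((expR v + expR (- v)) / 2).

(** The coefficient D_m: what the Gamma integral of the m-th Bessel term leaves.
The powers of 2 and 4 are written as exponentials so that they combine with
the other ones. *)
Definition kernel_coef alpha sigma (m : nat) : R :=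
  Gamma (2 * m%:R + (alpha + 1 - sigma)) /
    (2 * Gamma sigma * m`!%:R * Gamma (m%:R + alpha + 1)) *
  expR ((2 * m%:R + (alpha + 1 - sigma)) * ln 2 - (2 * m%:R + alpha) * ln 4).

(** The function H, with values in the extended reals because H 0 = +oo is the
value of the kernel on the diagonal for small sigma. *)
Definition line_kernel alpha sigma v : \bar R :=
  (\sum_(m <oo) (kernel_coef alpha sigma m *
     expR (- (2 * m%:R + (alpha + 1 - sigma)) * lncosh v))%:E)%E.

Definition kernel_term alpha sigma x y (m : nat) (t : R) : R :=
  (x * y) `^ 2^-1 / (2 * t) * expR (- ((x ^+ 2 + y ^+ 2) / (4 * t)))
  * besselI_term alpha m (x * y / (2 * t)) * t `^ (sigma - 1).

Lemma expR_lncosh v : expR (lncosh v) = (expR v + expR (- v)) / 2.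
Proof. by rewrite /lncosh lnK// posrE divr_gt0// addr_gt0 ?expR_gt0. Qed.

(** For t = e^tau the exponent (x^2 + y^2) / (4t) is e^w with
w = - tau + s + u + lncosh (s - u) - ln 2, because x^2 + y^2 is
2 e^(s + u) cosh (s - u).  Hence the term is a Gamma integrand in w. *)
Lemma kernel_term_exp alpha sigma s u m tau :
  -1 < alpha -> 0 < sigma -> sigma < alpha + 1 ->
  kernel_term alpha sigma (expR s) (expR u) m (expR tau) * expR tau =
  expR ((sigma - 2^-1) * (s + u)) *
  (Gamma sigma * kernel_coef alpha sigma m / Gamma (2 * m%:R + (alpha + 1 - sigma))
    * expR (- (2 * m%:R + (alpha + 1 - sigma)) * lncosh (s - u))) *
  Gamma_integrand (2 * m%:R + (alpha + 1 - sigma)) (-1 * tau + (s + u + lncosh (s - u) - ln 2)).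
Proof.
move=> a1 s0 sa.
have m0 : 0 <= m%:R :> R by [].
set b := 2 * m%:R + (alpha + 1 - sigma).
set w := -1 * tau + _.
have Gb : Gamma b != 0 by rewrite gt_eqF// Gamma_gt0// /b; lra.
have Gs : Gamma sigma != 0 by rewrite gt_eqF// Gamma_gt0.
have Gm : Gamma (m%:R + alpha + 1) != 0 by rewrite gt_eqF// Gamma_gt0//; lra.
have fm : m`!%:R != 0 :> R by rewrite pnatr_eq0 -lt0n fact_gt0.
have e2 : expR (ln 2) = 2 :> R by rewrite lnK ?posrE.
have e4 : expR (ln 4) = 4 :> R by rewrite lnK ?posrE.
have H1 : (expR s * expR u) `^ 2^-1 / (2 * expR tau) =
    2^-1 * expR (2^-1 * (s + u) - tau).
  by rewrite -expRD powR_expR invfM expRD expRN; ring.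
have H2 : (expR s ^+ 2 + expR u ^+ 2) / (4 * expR tau) = expR w.
  rewrite /w !expRD mulN1r !expRN expR_lncosh e2 opprB !expRB.
  by field; rewrite !gt_eqF ?expR_gt0.
have H3 : expR s * expR u / (2 * expR tau) / 2 = expR (s + u - tau - ln 4).
  by rewrite !expRB expRD e4; field; rewrite gt_eqF ?expR_gt0.
rewrite /kernel_term /besselI_term H1 H2 H3 !powR_expR /kernel_coef -/b /Gamma_integrand.
have cancel_Gamma (A B C D gs gb f gm : R) : gs != 0 -> gb != 0 -> f != 0 -> gm != 0 ->
    A * (gs * (gb / (2 * gs * f * gm) * B) / gb * C) * D = 2^-1 / (f * gm) * (A * B * C * D).
  by move=> *; field; apply/and4P; split.
rewrite [RHS]cancel_Gamma//.
rewrite [LHS](_ : _ = 2^-1 / (m`!%:R * Gamma (m%:R + alpha + 1)) *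
   (expR (2^-1 * (s + u) - tau) * expR (- expR w) *
   expR ((2 * m%:R + alpha) * (s + u - tau - ln 4)) *
   expR ((sigma - 1) * tau) * expR tau)); last by ring.
by congr (_ * _); rewrite -!expRD; congr expR; rewrite /w /b; field.
Qed.

Lemma potential_kernel_exp alpha sigma s u :
  -1 < alpha -> 0 < sigma -> sigma < alpha + 1 ->
  (potential_kernel alpha sigma (expR s) (expR u) =
   (expR ((sigma - 2^-1) * (s + u)))%:E * line_kernel alpha sigma (s - u))%E.
Proof.
move=> a1 s0 sa; rewrite /potential_kernel.
set x := expR s; set y := expR u.
have x0 : 0 < x := expR_gt0 _.
have y0 : 0 < y := expR_gt0 _.
have h0 m t : 0 < t -> 0 <= kernel_term alpha sigma x y m t.
  move=> t0; rewrite /kernel_term mulr_ge0 ?powR_ge0// mulr_ge0 ?besselI_term_ge0//.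
  by rewrite mulr_ge0 ?expR_ge0// divr_ge0 ?powR_ge0// mulr_ge0// ltW.
have mh m : measurable_fun setT (kernel_term alpha sigma x y m).
  rewrite /kernel_term /besselI_term.
  have mi : measurable_fun setT (fun t : R => (2 * t)^-1).
    by apply: (measurableT_comp measurable_inv); solve_measurable.
  have mi4 : measurable_fun setT (fun t : R => (4 * t)^-1).
    by apply: (measurableT_comp measurable_inv); solve_measurable.
  solve_measurable.
pose b m := 2 * m%:R + (alpha + 1 - sigma).
have b0 m : 0 < b m by rewrite /b; have : 0 <= m%:R :> R by []; lra.
transitivity ((Gamma sigma)^-1%:E * \sum_(m <oo)
    (\int[mu]_(t in Rplus) (kernel_term alpha sigma x y m t)%:E))%E.
  congr (_ * _)%E; rewrite -integral_nneseries.
  - apply: eq_integral => t; rewrite inE /Rplus/= in_itv/= andbT => t0.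
    rewrite /heat_kernel mulrAC EFinM besselI_series//; last first.
      by rewrite divr_gt0 ?mulr_gt0.
    rewrite -nneseriesZl; last by move=> m _; rewrite lee_fin besselI_term_ge0.
    by apply: eq_eseriesr => m _; rewrite -EFinM /kernel_term mulrAC.
  - exact: measurable_Rplus.
  - by move=> m; apply/measurable_EFinP; apply: measurable_funTS; exact: mh.
  - by move=> m t; rewrite /Rplus/= in_itv/= andbT => t0; rewrite lee_fin h0.
have kc0 m : 0 <= kernel_coef alpha sigma m.
  rewrite /kernel_coef mulr_ge0 ?expR_ge0// divr_ge0//.
    by apply/ltW/Gamma_gt0; exact: b0.
  rewrite !mulr_ge0//; apply/ltW/Gamma_gt0 => //.
  by have : 0 <= m%:R :> R by []; lra.
rewrite -!nneseriesZl; last 2 first.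
- by move=> m _; rewrite lee_fin mulr_ge0 ?expR_ge0.
- move=> m _; apply: integral_ge0 => t; rewrite /Rplus/= in_itv/= andbT => t0.
  by rewrite lee_fin h0.
apply: eq_eseriesr => m _.
rewrite integral_Rplus_expR; last 2 first.
- by apply/measurable_EFinP; apply: measurable_funTS; exact: mh.
- by move=> t t0; rewrite lee_fin h0.
under eq_integral do rewrite -EFinM kernel_term_exp// EFinM.
rewrite ge0_integralZl_EFin//.
- rewrite (@integral_affine _ (-1) _ (fun w => (Gamma_integrand (b m) w)%:E)).
  + rewrite -Gamma_line// -!EFinM; congr (_%:E).
    rewrite -/(b m); field.
    by rewrite !gt_eqF ?Gamma_gt0.
  + by right.
  + by apply/measurable_EFinP; exact: measurable_Gamma_integrand.
  + by move=> w; rewrite lee_fin expR_ge0.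
- by move=> w _; rewrite lee_fin expR_ge0.
- apply/measurable_EFinP; apply: (measurableT_comp (measurable_Gamma_integrand _)).
  by solve_measurable.
- apply: mulr_ge0; first exact: expR_ge0.
  apply: mulr_ge0; last exact: expR_ge0.
  apply: divr_ge0; last exact/ltW/Gamma_gt0/b0.
  by apply: mulr_ge0; [exact/ltW/Gamma_gt0|exact: kc0].
Qed.

End KernelFormula.

(** * Size of the convolution kernel *)

Section KernelBounds.
Context {R : realType}.
Local Notation mu := (@lebesgue_measure R).

(** Since A + B <= D1 + D2, consecutive ratios of w are at most
1 + A B / ((m + D1) (m + D2)).  The exponential of K / (m + eta) decreases by a
factor that compensates for this, so w m exp (K / (m + eta)) is nonincreasing. *)
Lemma ratio_bounded (w : nat -> R) (A B D1 D2 : R) :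
  0 < A -> 0 < B -> 0 < D1 -> 0 < D2 -> A + B <= D1 + D2 ->
  (forall m, 0 <= w m) ->
  (forall m, w m.+1 * ((m%:R + D1) * (m%:R + D2)) = w m * ((m%:R + A) * (m%:R + B))) ->
  exists2 C, 0 < C & forall m, w m <= C.
Proof.
move=> A0 B0 D10 D20 ABD w0 wS.
(* eta is chosen so that (m + eta)^2 <= (m + D1) (m + D2). *)
pose eta := Num.min D1 D2.
have eta0 : 0 < eta by rewrite lt_min D10.
have eta1 : eta <= D1 by rewrite ge_min lexx.
have eta2 : eta <= D2 by rewrite ge_min lexx orbT.
pose K := A * B * (1 + eta^-1).
pose a (m : nat) : R := (m%:R + eta)^-1.
have step m : w m.+1 * expR (K * a m.+1) <= w m * expR (K * a m).
  have m0 : 0 <= m%:R :> R by [].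
  set P := (m%:R + A) * (m%:R + B); set Q := (m%:R + D1) * (m%:R + D2).
  have Q0 : 0 < Q by rewrite mulr_gt0// ltr_wpDl.
  have me0 : 0 < m%:R + eta by rewrite ltr_wpDl.
  have -> : w m.+1 = w m * (P / Q) by rewrite mulrA -wS mulfK// gt_eqF.
  rewrite -mulrA ler_wpM2l//.
  have -> : K * a m = K * (a m - a m.+1) + K * a m.+1 by rewrite -mulrDr subrK.
  rewrite [leRHS]expRD ler_wpM2r ?expR_ge0//.
  apply: le_trans (expR_ge1Dx _).
  have -> : a m - a m.+1 = ((m%:R + eta) * (m%:R + 1 + eta))^-1.
    rewrite /a -[m.+1%:R]natr1; field.
    by apply/andP; split; rewrite gt_eqF//; lra.
  have PQ : P <= Q + A * B.
    by rewrite /P /Q; clearbody K a eta; nra.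
  apply: (@le_trans _ _ (1 + A * B / Q)).
    by rewrite ler_pdivrMr// mulrDl mul1r divfK// gt_eqF.
  rewrite lerD2l /K -[leRHS]mulrA; apply: ler_wpM2l; first exact: mulr_ge0 (ltW A0) (ltW B0).
  rewrite ler_pdivlMr ?mulr_gt0//; last by lra.
  rewrite mulrC ler_pdivrMr//.
  have -> : (1 + eta^-1) * Q = Q + Q / eta by rewrite mulrDl mul1r (mulrC _^-1).
  have Q1 : (m%:R + eta) * (m%:R + eta) <= Q by rewrite ler_pM ?lerD2l// ltW.
  have Q2 : m%:R + eta <= Q / eta.
    by rewrite ler_pdivlMr//; apply: le_trans Q1; rewrite ler_pM2l//; lra.
  have -> : (m%:R + eta) * (m%:R + 1 + eta) =
    (m%:R + eta) * (m%:R + eta) + (m%:R + eta) by ring.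
  exact: lerD.
have bound m : w m * expR (K * a m) <= w 0%N * expR (K * a 0%N).
  by elim: m => [//|m IH]; exact: le_trans (step m) IH.
exists (w 0%N * expR (K * a 0%N) + 1).
  by rewrite ltr_wpDl// mulr_ge0// expR_ge0.
move=> m; apply: (@le_trans _ _ (w m * expR (K * a m))).
  have K0 : 0 <= K * a m.
    have AB := mulr_ge0 (ltW A0) (ltW B0).
    have e1 : 0 <= eta^-1 by rewrite invr_ge0 ltW.
    apply: mulr_ge0; first by rewrite mulr_ge0// addr_ge0.
    by rewrite invr_ge0 addr_ge0// ltW.
  by rewrite ler_peMr// -expR0 ler_expR.
by apply: (le_trans (bound m)); rewrite lerDl.
Qed.

Lemma expR_series (x : R) : 0 <= x -> ((expR x)%:E = \sum_(m <oo) (x ^+ m / m`!%:R)%:E)%E.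
Proof.
move=> x0; rewrite -(nneseries_EFin (is_cvg_series_exp_coeff x)).
by [].
Qed.

(** Gamma delta times the coefficient of rho^m in (1 - rho)^(- delta). *)
Definition binomial_coef (delta : R) (m : nat) : R := Gamma (m%:R + delta) / m`!%:R.

Lemma binomial_coef_gt0 delta m : 0 < delta -> 0 < binomial_coef delta m.
Proof.
move=> d0; rewrite divr_gt0 ?ltr0n ?fact_gt0//; apply: Gamma_gt0.
by rewrite ltr_wpDl.
Qed.

Lemma binomial_coefS delta m : 0 < delta ->
  binomial_coef delta m.+1 * (m%:R + 1) = binomial_coef delta m * (m%:R + delta).
Proof.
move=> d0; rewrite /binomial_coef -natr1 (_ : m%:R + 1 + delta = m%:R + delta + 1); last by ring.
rewrite GammaS ?ltr_wpDl// factS natrM -natr1; field.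
by rewrite pnatr_eq0 -lt0n fact_gt0/= gt_eqF.
Qed.

(** Summed under the Gamma integral, the series gives e^(rho e^u), so that e^u is
replaced by (1 - rho) e^u; a translation of u takes this factor out. *)
Lemma binomial_series delta rho : 0 < delta -> 0 <= rho < 1 ->
  (\sum_(m <oo) (binomial_coef delta m * rho ^+ m)%:E =
   (Gamma delta * (1 - rho) `^ (- delta))%:E)%E.
Proof.
move=> d0 /andP[r0 r1].
have t0 : 0 < 1 - rho by rewrite subr_gt0.
transitivity (\sum_(m <oo) \int[mu]_u
   (rho ^+ m / m`!%:R * Gamma_integrand (m%:R + delta) u)%:E)%E.
  apply: eq_eseriesr => m _.
  under eq_integral do rewrite EFinM.
  rewrite ge0_integralZl_EFin//.
  - rewrite -Gamma_line ?ltr_wpDl// -EFinM; congr (_%:E).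
    by rewrite /binomial_coef; ring.
  - by move=> u _; rewrite lee_fin expR_ge0.
  - by apply/measurable_EFinP; exact: measurable_Gamma_integrand.
  - by rewrite divr_ge0// exprn_ge0.
rewrite -integral_nneseries//; last 2 first.
- move=> m; apply/measurable_EFinP; apply: measurable_funM => //.
  exact: measurable_Gamma_integrand.
- by move=> m u _; rewrite lee_fin mulr_ge0 ?expR_ge0// divr_ge0// exprn_ge0.
transitivity (\int[mu]_u ((1 - rho) `^ (- delta) *
    Gamma_integrand delta (1 * u + ln (1 - rho))%R)%:E)%E.
  apply: eq_integral => u _.
  transitivity ((expR (delta * u - expR u))%:E *
      \sum_(m <oo) ((rho * expR u) ^+ m / m`!%:R)%:E)%E.
    rewrite -nneseriesZl; last first.
      by move=> m _; rewrite lee_fin divr_ge0// exprn_ge0// mulr_ge0// expR_ge0.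
    apply: eq_eseriesr => m _; rewrite -EFinM; congr (_%:E).
    rewrite /Gamma_integrand exprMn -expRM_natl mulrDl -addrA expRD; ring.
  rewrite -expR_series ?mulr_ge0 ?expR_ge0// -EFinM -expRD; congr (_%:E).
  rewrite -[in RHS](lnK (x := 1 - rho)) ?posrE// powR_expR /Gamma_integrand -expRD.
  congr expR; rewrite expRK mul1r [in RHS]expRD lnK ?posrE//; ring.
under eq_integral do rewrite EFinM.
rewrite ge0_integralZl_EFin ?powR_ge0//.
- rewrite (@integral_affine _ 1 _ (fun w => (Gamma_integrand delta w)%:E)).
  + by rewrite -Gamma_line// -EFinM mulrC.
  + by left.
  + by apply/measurable_EFinP; exact: measurable_Gamma_integrand.
  + by move=> w; rewrite lee_fin expR_ge0.
- by move=> u _; rewrite lee_fin expR_ge0.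
- apply/measurable_EFinP; apply: (measurableT_comp (measurable_Gamma_integrand _)).
  by solve_measurable.
Qed.

Section lncosh_bounds.
Implicit Types v : R.

Lemma lncosh_abs v : lncosh v = lncosh `|v|.
Proof.
have [v0|v0] := leP 0 v; first by rewrite ger0_norm.
by rewrite ltr0_norm// /lncosh opprK addrC.
Qed.

Lemma lncosh_le v : lncosh v <= `|v|.
Proof.
rewrite lncosh_abs -ler_expR expR_lncosh.
have : expR (- `|v|) <= expR `|v| by rewrite ler_expR ge0_cp.
by move=> ?; lra.
Qed.

Lemma lncosh_ge v : `|v| - ln 2 <= lncosh v.
Proof.
rewrite lncosh_abs -ler_expR expR_lncosh expRB lnK ?posrE//.
by have := expR_gt0 (- `|v|); lra.
Qed.

Lemma expR_double (x : R) : expR (2 * x) = expR x ^+ 2.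
Proof. by rewrite expr2 -expRD; congr expR; ring. Qed.

(** 1 / cosh^2 v, the variable of the power series in line_kernelE. *)
Definition sech2 v := expR (- 2 * lncosh v).

(** The right-hand side is tanh^2 |v|. *)
Lemma sech2E v : 1 - sech2 v =
  ((1 - expR (- 2 * `|v|)) / (1 + expR (- 2 * `|v|))) ^+ 2.
Proof.
rewrite /sech2 lncosh_abs !mulNr !expRN !expR_double expR_lncosh expRN.
have := expR_gt0 `|v|; set e := expR _ => e0.
have : 0 < e ^+ 2 by rewrite exprn_gt0.
by move=> e2; field; rewrite !gt_eqF//=; nra.
Qed.

Lemma sech2_gt0 v : 0 < sech2 v. Proof. exact: expR_gt0. Qed.

(** |v| / (1 + 2 |v|) <= tanh |v| <= 2 |v| follows from
1 - 2 |v| <= e^(- 2 |v|) <= 1 / (1 + 2 |v|). *)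
Lemma sech2_bounds v : (`|v| / (1 + 2 * `|v|)) ^+ 2 <= 1 - sech2 v <= (2 * `|v|) ^+ 2.
Proof.
rewrite sech2E; set x := `|v|; have x0 : 0 <= x := normr_ge0 _.
set y := expR _; have y0 : 0 < y := expR_gt0 _.
have y1 : 1 + - 2 * x <= y := expR_ge1Dx _.
have y2 : y * (1 + 2 * x) <= 1.
  have ye : y * expR (2 * x) = 1 by rewrite -expRD mulNr addNr expR0.
  by rewrite -[leRHS]ye ler_wpM2l ?expR_ge1Dx// ltW.
have y3 : y <= 1 by rewrite -[leRHS](expR0 R) ler_expR; lra.
have lo : x / (1 + 2 * x) <= (1 - y) / (1 + y).
  rewrite ler_pdivrMr; last by lra.
  by rewrite mulrAC ler_pdivlMr; [nra|lra].
have hi : (1 - y) / (1 + y) <= 2 * x.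
  by rewrite ler_pdivrMr; [nra|lra].
have lo0 : 0 <= x / (1 + 2 * x) by rewrite divr_ge0//; lra.
have mid0 := le_trans lo0 lo.
by apply/andP; split; rewrite lerXn2r ?nnegrE ?(mulr_ge0 _ x0).
Qed.

Lemma sech2_lt1 v : v != 0 -> sech2 v < 1.
Proof.
move=> v0; rewrite -subr_gt0; case/andP: (sech2_bounds v) => + _; apply: lt_le_trans.
by rewrite exprn_gt0// divr_gt0 ?normr_gt0//.
Qed.

End lncosh_bounds.

Section bounds.
Variables alpha sigma : R.
Hypotheses (halpha : -1 < alpha) (hsigma0 : 0 < sigma) (hsigma : sigma < alpha + 1).
Ltac hlra := move: halpha hsigma0 hsigma => /= ? ? ?; lra.
Let beta := alpha + 1 - sigma.
Let beta0 : 0 < beta. Proof. by rewrite /beta; hlra. Qed.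
Let u := kernel_coef alpha sigma.
Let H := line_kernel alpha sigma.

Lemma kernel_coef_gt0 m : 0 < u m.
Proof.
have m0 : 0 <= m%:R :> R by [].
have bm : 0 < 2 * m%:R + (alpha + 1 - sigma) by (have := beta0; hlra).
have am : 0 < m%:R + alpha + 1 by (have := beta0; hlra).
rewrite /u /kernel_coef; apply: mulr_gt0; last exact: expR_gt0.
apply: divr_gt0; first exact: Gamma_gt0.
apply: mulr_gt0; last exact: Gamma_gt0.
apply: mulr_gt0; last by rewrite ltr0n fact_gt0.
by apply: mulr_gt0 => //; exact: Gamma_gt0.
Qed.

(** The recurrence of a hypergeometric series with upper entries beta / 2 and
(beta + 1) / 2 and lower entry alpha + 1; the upper ones come from
Gamma (2m + beta), which advances by two steps. *)
Lemma kernel_coefS m : u m.+1 * ((m%:R + 1) * (m%:R + (alpha + 1))) =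
  u m * ((m%:R + beta / 2) * (m%:R + (beta + 1) / 2)).
Proof.
have m0 : 0 <= m%:R :> R by [].
rewrite /u /kernel_coef -/beta -[m.+1%:R]natr1.
rewrite (_ : 2 * (m%:R + 1) + beta = 2 * m%:R + beta + 1 + 1); last by ring.
rewrite (@GammaS _ (2 * m%:R + beta + 1)); last by (have := beta0; hlra).
rewrite (@GammaS _ (2 * m%:R + beta)); last by (have := beta0; hlra).
rewrite (_ : m%:R + 1 + alpha + 1 = m%:R + alpha + 1 + 1); last by ring.
rewrite (@GammaS _ (m%:R + alpha + 1)); last by (have := beta0; hlra).
rewrite factS natrM -[m.+1%:R]natr1.
have bm : 0 < 2 * m%:R + beta by (have := beta0; hlra).
have am : 0 < m%:R + alpha + 1 by (have := beta0; hlra).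
have Gs : Gamma sigma != 0 by rewrite gt_eqF// Gamma_gt0.
have Gm : Gamma (m%:R + alpha + 1) != 0 by rewrite gt_eqF// Gamma_gt0.
have fm : m`!%:R != 0 :> R by rewrite pnatr_eq0 -lt0n fact_gt0.
have -> : expR ((2 * m%:R + beta + 1 + 1) * ln 2 - (2 * (m%:R + 1) + alpha) * ln 4) =
  4^-1 * expR ((2 * m%:R + beta) * ln 2 - (2 * m%:R + alpha) * ln 4).
  rewrite (_ : 4^-1 = expR (2 * ln 2 - 2 * ln 4)).
    by rewrite -expRD; congr expR; ring.
  rewrite expRB !expR_double !lnK ?posrE//; by field.
set E := expR _.
have key (g b gs f gm e mm a : R) : gs != 0 -> f != 0 -> gm != 0 -> mm + 1 != 0 -> mm + a + 1 != 0 ->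
   (2 * mm + b + 1) * ((2 * mm + b) * g) / (2 * gs * ((mm + 1) * f) * ((mm + a + 1) * gm)) *
   (4^-1 * e) * ((mm + 1) * (mm + (a + 1))) =
   g / (2 * gs * f * gm) * e * ((mm + b / 2) * (mm + (b + 1) / 2)).
  by move=> *; field; do ?[apply/andP; split].
by apply: key => //; rewrite gt_eqF//; have := beta0; hlra.
Qed.

Lemma line_kernelE v : H v = ((expR (- beta * lncosh v))%:E *
  \sum_(m <oo) (u m * sech2 v ^+ m)%:E)%E.
Proof.
rewrite -nneseriesZl; last first.
  by move=> m _; rewrite lee_fin mulr_ge0 ?exprn_ge0 ?ltW ?kernel_coef_gt0 ?sech2_gt0.
apply: eq_eseriesr => m _; rewrite -EFinM; congr (_%:E).
rewrite mulrCA; congr (_ * _); rewrite /sech2 -expRM_natl -expRD; congr expR.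
by rewrite -/beta; ring.
Qed.

(** The quotient of the two sequences satisfies the recurrence of ratio_bounded,
and the condition there on the sums reads tau <= sigma. *)
Lemma kernel_coef_le_binomial tau : 0 < tau -> tau < 2^-1 -> tau <= sigma ->
  exists2 C, 0 < C & forall m, u m <= C * binomial_coef (2^-1 - tau) m.
Proof.
move=> t0 t1 ts.
have d0 : 0 < 2^-1 - tau by (have := beta0; hlra).
have [||||||m|C C0 Cw] := @ratio_bounded (fun m => u m / binomial_coef (2^-1 - tau) m)
  (beta / 2) ((beta + 1) / 2) (alpha + 1) (2^-1 - tau).
- by rewrite divr_gt0.
- by rewrite divr_gt0// addr_gt0.
- by (have := beta0; hlra).
- by (have := beta0; hlra).
- by rewrite /beta; hlra.
- by move=> m; rewrite divr_ge0// ltW// ?kernel_coef_gt0 ?binomial_coef_gt0.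
- have := kernel_coefS m; have := binomial_coefS m d0.
  have := binomial_coef_gt0 m d0; have := binomial_coef_gt0 m.+1 d0.
  have m0 : 0 <= m%:R :> R by [].
  set v' := binomial_coef _ _; set v := binomial_coef _ _ => v'0 v_0 vE uE.
  have -> : v' = v * (m%:R + (2^-1 - tau)) / (m%:R + 1) by rewrite -vE mulfK// gt_eqF//; have := beta0; hlra.
  rewrite [RHS]mulrAC -uE; field.
  by rewrite !gt_eqF//; have := beta0; hlra.
- exists C => // m; rewrite -ler_pdivrMr//; exact: binomial_coef_gt0.
Qed.

Lemma kernel_coef_ge_binomial : sigma < 2^-1 ->
  exists2 c, 0 < c & forall m, c * binomial_coef (2^-1 - sigma) m <= u m.
Proof.
move=> s1.
have d0 : 0 < 2^-1 - sigma by (have := beta0; hlra).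
have [||||||m|C C0 Cw] := @ratio_bounded (fun m => binomial_coef (2^-1 - sigma) m / u m)
  (alpha + 1) (2^-1 - sigma) (beta / 2) ((beta + 1) / 2).
- by (have := beta0; hlra).
- by (have := beta0; hlra).
- by rewrite divr_gt0.
- by rewrite divr_gt0// addr_gt0.
- by rewrite /beta; hlra.
- by move=> m; rewrite divr_ge0// ltW// ?kernel_coef_gt0 ?binomial_coef_gt0.
- have := kernel_coefS m; have := binomial_coefS m d0.
  have := kernel_coef_gt0 m; have := kernel_coef_gt0 m.+1.
  have m0 : 0 <= m%:R :> R by [].
  set v' := binomial_coef _ _; set v := binomial_coef _ _ => u'0 u_0 vE uE.
  have -> : v' = v * (m%:R + (2^-1 - sigma)) / (m%:R + 1) by rewrite -vE mulfK// gt_eqF//; have := beta0; hlra.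
  have u'E : u m.+1 = u m * ((m%:R + beta / 2) * (m%:R + (beta + 1) / 2)) /
     ((m%:R + 1) * (m%:R + (alpha + 1))).
    by rewrite -uE mulfK// gt_eqF// mulr_gt0//; have := beta0; hlra.
  rewrite u'E; field.
  have := beta0; rewrite !gt_eqF//; have := beta0; hlra.
- exists C^-1; first by rewrite invr_gt0.
  move=> m; rewrite mulrC ler_pdivrMr// mulrC -ler_pdivrMr//; exact: kernel_coef_gt0.
Qed.

Let term_ge0 m v : (0 <= (u m * sech2 v ^+ m)%:E)%E.
Proof.
by rewrite lee_fin mulr_ge0 ?exprn_ge0 ?(ltW (sech2_gt0 _)) ?(ltW (kernel_coef_gt0 _)).
Qed.

Lemma line_kernel_ge0 v : (0 <= H v)%E.
Proof.
rewrite line_kernelE mule_ge0 ?lee_fin ?expR_ge0//.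
by apply: nneseries_ge0 => m _ _; exact: term_ge0.
Qed.

Lemma measurable_line_kernel : measurable_fun setT H.
Proof.
apply: ge0_emeasurable_sum => [m v _ _|m _].
  by rewrite lee_fin mulr_ge0 ?expR_ge0// (ltW (kernel_coef_gt0 _)).
apply/measurable_EFinP; apply: measurable_funM => //.
apply: (measurableT_comp (@measurable_expR R)); apply: measurable_funM => //.
rewrite /lncosh; apply: (measurableT_comp (@measurable_ln R)).
by solve_measurable.
Qed.

Lemma expR_lncosh_ub v :
  expR (- beta * lncosh v) <= expR (beta * ln 2) * expR (- beta * `|v|).
Proof.
rewrite -expRD ler_expR.
have := lncosh_ge v; have := beta0; nra.
Qed.

Lemma expR_lncosh_lb v : expR (- beta * `|v|) <= expR (- beta * lncosh v).
Proof. by rewrite ler_expR; have := lncosh_le v; have := beta0; nra. Qed.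

Lemma sech2_powR_ub (d v : R) : 0 < d -> d < 1 -> v != 0 ->
  (1 - sech2 v) `^ (- (d / 2)) <= 3 * (1 + `|v| `^ (- d)).
Proof.
move=> d0 d1 v0; set x := `|v|; have x0 : 0 < x by rewrite normr_gt0.
have /andP[lo _] := sech2_bounds v; rewrite -/x in lo.
set y := x / (1 + 2 * x) in lo.
have y0 : 0 < y by rewrite divr_gt0//; lra.
apply: (@le_trans _ _ (y^-1 `^ d)).
  have -> : y^-1 `^ d = (y ^+ 2) `^ (- (d / 2)).
    rewrite -powR_mulrn ?(ltW y0)// -powRrM (_ : 2 * - (d / 2) = - d); last by field.
    by rewrite -powR_inv1 ?(ltW y0)// -powRrM mulN1r.
  rewrite !powRN lef_pV2 ?posrE ?powR_gt0 ?exprn_gt0//; last by rewrite (lt_le_trans _ lo) ?exprn_gt0.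
  by rewrite ge0_ler_powR ?nnegrE ?exprn_ge0 ?(ltW y0) ?(le_trans _ lo) ?exprn_ge0 ?(ltW y0)//; lra.
have yE : y^-1 = (1 + 2 * x) / x by rewrite invf_div.
have p3 : (3 : R) `^ d <= 3 by rewrite ler1_powR ?ler1n// ltW.
have x1 : 0 <= x `^ (- d) := powR_ge0 _ _.
have yi : 0 <= y^-1 by rewrite invr_ge0 ltW.
have [x1l|x1g] := leP 1 x.
  apply: (@le_trans _ _ (3 `^ d)); last by lra.
  by rewrite ge0_ler_powR ?nnegrE ?(ltW d0)// yE ler_pdivrMr//; lra.
apply: (@le_trans _ _ ((3 / x) `^ d)).
  have : y^-1 <= 3 / x by rewrite yE ler_pM2r ?invr_gt0//; lra.
  by move=> h; rewrite ge0_ler_powR ?nnegrE ?(ltW d0) ?(le_trans yi h).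
rewrite powRM ?invr_ge0 ?(ltW x0)// -powR_inv1 ?(ltW x0)// -powRrM mulN1r.
by have := powR_ge0 3 d; nra.
Qed.

Lemma sech2_powR_lb (d v : R) : 0 < d -> d < 1 -> v != 0 ->
  2^-1 * `|v| `^ (- d) <= (1 - sech2 v) `^ (- (d / 2)).
Proof.
move=> d0 d1 v0; set x := `|v|; have x0 : 0 < x by rewrite normr_gt0.
have /andP[lo hi] := sech2_bounds v; rewrite -/x in lo hi.
have r0 : 0 < 1 - sech2 v by rewrite subr_gt0 sech2_lt1.
have y0 : 0 < 2 * x by lra.
apply: (@le_trans _ _ ((2 * x) `^ (- d))).
  rewrite powRM ?(ltW x0)// ler_wpM2r ?powR_ge0//.
  rewrite powRN lef_pV2 ?posrE ?powR_gt0//.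
  by rewrite ler1_powR ?ler1n// ltW.
have -> : (2 * x) `^ (- d) = ((2 * x) ^+ 2) `^ (- (d / 2)).
  by rewrite -powR_mulrn ?(ltW y0)// -powRrM; congr (_ `^ _); field.
rewrite !powRN lef_pV2 ?posrE ?powR_gt0 ?exprn_gt0//.
by rewrite ge0_ler_powR ?nnegrE ?exprn_ge0 ?(ltW y0) ?(ltW r0)//; lra.
Qed.

(** For sigma < 1/2 the choice tau = sigma gives the order of the singularity; for
sigma >= 1/2, taking tau close to 1/2 makes the exponent 2 tau - 1 as close to
0 as needed. *)
Lemma line_kernel_ub tau : 0 < tau -> tau < 2^-1 -> tau <= sigma ->
  exists2 C, 0 < C & forall v, v != 0 ->
    (H v <= (C * (expR (- beta * `|v|) * (1 + `|v| `^ (2 * tau - 1))))%:E)%E.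
Proof.
move=> t0 t1 ts; have [C C0 uC] := kernel_coef_le_binomial t0 t1 ts.
have d0 : 0 < 2^-1 - tau by lra.
have G0 := Gamma_gt0 d0.
exists (expR (beta * ln 2) * (C * Gamma (2^-1 - tau) * 3)).
  by rewrite !mulr_gt0 ?expR_gt0.
move=> v v0; rewrite line_kernelE.
have rho1 := sech2_lt1 v0; have rho0 := ltW (sech2_gt0 v).
have S : (\sum_(m <oo) (u m * sech2 v ^+ m)%:E <=
    (C * (Gamma (2^-1 - tau) * (1 - sech2 v) `^ (- (2^-1 - tau))))%:E)%E.
  rewrite EFinM -binomial_series ?rho0 ?rho1//.
  rewrite -nneseriesZl; last first.
    by move=> m _; rewrite lee_fin mulr_ge0 ?exprn_ge0// (ltW (binomial_coef_gt0 _ d0)).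
  apply: lee_nneseries => m _; first by move=> _; exact: term_ge0.
  by rewrite -EFinM lee_fin mulrA ler_wpM2r ?exprn_ge0.
apply: (@le_trans _ _ ((expR (beta * ln 2) * expR (- beta * `|v|))%:E *
   (C * (Gamma (2^-1 - tau) * (3 * (1 + `|v| `^ (2 * tau - 1)))))%:E)%E); last first.
  rewrite -EFinM lee_fin le_eqVlt; apply/orP; left; apply/eqP; ring.
apply: lee_pmul; rewrite ?lee_fin ?expR_ge0//.
- by apply: nneseries_ge0 => m _ _; exact: term_ge0.
- exact: expR_lncosh_ub.
- apply: (le_trans S); rewrite lee_fin ler_wpM2l ?(ltW C0)// ler_wpM2l ?(ltW G0)//.
  have d20 : 0 < 1 - 2 * tau by lra.
  have d21 : 1 - 2 * tau < 1 by lra.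
  have := sech2_powR_ub d20 d21 v0.
  by rewrite (_ : - ((1 - 2 * tau) / 2) = - (2^-1 - tau)) ?opprB//; field.
Qed.

(** The term m = 0 of the series suffices. *)
Lemma line_kernel_lb : exists2 c, 0 < c &
  forall v, ((c * expR (- beta * `|v|))%:E <= H v)%E.
Proof.
exists (u 0); first exact: kernel_coef_gt0.
move=> v; rewrite line_kernelE.
apply: (@le_trans _ _ ((expR (- beta * lncosh v))%:E * (u 0)%:E)%E).
  by rewrite -EFinM lee_fin mulrC ler_wpM2r ?(ltW (kernel_coef_gt0 _))// expR_lncosh_lb.
rewrite lee_pmul2l ?lte_fin ?expR_gt0//.
have := @nneseries_lim_ge R (fun m => (u m * sech2 v ^+ m)%:E) xpredT 0 1.
by rewrite big_nat1 expr0 mulr1; apply => m _ _; exact: term_ge0.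
Qed.

Lemma line_kernel_lb_singular : sigma < 2^-1 -> exists2 c, 0 < c &
  forall v, v != 0 -> `|v| <= 1 -> ((c * `|v| `^ (2 * sigma - 1))%:E <= H v)%E.
Proof.
move=> s1; have [c c0 uc] := kernel_coef_ge_binomial s1.
have d0 : 0 < 2^-1 - sigma by lra.
have G0 := Gamma_gt0 d0.
exists (expR (- beta) * (c * (Gamma (2^-1 - sigma) * 2^-1))).
  by rewrite !mulr_gt0 ?expR_gt0.
move=> v v0 v1; rewrite line_kernelE.
have rho1 := sech2_lt1 v0; have rho0 := ltW (sech2_gt0 v).
rewrite -mulrA EFinM; apply: lee_pmul; rewrite ?lee_fin ?expR_ge0//.
- by rewrite !mulr_ge0 ?powR_ge0 ?(ltW c0) ?(ltW G0).
- apply: le_trans (expR_lncosh_lb v); rewrite ler_expR.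
  by have := beta0; nra.
apply: (@le_trans _ _ (c%:E * \sum_(m <oo) (binomial_coef (2^-1 - sigma) m * sech2 v ^+ m)%:E)%E).
  rewrite binomial_series ?rho0 ?rho1// -EFinM lee_fin -!mulrA.
  rewrite ler_wpM2l ?(ltW c0)// ler_wpM2l ?(ltW G0)//.
  have d20 : 0 < 1 - 2 * sigma by lra.
  have d21 : 1 - 2 * sigma < 1 by hlra.
  have := sech2_powR_lb d20 d21 v0.
  by rewrite (_ : - ((1 - 2 * sigma) / 2) = - (2^-1 - sigma)) ?opprB//; field.
have b0 m : 0 <= binomial_coef (2^-1 - sigma) m * sech2 v ^+ m.
  by rewrite mulr_ge0 ?exprn_ge0// (ltW (binomial_coef_gt0 _ d0)).
rewrite -nneseriesZl; last by move=> m _; rewrite lee_fin.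
apply: lee_nneseries => m _; first by move=> _; rewrite -EFinM lee_fin mulr_ge0// ltW.
by rewrite -EFinM lee_fin mulrA ler_wpM2r ?exprn_ge0.
Qed.

(** For sigma > 1/2 and large m the recurrence gives
(sigma - 1/2) / 2 D_m <= m D_m - (m + 1) D_(m+1), which telescopes. *)
Lemma kernel_coef_summable : 2^-1 < sigma ->
  exists2 C, 0 < C & forall n, \sum_(0 <= m < n) u m <= C.
Proof.
move=> s1; pose e := sigma - 2^-1.
have e0 : 0 < e by rewrite /e; lra.
have AB0 : 0 < beta / 2 * ((beta + 1) / 2).
  by rewrite mulr_gt0// divr_gt0//; have := beta0; lra.
have a0 : 0 < alpha + 1 by hlra.
have [m0 hm0] : exists m0 : nat, forall m, (m0 <= m)%N ->
    beta / 2 * ((beta + 1) / 2) + e / 2 * (m%:R + (alpha + 1)) <= e * m%:R.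
  pose X := 2 / e * (beta / 2 * ((beta + 1) / 2) + e / 2 * (alpha + 1)).
  exists (Num.bound X) => m mX.
  have : X <= m%:R.
    apply: (@le_trans _ _ (Num.bound X)%:R); last by rewrite ler_nat.
    apply/ltW/archi_boundP; apply: mulr_ge0; first by rewrite divr_ge0// ltW.
    by rewrite addr_ge0 ?(ltW AB0)// mulr_ge0 ?divr_ge0 ?(ltW e0) ?(ltW a0).
  rewrite /X -ler_pdivlMl ?divr_gt0// invf_div => h.
  have -> : e * m%:R = e / 2 * m%:R + e / 2 * m%:R by field.
  by lra.
have step m : (m0 <= m)%N -> e / 2 * u m + m.+1%:R * u m.+1 <= m%:R * u m.
  move=> /hm0 h; have um := kernel_coef_gt0 m; have := kernel_coefS m.
  rewrite -[m.+1%:R]natr1.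
  have mm : 0 <= m%:R :> R by [].
  set mR := m%:R in h mm *.
  have q0 : 0 < mR + (alpha + 1) by lra.
  move=> E; rewrite -(ler_pM2r q0).
  have -> : (e / 2 * u m + (mR + 1) * u m.+1) * (mR + (alpha + 1)) =
    e / 2 * u m * (mR + (alpha + 1)) + u m.+1 * ((mR + 1) * (mR + (alpha + 1))) by ring.
  rewrite E.
  have -> : e / 2 * u m * (mR + (alpha + 1)) + u m * ((mR + beta / 2) * (mR + (beta + 1) / 2)) =
   u m * (e / 2 * (mR + (alpha + 1)) + (mR + beta / 2) * (mR + (beta + 1) / 2)) by ring.
  rewrite (_ : mR * u m * (mR + (alpha + 1)) = u m * (mR * (mR + (alpha + 1)))); last by ring.
  rewrite ler_wpM2l ?(ltW um)//.
  have -> : (mR + beta / 2) * (mR + (beta + 1) / 2) =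
    mR * (mR + (alpha + 1)) - e * mR + beta / 2 * ((beta + 1) / 2) by rewrite /e /beta; field.
  lra.
pose C := \sum_(0 <= m < m0) u m + 2 / e * (m0%:R * u m0).
have bnd n : (m0 <= n)%N -> \sum_(0 <= m < n) u m + 2 / e * (n%:R * u n) <= C.
  move=> /subnK <-; elim: (n - m0)%N => [|k IH]; first by rewrite add0n.
  apply: le_trans IH; rewrite addSn big_nat_recr//= -addrA lerD2l.
  rewrite -(@ler_pM2l _ (e / 2)) ?divr_gt0//.
  have cancel (x y : R) : e / 2 * (x + 2 / e * y) = e / 2 * x + y.
    by field; rewrite gt_eqF.
  rewrite cancel; have := step (k + m0)%N (leq_addl _ _); congr (_ <= _).
  by field; rewrite gt_eqF.
have u0 m : 0 <= u m by exact/ltW/kernel_coef_gt0.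
exists (C + 1).
  by rewrite ltr_wpDl// addr_ge0 ?sumr_ge0// mulr_ge0 ?divr_ge0 ?(ltW e0)// mulr_ge0.
move=> n; apply: (@le_trans _ _ C); last by rewrite lerDl.
apply: le_trans (bnd (maxn n m0) (leq_maxr _ _)).
rewrite (@big_cat_nat _ _ _ n 0%N (maxn n m0))//=; last exact: leq_maxl.
by rewrite -addrA lerDl addr_ge0 ?sumr_ge0// mulr_ge0 ?divr_ge0 ?(ltW e0)// mulr_ge0.
Qed.

Lemma line_kernel_ub_bounded : 2^-1 < sigma ->
  exists2 C, 0 < C & forall v, (H v <= (C * expR (- beta * `|v|))%:E)%E.
Proof.
move=> /kernel_coef_summable[C C0 uC].
exists (expR (beta * ln 2) * C); first by rewrite mulr_gt0 ?expR_gt0.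
move=> v; rewrite line_kernelE mulrAC EFinM; apply: lee_pmul; rewrite ?lee_fin ?expR_ge0//.
- by apply: nneseries_ge0 => m _ _; exact: term_ge0.
- exact: expR_lncosh_ub.
apply: lime_le; first by apply: is_cvg_nneseries => m _ _; exact: term_ge0.
near=> n; rewrite sumEFin lee_fin; apply: le_trans (uC n).
apply: ler_sum => m _; rewrite ler_piMr ?(ltW (kernel_coef_gt0 _))//.
rewrite exprn_ile1 ?(ltW (sech2_gt0 _))//.
have := sech2_bounds v; have := sech2_gt0 v => _ /andP[h _].
by rewrite -subr_ge0 (le_trans _ h)// sqr_ge0.
Unshelve. all: by end_near.
Qed.

(** For sigma = 1/2, D_m is at least a multiple of 1 / (m + 1).  The first N terms
of the series stay within a factor e of their values at v = 0 as long as
(2 N + beta) |v| <= 1, and the harmonic series diverges. *)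
Lemma line_kernel_blowup : sigma = 2^-1 -> forall M, exists2 e, 0 < e &
  forall v, `|v| <= e -> (M%:E <= H v)%E.
Proof.
move=> s1.
have a0 : 0 < alpha + 1 by hlra.
have b0 := beta0.
have [||||||m|C C0 Cw] := @ratio_bounded (fun m => (m%:R + beta / 2)^-1 / u m)
  1 (alpha + 1) (beta / 2 + 1) ((beta + 1) / 2).
- by [].
- by [].
- by lra.
- by lra.
- by rewrite /beta s1; lra.
- by move=> m; rewrite divr_ge0 ?(ltW (kernel_coef_gt0 _))// invr_ge0 addr_ge0//; lra.
- have m0 : 0 <= m%:R :> R by [].
  have um := kernel_coef_gt0 m.
  have -> : u m.+1 = u m * ((m%:R + beta / 2) * (m%:R + (beta + 1) / 2)) /
     ((m%:R + 1) * (m%:R + (alpha + 1))).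
    by rewrite -kernel_coefS mulfK// gt_eqF// mulr_gt0//; lra.
  rewrite -[m.+1%:R]natr1; field.
  by rewrite !gt_eqF//; lra.
have uge m : (C * (1 + beta))^-1 * harmonic m <= u m.
  have m0 : 0 <= m%:R :> R by [].
  have um := kernel_coef_gt0 m.
  rewrite /harmonic/= -invfM; have := Cw m.
  rewrite ler_pdivrMr// => h.
  move: h; rewrite -[X in X <= _]div1r ler_pdivrMr; last by lra.
  move=> h; rewrite -[X in X <= _]div1r ler_pdivrMr; last first.
    by rewrite !mulr_gt0// addr_gt0.
  apply: (le_trans h); rewrite -[m.+1%:R]natr1.
  have -> : u m * (C * (1 + beta) * (m%:R + 1)) = C * u m * ((1 + beta) * (m%:R + 1)) by ring.
  have aux (b n : R) : 0 < b -> 0 <= n -> n + b / 2 <= (1 + b) * (n + 1).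
    by move=> ? ?; nra.
  apply: ler_wpM2l; first exact: mulr_ge0 (ltW C0) (ltW um).
  exact: aux.
move=> M.
have [N hN] : exists N : nat, expR 1 * (C * (1 + beta)) * M <= series harmonic N.
  apply: contrapT => /forallNP hN; apply: (@dvg_harmonic R).
  apply: nondecreasing_is_cvgn.
    apply/nondecreasing_seqP => n; rewrite /series/= big_nat_recr//= lerDl.
    by rewrite /harmonic/= invr_ge0.
  exists (expR 1 * (C * (1 + beta)) * M) => _ [n _ <-].
  by apply/ltW; rewrite ltNge; apply/negP/hN.
have K0 : 0 < 2 * N%:R + beta by rewrite ltr_wpDl// mulr_ge0.
exists (2 * N%:R + beta)^-1; first by rewrite invr_gt0.
move=> v ve; apply: le_trans (nneseries_lim_ge N _); last first.
  by move=> m _ _; rewrite lee_fin mulr_ge0 ?expR_ge0// (ltW (kernel_coef_gt0 _)).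
rewrite sumEFin lee_fin.
have C10 : 0 < C * (1 + beta) by rewrite mulr_gt0// addr_gt0.
have hM : M <= \sum_(0 <= m < N) (expR (- 1) * ((C * (1 + beta))^-1 * harmonic m)).
  rewrite -!mulr_sumr expRN -[X in _ <= _ * (_ * X)]/(series harmonic N).
  by rewrite mulrA -invfM ler_pdivlMl// mulr_gt0 ?expR_gt0.
apply: (le_trans hM); rewrite big_nat [leRHS]big_nat; apply: ler_sum => m /andP[_ mN].
rewrite mulrC; apply: ler_pM; rewrite ?expR_ge0//.
  by rewrite mulr_ge0 ?invr_ge0 ?(ltW C10).
rewrite ler_expR -/beta mulNr lerN2.
have mN' : m%:R <= N%:R :> R by rewrite ler_nat ltnW.
apply: (@le_trans _ _ ((2 * N%:R + beta) * `|v|)).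
  have L0 : lncosh v <= `|v| := lncosh_le v.
  have m0 : 0 <= m%:R :> R by [].
  by have := normr_ge0 v; nra.
by rewrite -ler_pdivlMl// mulr1.
Qed.

End bounds.
End KernelBounds.

(** * Young's inequality *)

Ltac nonneg := repeat first
  [ assumption | exact: powR_ge0 | exact: expR_ge0 | exact: normr_ge0 | by []
  | apply: mulr_ge0 | apply: addr_ge0 | (rewrite invr_ge0) | (by apply: ltW)
  | match goal with H : forall x, is_true (0 <= _) |- _ => exact: H end ].

Section RealIntegrals.
Context {R : realType}.
Local Notation mu := (@lebesgue_measure R).
Implicit Types f g : R -> R.

Lemma integralD_real f g : measurable_fun setT f -> measurable_fun setT g ->
  (forall x, 0 <= f x) -> (forall x, 0 <= g x) ->
  (\int[mu]_x (f x + g x)%:E = \int[mu]_x (f x)%:E + \int[mu]_x (g x)%:E)%E.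
Proof.
move=> mf mg f0 g0; under eq_integral do rewrite EFinD.
by apply: ge0_integralD => //; first [exact/measurable_EFinP|move=> x _; rewrite lee_fin].
Qed.

Lemma integralZ_real c f : measurable_fun setT f -> (forall x, 0 <= f x) -> 0 <= c ->
  (\int[mu]_x (c * f x)%:E = c%:E * \int[mu]_x (f x)%:E)%E.
Proof.
move=> mf f0 c0; under eq_integral do rewrite EFinM.
by apply: ge0_integralZl_EFin => //; first [exact/measurable_EFinP|move=> x _; rewrite lee_fin].
Qed.

Lemma le_integral_real f g : measurable_fun setT f -> measurable_fun setT g ->
  (forall x, 0 <= f x) -> (forall x, f x <= g x) ->
  (\int[mu]_x (f x)%:E <= \int[mu]_x (g x)%:E)%E.
Proof.
move=> mf mg f0 fg.
by apply: ge0_le_integral => //; first [exact/measurable_EFinP|move=> x _; rewrite lee_fin].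
Qed.

Lemma integral_real_ge0 f : (forall x, 0 <= f x) -> (0 <= \int[mu]_x (f x)%:E)%E.
Proof. by move=> f0; apply: integral_ge0 => x _; rewrite lee_fin. Qed.

End RealIntegrals.

Section Convolution.
Context {R : realType}.
Local Notation mu := (@lebesgue_measure R).
Implicit Types (k F : R -> R) (s u v w : R).

Definition conv k F s : \bar R := (\int[mu]_u (k (s - u) * F u)%:E)%E.

Lemma integral_shift_reflect k s : measurable_fun setT k -> (forall v, 0 <= k v) ->
  (\int[mu]_u (k (s - u))%:E = \int[mu]_u (k u)%:E)%E.
Proof.
move=> mg g0; rewrite -[RHS](@integral_affine _ (-1) s); first last.
- by move=> u; rewrite lee_fin.
- exact/measurable_EFinP.
- by right.
by apply: eq_integral => u _; rewrite mulN1r addrC.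
Qed.

Lemma integral_shift k u : measurable_fun setT k -> (forall v, 0 <= k v) ->
  (\int[mu]_s (k (s - u))%:E = \int[mu]_s (k s)%:E)%E.
Proof.
move=> mg g0; rewrite -[RHS](@integral_affine _ 1 (- u)); first last.
- by move=> s; rewrite lee_fin.
- exact/measurable_EFinP.
- by left.
by apply: eq_integral => s _; rewrite mul1r.
Qed.

Lemma measurable_conv_integrand k F : measurable_fun setT k -> measurable_fun setT F ->
  measurable_fun setT (fun z : R * R => k (z.1 - z.2) * F z.2).
Proof.
move=> mk mF; apply: measurable_funM.
  by apply: (measurableT_comp mk); solve_measurable.
by apply: (measurableT_comp mF); solve_measurable.
Qed.

Lemma measurable_conv k F : measurable_fun setT k -> measurable_fun setT F ->
  (forall v, 0 <= k v) -> (forall v, 0 <= F v) -> measurable_fun setT (conv k F).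
Proof.
move=> mk mF k0 F0.
apply: (@measurable_fun_fubini_tonelli_F _ _ _ _ _ mu
  (fun z : R * R => (k (z.1 - z.2) * F z.2)%:E)).
  by apply/measurable_EFinP; exact: measurable_conv_integrand.
by move=> z; rewrite lee_fin mulr_ge0.
Qed.

Lemma conv_ge0 k F s : (forall v, 0 <= k v) -> (forall v, 0 <= F v) -> (0 <= conv k F s)%E.
Proof. by move=> k0 F0; apply: integral_ge0 => u _; rewrite lee_fin mulr_ge0. Qed.

Lemma integral_conv k F : measurable_fun setT k -> measurable_fun setT F ->
  (forall v, 0 <= k v) -> (forall v, 0 <= F v) ->
  (\int[mu]_s conv k F s = (\int[mu]_v (k v)%:E) * \int[mu]_u (F u)%:E)%E.
Proof.
move=> mk mF k0 F0; rewrite /conv (@tonelli _ (fun s u => k (s - u) * F u)); last 2 first.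
- exact: measurable_conv_integrand.
- by move=> s u; rewrite mulr_ge0.
rewrite -ge0_integralZl//; last 3 first.
- exact/measurable_EFinP.
- by move=> u _; rewrite lee_fin.
- by apply: integral_ge0 => v _; rewrite lee_fin.
apply: eq_integral => u _; rewrite muleC -(integral_shift u mk k0) -integralZ_real//; last first.
  by solve_measurable.
by apply: eq_integral => s _; rewrite mulrC.
Qed.

Lemma mul_le_powRD (p p' x y : R) : 1 < p -> p^-1 + p'^-1 = 1 -> 0 <= x -> 0 <= y ->
  x * y <= x `^ p' + y `^ p.
Proof.
move=> p1 pp x0 y0.
have p0 : 0 < p by lra.
have pi1 : p^-1 < 1 by rewrite invf_lt1.
have p'i : 0 < p'^-1 by lra.
have p'0 : 0 < p' by rewrite -invr_gt0.
have pi0 : 0 < p^-1 by rewrite invr_gt0.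
have p'1 : p'^-1 <= 1 by lra.
rewrite mulrC; apply: le_trans (conjugate_powR y0 x0 _ _ pp) _; rewrite ?(ltW p0) ?(ltW p'0)//.
by rewrite addrC lerD// ler_piMr// ?powR_ge0// ltW.
Qed.

(** Hoelder's inequality in the additive form x y <= x^p' + y^p, which is enough
when the size of the constant does not matter. *)
Lemma conv_le_holder (p p' : R) k F K s : 1 < p -> p^-1 + p'^-1 = 1 ->
  measurable_fun setT k -> measurable_fun setT F ->
  (forall v, 0 <= k v) -> (forall v, 0 <= F v) ->
  (\int[mu]_v (k v `^ p')%:E <= K%:E)%E -> (\int[mu]_v (F v `^ p)%:E <= 1)%E ->
  (conv k F s <= (K + 1)%:E)%E.
Proof.
move=> p1 pp mk mF k0 F0 kK F1.
have mkp : measurable_fun setT (fun v => k v `^ p') by solve_measurable.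
have mFp : measurable_fun setT (fun v => F v `^ p) by solve_measurable.
apply: (@le_trans _ _ (\int[mu]_u (k (s - u) `^ p' + F u `^ p)%:E)%E).
  apply: le_integral_real; [by solve_measurable|by solve_measurable|by move=> u; nonneg|].
  by move=> u; exact: mul_le_powRD.
rewrite integralD_real; [|by solve_measurable|by solve_measurable|by move=> u; nonneg|by move=> u; nonneg].
rewrite EFinD; apply: leeD; last exact: F1.
by rewrite (@integral_shift_reflect (fun w => k w `^ p'))// => w; exact: powR_ge0.
Qed.

(** With Z = x^r y^p / l, Y = y^p and X = x^r one has
x y = l^(1/q) Z^(1/q) Y^(1/p - 1/q) X^(1 - 1/p); the exponents of Z, Y and X
add up to 1, so the product of these powers is at most Z + Y + X. *)
Lemma young_pointwise (p q r l x y : R) : 1 <= p -> p <= q -> 0 < r ->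
  r^-1 = 1 + q^-1 - p^-1 -> 0 < l -> 0 <= x -> 0 <= y ->
  x * y <= l `^ q^-1 * (l^-1 * (x `^ r * y `^ p) + (y `^ p + x `^ r)).
Proof.
move=> p1 pq r0 rE l0 x0 y0.
have [->|xN0] := eqVneq x 0.
  by rewrite mul0r mulr_ge0 ?powR_ge0// addr_ge0 ?addr_ge0 ?mulr_ge0 ?powR_ge0 ?invr_ge0 ?(ltW l0).
have [->|yN0] := eqVneq y 0.
  by rewrite mulr0 mulr_ge0 ?powR_ge0// addr_ge0 ?addr_ge0 ?mulr_ge0 ?powR_ge0 ?invr_ge0 ?(ltW l0).
set Z := l^-1 * _; set Y := y `^ p; set X := x `^ r.
have p0 : 0 < p by lra.
have q0 : 0 < q by lra.
have X0 : 0 <= X := powR_ge0 _ _.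
have Y0 : 0 <= Y := powR_ge0 _ _.
have Z0 : 0 <= Z by rewrite /Z !mulr_ge0 ?powR_ge0 ?invr_ge0 ?(ltW l0).
set T := Z + (Y + X).
have T0 : 0 < T.
  have : 0 < X by rewrite powR_gt0// lt_neqAle eq_sym xN0.
  by rewrite /T; lra.
have qi : 0 <= q^-1 by rewrite invr_ge0 ltW.
have pqi : 0 <= p^-1 - q^-1 by rewrite subr_ge0 lef_pV2.
have pi1 : 0 <= 1 - p^-1 by rewrite subr_ge0 invf_le1.
have -> : x * y = l `^ q^-1 * (Z `^ q^-1 * (Y `^ (p^-1 - q^-1) * X `^ (1 - p^-1))).
  have lZ : l * Z = x `^ r * y `^ p by rewrite /Z mulrA divff ?mul1r// gt_eqF.
  rewrite mulrA -powRM ?(ltW l0)// lZ.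
  rewrite powRM ?powR_ge0// /Y /X -!powRrM.
  have -> : x `^ (r * q^-1) * y `^ (p * q^-1) *
    (y `^ (p * (p^-1 - q^-1)) * x `^ (r * (1 - p^-1))) =
    (x `^ (r * q^-1) * x `^ (r * (1 - p^-1))) *
    (y `^ (p * q^-1) * y `^ (p * (p^-1 - q^-1))) by ring.
  rewrite -!powRD ?xN0 ?yN0 ?implybT//.
  have -> : r * q^-1 + r * (1 - p^-1) = 1.
    by rewrite -mulrDr (_ : q^-1 + (1 - p^-1) = r^-1) ?divff ?gt_eqF// rE; ring.
  have -> : p * q^-1 + p * (p^-1 - q^-1) = 1 by field; rewrite !gt_eqF.
  by rewrite !powRr1.
apply: ler_wpM2l; first exact: powR_ge0.
have -> : T = T `^ q^-1 * (T `^ (p^-1 - q^-1) * T `^ (1 - p^-1)).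
  rewrite -!powRD ?(gt_eqF T0) ?implybT//.
  by rewrite (_ : q^-1 + _ = 1) ?powRr1 ?(ltW T0)//; ring.
have tn := ltW T0.
apply: ler_pM; [exact: powR_ge0|by apply: mulr_ge0; exact: powR_ge0| |].
  by rewrite ge0_ler_powR ?nnegrE// /T; lra.
apply: ler_pM; rewrite ?powR_ge0//.
  by rewrite ge0_ler_powR ?nnegrE// /T; lra.
by rewrite ge0_ler_powR ?nnegrE// /T; lra.
Qed.

Lemma lee_forall_gt (x : \bar R) (a c : R) : 0 < c ->
  (forall l, a < l -> (x <= (l * c)%:E)%E) -> (x <= (a * c)%:E)%E.
Proof.
move=> c0 h; apply/lee_addgt0Pr => e e0.
have := h (a + e / c); rewrite ltrDl divr_gt0// => /(_ isT).
by rewrite mulrDl divfK ?gt_eqF// EFinD.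
Qed.

(** Let A = k^r * F^p.  Integrating young_pointwise in u, with l decreasing to A s,
gives (k * F)^q <= (2 + K)^q A at s, and A has integral at most K. *)
Lemma young (p q r K : R) k F : 1 <= p -> p <= q -> 0 < r ->
  r^-1 = 1 + q^-1 - p^-1 ->
  measurable_fun setT k -> measurable_fun setT F ->
  (forall v, 0 <= k v) -> (forall v, 0 <= F v) -> 0 <= K ->
  (\int[mu]_v (k v `^ r)%:E <= K%:E)%E -> (\int[mu]_v (F v `^ p)%:E <= 1)%E ->
  (\int[mu]_s (conv k F s `^ q) <= ((2 + K) `^ q * K)%:E)%E.
Proof.
move=> p1 pq r0 rE mk mF k0 F0 K0 kK F1.
have q0 : 0 < q by lra.
have mkr : measurable_fun setT (fun v => k v `^ r).
  exact: (measurableT_comp (measurable_powR _)).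
have mFp : measurable_fun setT (fun v => F v `^ p).
  exact: (measurableT_comp (measurable_powR _)).
pose A := conv (fun v => k v `^ r) (fun v => F v `^ p).
have mA : measurable_fun setT A by apply: measurable_conv => // v; exact: powR_ge0.
have A0 s : (0 <= A s)%E by apply: conv_ge0 => v; exact: powR_ge0.
have K2 : 0 < 2 + K by lra.
have c0 : 0 < (2 + K) `^ q by rewrite powR_gt0.
have ptw s : (conv k F s `^ q <= ((2 + K) `^ q)%:E * A s)%E.
  have := A0 s; case EA : (A s) => [a| |//] a0; last by rewrite gt0_muley ?lte_fin// leey.
  rewrite -EFinM mulrC; apply: lee_forall_gt => // l al.
  have l0 : 0 < l by apply: le_lt_trans al; rewrite -lee_fin.
  have lq : l * (2 + K) `^ q = (l `^ q^-1 * (2 + K)) `^ q.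
    by rewrite powRM ?powR_ge0 ?(ltW K2)// -powRrM mulVf ?gt_eqF// powRr1 ?(ltW l0).
  rewrite lq -poweR_EFin; apply: gt0_ler_poweR; rewrite ?(ltW q0)//.
  - by rewrite in_itv/= leey andbT conv_ge0.
  - by rewrite in_itv/= leey andbT lee_fin mulr_ge0 ?powR_ge0 ?(ltW K2).
  have li : 0 <= l^-1 by rewrite invr_ge0 ltW.
  apply: (@le_trans _ _ (\int[mu]_u (l `^ q^-1 *
     (l^-1 * (k (s - u) `^ r * F u `^ p) + (F u `^ p + k (s - u) `^ r)))%:E)%E).
    apply: le_integral_real; [by solve_measurable|by solve_measurable|by move=> u; nonneg|].
    by move=> u; exact: young_pointwise.
  rewrite integralZ_real; [|by solve_measurable|by move=> u; nonneg|exact: powR_ge0].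
  rewrite EFinM lee_pmul2l ?lte_fin ?powR_gt0//.
  rewrite integralD_real; [|by solve_measurable|by solve_measurable|by move=> u; nonneg|by move=> u; nonneg].
  rewrite integralD_real; [|by solve_measurable|by solve_measurable|by move=> u; nonneg|by move=> u; nonneg].
  rewrite integralZ_real; [|by solve_measurable|by move=> u; nonneg|by []].
  rewrite -[X in (_ * X)%E]/(A s) EA.
  rewrite (@integral_shift_reflect (fun w => k w `^ r)); [|by []|by move=> w; exact: powR_ge0].
  rewrite (_ : (2 + K)%:E = 1 + (1 + K%:E))%E; last by rewrite -!EFinD; congr (_%:E); ring.
  apply: leeD; last exact: leeD.
  by rewrite -EFinM lee_fin mulrC ler_pdivrMr// mul1r ltW.
apply: (@le_trans _ _ (\int[mu]_s (((2 + K) `^ q)%:E * A s))%E).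
  apply: ge0_le_integral => //.
  - by move=> s _; exact: poweR_ge0.
  - apply: (@measurableT_comp _ _ _ _ _ _ (fun x => poweR x q)); first exact: measurable_poweR.
    exact: measurable_conv.
  - exact: measurable_funeM.
rewrite ge0_integralZl_EFin ?(ltW c0)//.
rewrite EFinM lee_pmul2l ?lte_fin// integral_conv//; try by move=> v; exact: powR_ge0.
rewrite -[leRHS]mule1; apply: lee_pmul => //.
- by apply: integral_ge0 => v _; rewrite lee_fin powR_ge0.
- by apply: integral_ge0 => v _; rewrite lee_fin powR_ge0.
Qed.

End Convolution.

(** * The Hardy-Littlewood-Sobolev inequality *)

Section HardyLittlewoodSobolev.
Context {R : realType}.
Local Notation mu := (@lebesgue_measure R).
Implicit Types (F : R -> R) (s u v w : R).

(** If N v is replaced by e^v times the indicator of D e^v <= G, the right-hand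
side is G^q: this is the formula for G^q by its level sets, with levels D e^v. *)
Lemma layer_cake (q D : R) (G : \bar R) (N : R -> \bar R) :
  0 < q -> 0 < D -> (0 <= G)%E -> measurable_fun setT N -> (forall v, 0 <= N v)%E ->
  (forall v, (D * expR v)%:E <= G -> (expR v)%:E <= N v)%E ->
  (G `^ q <= \int[mu]_v ((q * D `^ q * expR ((q - 1) * v))%:E * N v))%E.
Proof.
move=> q0 D0 G0 mN N0 GN.
have Dq0 : 0 < D `^ q by rewrite powR_gt0.
have trunc x : (forall v, v <= x -> ((expR v)%:E <= N v)%E) ->
    ((D `^ q * expR (q * x))%:E <=
     \int[mu]_v ((q * D `^ q * expR ((q - 1) * v))%:E * N v))%E.
  move=> xN; rewrite (_ : D `^ q * expR (q * x) = (q * D `^ q) * (q^-1 * expR (q * x))); last first.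
    by field; rewrite gt_eqF.
  rewrite EFinM -integral_expR_ltail// -integralZ_real; [|by solve_measurable|by move=> v; nonneg|by nonneg].
  apply: ge0_le_integral => //.
  - by move=> v _; rewrite lee_fin; nonneg.
  - by apply/measurable_EFinP; solve_measurable.
  - by apply: emeasurable_funM => //; apply/measurable_EFinP; solve_measurable.
  move=> v _; rewrite indicE mem_setE in_itv/=; case: (leP v x) => [vx|_]; last first.
    by rewrite mul0r mulr0 mule_ge0// lee_fin; nonneg.
  rewrite mul1r (_ : q * D `^ q * expR (q * v) = (q * D `^ q * expR ((q - 1) * v)) * expR v).
    by rewrite EFinM lee_pmul2l ?xN// lte_fin !mulr_gt0 ?expR_gt0.
  by rewrite -[RHS]mulrA -expRD; congr (_ * expR _); ring.
case: G G0 GN => [g| |]//.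
- rewrite lee_fin le_eqVlt => /predU1P[<- _|g0 GN].
    rewrite poweR_EFin powR0 ?gt_eqF//; apply: integral_ge0 => v _.
    by rewrite mule_ge0// lee_fin; nonneg.
  have gD : 0 < g / D by rewrite divr_gt0.
  have := trunc (ln (g / D)).
  have -> : D `^ q * expR (q * ln (g / D)) = g `^ q.
    rewrite -powR_expR lnK// -powRM ?(ltW D0) ?(ltW gD)//.
    by rewrite mulrC divfK// gt_eqF.
  rewrite poweR_EFin; apply=> v vx; apply: GN.
  rewrite lee_fin mulrC -ler_pdivlMr//.
  by rewrite -[leRHS]lnK// ler_expR.
- move=> _ GN; rewrite poweRyr ?gt_eqF// leye_eq; apply/eqP/eqyP => A A0.
  have AD : 0 < A / D `^ q by rewrite divr_gt0.
  have := trunc (q^-1 * ln (A / D `^ q)).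
  have -> : D `^ q * expR (q * (q^-1 * ln (A / D `^ q))) = A.
    by rewrite mulVKf ?gt_eqF// lnK// [LHS]mulrC divfK ?gt_eqF.
  by apply=> v _; apply: GN; rewrite leey.
Qed.

(** At the level D e^v the kernel is cut at the distance e^(- q v) and F at the
height e^((q / p) v).  By Hoelder's inequality the far part of the kernel
contributes at most a multiple of e^v, and so does the near part against the
low values of F.  Where the convolution exceeds D e^v, the near part against
the high values must therefore exceed e^v.  Its integral in s is explicit, and
inserting it in layer_cake and integrating in v gives back F^p. *)
Lemma hardy_littlewood_sobolev (p q th : R) : 1 < p -> 0 < th -> 0 < q ->
  q^-1 = p^-1 - th ->
  exists2 C : R, 0 <= C & forall F, measurable_fun setT F -> (forall u, 0 <= F u) ->
    (\int[mu]_u (F u `^ p)%:E <= 1)%E ->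
    (\int[mu]_s (conv (fun v => `|v| `^ (th - 1))%R F s `^ q) <= C%:E)%E.
Proof.
move=> p1 th0 q0 qE.
have p0 : 0 < p by lra.
have pi1 : p^-1 < 1 by rewrite invf_lt1.
have qi0 : 0 < q^-1 by rewrite invr_gt0.
have th1 : th < 1 by lra.
pose p' := (1 - p^-1)^-1.
have p'i : p'^-1 = 1 - p^-1 by rewrite invrK.
have p'0 : 0 < p' by rewrite invr_gt0; lra.
have pp : p^-1 + p'^-1 = 1 by rewrite p'i; ring.
pose c := p' / q.
have c0 : 0 < c by rewrite divr_gt0.
(* The p'-th power of the kernel is |w|^(- c - 1). *)
have cE : - c - 1 = (th - 1) * p'.
  have : p' * (p'^-1 + q^-1) = 1 + c by rewrite mulrDr divff// gt_eqF.
  by move=> h; rewrite (_ : - c - 1 = - (1 + c)); [rewrite -h p'i qE; ring|ring].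
have qc : q * c = p' by rewrite /c mulrC divfK// gt_eqF.
have qth : q * th = q / p - 1.
  by rewrite (_ : th = p^-1 - q^-1); [rewrite mulrBr divff ?gt_eqF|rewrite qE; ring].
(* The terms bound the far part (2 / c + 1) and the low values (2 / th); the
   final 1 is what is left for the near part against the high values. *)
pose D := 2 / c + 1 + 2 / th + 1.
have D0 : 0 < D by rewrite !addr_gt0// divr_gt0.
pose C0 := q * D `^ q * (2 / th).
have C00 : 0 < C0 by rewrite !mulr_gt0 ?powR_gt0 ?invr_gt0.
pose e1 := q - q / p.
have e10 : 0 < e1 by rewrite /e1 subr_gt0 gtr_pMr.
exists (C0 / e1); first by rewrite divr_ge0// ltW.
move=> F mF F0 F1.
pose k w := `|w| `^ (th - 1).
have k0 w : 0 <= k w by exact: powR_ge0.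
have mk : measurable_fun setT k by rewrite /k; solve_measurable.
pose near v w := \1_`[0, +oo[ (expR (- q * v) - `|w|) * k w.
pose far v w := \1_`]-oo, 0] (expR (- q * v) - `|w|) * k w.
pose high v u := \1_`[0, +oo[ (F u - expR (q / p * v)) * F u.
have near0 v w : 0 <= near v w by rewrite /near; nonneg.
have far0 v w : 0 <= far v w by rewrite /far; nonneg.
have high0 v u : 0 <= high v u by rewrite /high; nonneg.
have mnear v : measurable_fun setT (near v) by rewrite /near /k; solve_measurable.
have mfar v : measurable_fun setT (far v) by rewrite /far /k; solve_measurable.
have mhigh v : measurable_fun setT (high v) by rewrite /high; solve_measurable.
have int_near v : (\int[mu]_w (near v w)%:E = (2 / th * expR (- (q * th) * v))%:E)%E.
  have := integral_powR_near th0 (expR_gt0 (- q * v)).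
  rewrite powR_expR (_ : th * (- q * v) = - (q * th) * v); last by ring.
  move=> <-; apply: eq_integral => w _; congr (_%:E).
  by rewrite /near !indicE !mem_setE !in_itv/= andbT subr_ge0.
have int_far v : (\int[mu]_w ((expR (- v) * far v w) `^ p')%:E = (2 / c)%:E)%E.
  have := integral_powR_far c0 (expR_gt0 (- q * v)).
  rewrite powR_expR => E.
  transitivity (\int[mu]_w (expR (- (p' * v)) *
     (\1_`[expR (- q * v), +oo[ `|w| * `|w| `^ (- c - 1)))%:E)%E.
    apply: eq_integral => w _; congr (_%:E).
    rewrite powRM ?expR_ge0// powR_expR mulrN; congr (_ * _).
    rewrite /far !indicE !mem_setE !in_itv/= andbT subr_le0.
    case: leP => _; last by rewrite !mul0r powR0// gt_eqF.
    by rewrite !mul1r /k -powRrM cE.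
  rewrite integralZ_real; [|by solve_measurable|by move=> w; nonneg|exact: expR_ge0].
  rewrite E -EFinM; congr (_%:E); rewrite mulrCA -expRD -qc.
  by rewrite (_ : _ + _ = 0) ?expR0 ?mulr1//; ring.
have conv_far v s : (\int[mu]_u (far v (s - u) * F u)%:E <= ((2 / c + 1) * expR v)%:E)%E.
  have h := @conv_le_holder R p p' (fun w => expR (- v) * far v w) F (2 / c) s p1 pp.
  have {h} : (conv (fun w => expR (- v) * far v w)%R F s <= (2 / c + 1)%:E)%E.
    by apply: h => //; [solve_measurable|move=> w; nonneg|rewrite int_far].
  rewrite /conv; under eq_integral do rewrite -mulrA.
  rewrite integralZ_real; [|by solve_measurable|by move=> w; nonneg|exact: expR_ge0].
  set X := (\int[mu]_u _)%E => h; rewrite mulrC EFinM.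
  have -> : X = ((expR v)%:E * ((expR (- v))%:E * X))%E.
    by rewrite muleA -EFinM -expRD subrr expR0 mul1e.
  by apply: lee_wpmul2l => //; rewrite lee_fin expR_ge0.
pose N s v : \bar R := conv (near v) (high v) s.
have N0 s v : (0 <= N s v)%E by exact: conv_ge0.
have split s v : (conv k F s <= ((2 / c + 1 + 2 / th) * expR v)%:E + N s v)%E.
  apply: (@le_trans _ _ (\int[mu]_u (far v (s - u) * F u +
      (expR (q / p * v) * near v (s - u) + near v (s - u) * high v u))%:E)%E).
    apply: le_integral_real; [by solve_measurable|by solve_measurable|by move=> u; nonneg|].
    move=> u; set w := s - u.
    have kn : k w <= far v w + near v w.
      rewrite /far /near -mulrDl ler_peMl// !indicE !mem_setE !in_itv/= andbT.
      by case: (leP 0 (expR (- q * v) - `|w|)) => [_|/ltW ->]; rewrite ?lerDr ?ler0n ?addr0.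
    have Fh : F u <= expR (q / p * v) + high v u.
      rewrite /high !indicE !mem_setE !in_itv/= andbT subr_ge0.
      case: (leP (expR (q / p * v)) (F u)) => [_|/ltW h]; first by rewrite mul1r lerDr expR_ge0.
      by rewrite mul0r addr0.
    apply: (@le_trans _ _ (far v w * F u + near v w * F u)).
      by rewrite -mulrDl ler_wpM2r.
    rewrite lerD2l (mulrC (expR _)) -mulrDr ler_wpM2l//.
  rewrite integralD_real; [|by solve_measurable|by solve_measurable|by move=> u; nonneg|by move=> u; nonneg].
  rewrite integralD_real; [|by solve_measurable|by solve_measurable|by move=> u; nonneg|by move=> u; nonneg].
  rewrite integralZ_real; [|by solve_measurable|by move=> u; nonneg|exact: expR_ge0].
  rewrite integral_shift_reflect// int_near addeA; apply: leeD => //.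
  rewrite (_ : (2 / c + 1 + 2 / th) * expR v = (2 / c + 1) * expR v + 2 / th * expR v); last by ring.
  rewrite EFinD; apply: leeD; first exact: conv_far.
  rewrite -EFinM mulrCA -expRD lee_fin le_eqVlt; apply/orP; left; apply/eqP.
  by congr (_ * expR _); rewrite qth; ring.
have mNs : measurable_fun setT (fun z : R * R => N z.1 z.2).
  apply: (@measurable_fun_fubini_tonelli_F _ _ _ _ _ mu
    (fun z : (R * R) * R => (near z.1.2 (z.1.1 - z.2) * high z.1.2 z.2)%:E)).
    apply/measurable_EFinP; rewrite /near /high /k.
    have m11 : measurable_fun setT (fun z : (R * R) * R => z.1.1).
      by apply: measurableT_comp.
    have m12 : measurable_fun setT (fun z : (R * R) * R => z.1.2).
      by apply: measurableT_comp.
    by solve_measurable.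
  by move=> z; rewrite lee_fin; nonneg.
have mN s : measurable_fun setT (N s).
  exact: (measurableT_comp mNs (pair1_measurable s)).
have mW : measurable_fun setT
    (fun z : R * R => ((q * D `^ q * expR ((q - 1) * z.2))%:E * N z.1 z.2)%E).
  by apply: emeasurable_funM => //; apply/measurable_EFinP; solve_measurable.
have W0 (z : R * R) : (0 <= (q * D `^ q * expR ((q - 1) * z.2))%:E * N z.1 z.2)%E.
  by rewrite mule_ge0// lee_fin; nonneg.
have cake s : (conv k F s `^ q <= \int[mu]_v ((q * D `^ q * expR ((q - 1) * v))%:E * N s v))%E.
  apply: layer_cake; [exact: q0|exact: D0|exact: conv_ge0|exact: mN|exact: N0|].
  move=> v /le_trans/(_ (split s v)).
  case: (N s v) => [n| |]; rewrite ?leey// -EFinD !lee_fin /D.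
  by rewrite mulrDl; lra.
apply: (@le_trans _ _ (\int[mu]_s \int[mu]_v
    ((q * D `^ q * expR ((q - 1) * v))%:E * N s v))%E).
  apply: ge0_le_integral => //.
  - by move=> s _; exact: poweR_ge0.
  - apply: (@measurableT_comp _ _ _ _ _ _ (fun x => poweR x q)); first exact: measurable_poweR.
    exact: measurable_conv.
  - exact: (@measurable_fun_fubini_tonelli_F _ _ _ _ _ mu _ mW W0).
rewrite (@fubini_tonelli _ _ _ _ _ mu mu _ mW W0)/=.
pose f v u := C0 * (expR (e1 * v) * high v u).
have f0 v u : 0 <= f v u by rewrite /f mulr_ge0 ?(ltW C00)// mulr_ge0 ?expR_ge0.
have -> : (\int[mu]_v \int[mu]_s ((q * D `^ q * expR ((q - 1) * v))%:E * N s v) =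
    \int[mu]_v \int[mu]_u (f v u)%:E)%E.
  apply: eq_integral => v _.
  rewrite ge0_integralZl_EFin//; last 2 first.
  - exact: measurable_conv.
  - by nonneg.
  rewrite integral_conv// int_near muleA -EFinM -integralZ_real//; last by nonneg.
  apply: eq_integral => u _; congr (_%:E); rewrite /f mulrA; congr (_ * _).
  have -> : q * D `^ q * expR ((q - 1) * v) * (2 / th * expR (- (q * th) * v)) =
    C0 * (expR ((q - 1) * v) * expR (- (q * th) * v)) by rewrite /C0; ring.
  by rewrite -expRD qth; congr (_ * expR _); rewrite /e1; ring.
have mf : measurable_fun setT (fun z : R * R => f z.1 z.2).
  by rewrite /f /high; solve_measurable.
rewrite tonelli//.
apply: (@le_trans _ _ (\int[mu]_u ((C0 / e1) * F u `^ p)%:E)%E); last first.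
  rewrite integralZ_real; [|by solve_measurable|by move=> u; nonneg|by rewrite divr_ge0// ltW].
  rewrite -[leRHS]mule1; apply: lee_wpmul2l => //.
  by rewrite lee_fin divr_ge0// ltW.
have fE u : (\int[mu]_v (f v u)%:E = (C0 / e1 * F u `^ p)%:E)%E.
  have [Fu|Fu] := eqVneq (F u) 0.
    rewrite Fu powR0 ?gt_eqF// mulr0 integral0_eq// => v _.
    by rewrite /f /high Fu !mulr0.
  have Fu0 : 0 < F u by rewrite lt_neqAle eq_sym Fu F0.
  transitivity (\int[mu]_v ((C0 * F u) * (\1_`]-oo, p / q * ln (F u)] v * expR (e1 * v)))%:E)%E.
    apply: eq_integral => v _; congr (_%:E); rewrite /f /high.
    rewrite !indicE !mem_setE !in_itv/= andbT subr_ge0.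
    have -> : (expR (q / p * v) <= F u) = (v <= p / q * ln (F u)).
      rewrite -{1}(lnK (x := F u)) ?posrE// ler_expR.
      by rewrite -[in RHS]ler_pdivrMl ?divr_gt0// invf_div.
    by ring.
  rewrite integralZ_real; [|by solve_measurable|by move=> v; nonneg|exact: mulr_ge0 (ltW C00) (F0 u)].
  rewrite integral_expR_ltail// -EFinM; congr (_%:E).
  have -> : e1 * (p / q * ln (F u)) = (p - 1) * ln (F u).
    by rewrite /e1; field; rewrite !gt_eqF.
  rewrite -powR_expR lnK//.
  rewrite -(mulr_powRB1 (F0 u) p0).
  by field; rewrite gt_eqF.
by under eq_integral do rewrite fE.
Qed.

End HardyLittlewoodSobolev.

(** * The potential as a convolution on the line *)

Section Transfer.
Context {R : realType}.
Local Notation mu := (@lebesgue_measure R).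
Implicit Types (f F G k : R -> R) (c eta s u v w x y l m : R).
Variables alpha sigma : R.
Hypotheses (halpha : -1 < alpha) (hsigma0 : 0 < sigma) (hsigma : sigma < alpha + 1).
Let beta := alpha + 1 - sigma.
Let H := line_kernel alpha sigma.
Let H0 v : (0 <= H v)%E. Proof. exact: line_kernel_ge0. Qed.
Let mH : measurable_fun setT H. Proof. exact: measurable_line_kernel. Qed.
Ltac hlra := move: halpha hsigma0 hsigma => /= ? ? ?; lra.

Lemma line_kernelN v : H (- v) = H v.
Proof. by rewrite /H /line_kernel (lncosh_abs (- v)) normrN -lncosh_abs. Qed.

(** Extends lower bounds that are singular at 0 to the point v = 0 itself. *)
Lemma line_kernel_le_center v : (H v <= H 0)%E.
Proof.
have l0 : @lncosh R 0 = 0.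
  by rewrite /lncosh oppr0 expR0 (_ : (1 + 1) / 2 = 1) ?ln1//; field.
have lv : 0 <= lncosh v.
  rewrite -ler_expR expR_lncosh expR0.
  have := expR_gt0 v; have := expR_gt0 (- v).
  have : expR v * expR (- v) = 1 by rewrite -expRD subrr expR0.
  set x := expR v; set y := expR (- v) => xy y0 x0.
  rewrite ler_pdivlMr//; have := sqr_ge0 (x - y); nra.
apply: lee_nneseries => m _.
  by move=> _; rewrite lee_fin mulr_ge0 ?expR_ge0// ltW// kernel_coef_gt0.
rewrite lee_fin l0 mulr0 expR0 ler_wpM2l ?(ltW (kernel_coef_gt0 _ _ _ _))//.
rewrite -[leRHS](expR0 R) ler_expR mulNr oppr_le0 mulr_ge0//.
by have : 0 <= m%:R :> R by []; hlra.
Qed.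

Lemma potential_kernelE x y : 0 < x -> 0 < y -> potential_kernel alpha sigma x y =
  ((expR ((sigma - 2^-1) * (ln x + ln y)))%:E * H (ln x - ln y))%E.
Proof.
move=> x0 y0; rewrite -{1}(lnK (x := x))// -{1}(lnK (x := y))//.
exact: potential_kernel_exp.
Qed.

Lemma measurable_potential_kernel x : 0 < x ->
  measurable_fun (@Rplus R) (potential_kernel alpha sigma x).
Proof.
move=> x0; apply: (@eq_measurable_fun _ _ _ _ _
  (fun y => ((expR ((sigma - 2^-1) * (ln x + ln y)))%:E * H (ln x - ln y))%E)).
  by move=> y; rewrite inE /Rplus/= in_itv/= andbT => y0; rewrite potential_kernelE.
apply: measurable_funTS; apply: emeasurable_funM.
  by apply/measurable_EFinP; solve_measurable.
by apply: (measurableT_comp mH); solve_measurable.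
Qed.

Lemma potential_kernel_ge0 x y : 0 < x -> 0 < y -> (0 <= potential_kernel alpha sigma x y)%E.
Proof. by move=> x0 y0; rewrite potential_kernelE// mule_ge0// lee_fin expR_ge0. Qed.

(** The convolution k * F; the tilt e^(- eta v) carries the powers of x and y. *)
Definition line_conv (eta : R) (F : R -> R) (s : R) : \bar R :=
  (\int[mu]_u ((expR (- eta * (s - u)))%:E * H (s - u) * (F u)%:E))%E.

(** For c = a + 1/p, its norm in L^p(du) is the norm of x^a f in L^p(dx). *)
Definition log_profile (c : R) (f : R -> R) (u : R) : R := expR (c * u) * `|f (expR u)|.

Lemma measurable_log_profile c f : measurable_fun (@Rplus R) f ->
  measurable_fun setT (log_profile c f).
Proof.
move=> mf; have mfe : measurable_fun setT (f \o expR).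
  apply: (measurable_comp (measurable_Rplus)) => //.
  by move=> _ [s _ <-]; rewrite /Rplus/= in_itv/= expR_gt0.
apply: measurable_funM; first by solve_measurable.
exact: (measurableT_comp (@normr_measurable _ _)).
Qed.

Lemma log_profile_ge0 c f u : 0 <= log_profile c f u.
Proof. by rewrite mulr_ge0 ?expR_ge0. Qed.

Lemma line_conv_integrand_ge0 eta F s u : (forall u, 0 <= F u) ->
  (0 <= (expR (- eta * (s - u)))%:E * H (s - u) * (F u)%:E)%E.
Proof. by move=> F0; rewrite !mule_ge0 ?lee_fin ?expR_ge0. Qed.

Lemma measurable_line_conv_integrand eta F : measurable_fun setT F ->
  measurable_fun setT (fun z : R * R =>
    ((expR (- eta * (z.1 - z.2)))%:E * H (z.1 - z.2) * (F z.2)%:E)%E).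
Proof.
move=> mF; apply: emeasurable_funM; last first.
  by apply/measurable_EFinP; solve_measurable.
apply: emeasurable_funM; first by apply/measurable_EFinP; solve_measurable.
by apply: (measurableT_comp mH); solve_measurable.
Qed.

Lemma measurable_line_conv_integrand1 eta F s : measurable_fun setT F ->
  measurable_fun setT (fun u =>
    ((expR (- eta * (s - u)))%:E * H (s - u) * (F u)%:E)%E).
Proof.
move=> mF; exact: (measurableT_comp (measurable_line_conv_integrand eta mF) (pair1_measurable s)).
Qed.

Lemma measurable_line_conv eta F : measurable_fun setT F -> (forall u, 0 <= F u) ->
  measurable_fun setT (line_conv eta F).
Proof.
move=> mF F0; apply: (@measurable_fun_fubini_tonelli_F _ _ _ _ _ mu _
  (measurable_line_conv_integrand eta mF)).
by move=> z; exact: line_conv_integrand_ge0.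
Qed.

Lemma line_conv_ge0 eta F s : (forall u, 0 <= F u) -> (0 <= line_conv eta F s)%E.
Proof. by move=> F0; apply: integral_ge0 => u _; exact: line_conv_integrand_ge0. Qed.

Lemma measurable_potential_integrand x f : 0 < x -> measurable_fun (@Rplus R) f ->
  measurable_fun (@Rplus R) (fun y => potential_kernel alpha sigma x y * (f y)%:E)%E.
Proof.
move=> x0 mf; apply: emeasurable_funM; first exact: measurable_potential_kernel.
exact/measurable_EFinP.
Qed.

(** The Jacobian e^u and the powers of the kernel combine for every c, which can
therefore be chosen according to p. *)
Lemma abs_potentialE c f s : measurable_fun (@Rplus R) f ->
  (\int[mu]_(y in Rplus) `|potential_kernel alpha sigma (expR s) y * (f y)%:E| =
   (expR ((2 * sigma - c) * s))%:E * line_conv (sigma + 2^-1 - c) (log_profile c f) s)%E.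
Proof.
move=> mf; rewrite integral_Rplus_expR; last 2 first.
- apply: (@measurableT_comp _ _ _ _ _ _ (@abse R)) => //.
  by apply: measurable_potential_integrand => //; exact: expR_gt0.
- by move=> y _; exact: abse_ge0.
rewrite -ge0_integralZl_EFin ?expR_ge0//; last 2 first.
- by move=> u _; apply: line_conv_integrand_ge0 => v; exact: log_profile_ge0.
- by apply: measurable_line_conv_integrand1; exact: measurable_log_profile.
apply: eq_integral => u _.
rewrite abseM gee0_abs; last by rewrite potential_kernel_ge0 ?expR_gt0.
rewrite potential_kernelE ?expR_gt0// !expRK /log_profile.
rewrite (muleC _ (H _)) abse_EFin -!muleA -!EFinM.
rewrite !(muleCA _ (H _)) -!EFinM; congr (_ * _%:E)%E.
set A := `|_|.
have h : expR ((sigma - 2^-1) * (s + u)) * expR u = expR ((2 * sigma - c) * s) *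
    (expR (- (sigma + 2^-1 - c) * (s - u)) * expR (c * u)).
  by rewrite -!expRD; congr expR; field.
by rewrite mulrCA h; ring.
Qed.

Lemma potentialE c f s : measurable_fun (@Rplus R) f -> (forall x, 0 < x -> 0 <= f x) ->
  (potential alpha sigma f (expR s) =
   (expR ((2 * sigma - c) * s))%:E * line_conv (sigma + 2^-1 - c) (log_profile c f) s)%E.
Proof.
move=> mf f0; rewrite -abs_potentialE//; apply: eq_integral => y.
rewrite inE /Rplus/= in_itv/= andbT => y0; rewrite gee0_abs//.
by rewrite mule_ge0 ?potential_kernel_ge0 ?expR_gt0// lee_fin f0.
Qed.

Lemma integrable_potentialP c f x : measurable_fun (@Rplus R) f -> 0 < x ->
  mu.-integrable Rplus (fun y => potential_kernel alpha sigma x y * (f y)%:E)%E <->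
  (line_conv (sigma + 2^-1 - c) (log_profile c f) (ln x) < +oo)%E.
Proof.
move=> mf x0; have := abs_potentialE c (ln x) mf; rewrite lnK// => E.
have h : (\int[mu]_(y in Rplus) `|potential_kernel alpha sigma x y * (f y)%:E| < +oo)%E <->
  (line_conv (sigma + 2^-1 - c) (log_profile c f) (ln x) < +oo)%E.
  have := line_conv_ge0 (sigma + 2^-1 - c) (ln x) (log_profile_ge0 c f).
  rewrite E; case: line_conv => [r| |]// _; first by rewrite -EFinM !ltry.
  by rewrite gt0_muley// lte_fin expR_gt0.
split; first by move=> /integrableP[_ /h].
by move=> /h ?; apply/integrableP; split => //; exact: measurable_potential_integrand.
Qed.

Lemma line_convN eta F s : measurable_fun setT F -> (forall u, 0 <= F u) ->
  line_conv eta F s = line_conv (- eta) (F \o -%R) (- s).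
Proof.
move=> mF F0; rewrite /line_conv.
rewrite -[RHS](@integral_affine _ (-1) 0); first last.
- by move=> u; apply: line_conv_integrand_ge0 => v; exact: F0.
- apply: measurable_line_conv_integrand1; apply: measurableT_comp => //.
- by right.
apply: eq_integral => u _; rewrite /= addr0 mulN1r !opprK.
rewrite (_ : - s + u = - (s - u)); last by ring.
by rewrite line_kernelN mulrN mulNr.
Qed.

Lemma line_conv_le_conv eta F k s : measurable_fun setT F -> (forall u, 0 <= F u) ->
  measurable_fun setT k -> (forall v, 0 <= k v) ->
  (forall v, v != 0 -> ((expR (- eta * v))%:E * H v <= (k v)%:E)%E) ->
  (line_conv eta F s <= conv k F s)%E.
Proof.
move=> mF F0 mk k0 Hk; apply: ae_ge0_le_integral => //.
- by move=> u _; exact: line_conv_integrand_ge0.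
- exact: measurable_line_conv_integrand1.
- by move=> u _; rewrite lee_fin mulr_ge0.
- by apply/measurable_EFinP; solve_measurable.
exists [set s]; split => //; first exact: lebesgue_measure_set1.
move=> u /=; apply: contra_notP => us _.
rewrite EFinM; apply: lee_wpmul2r; first by rewrite lee_fin.
by apply: Hk; rewrite subr_eq0; apply/eqP => su; apply: us.
Qed.

Lemma line_conv_ge_itv eta F s l w m : 0 <= w -> 0 <= m ->
  measurable_fun setT F -> (forall u, 0 <= F u) ->
  (forall u, l <= u <= l + w ->
     (m%:E <= (expR (- eta * (s - u)))%:E * H (s - u) * (F u)%:E)%E) ->
  ((m * w)%:E <= line_conv eta F s)%E.
Proof.
move=> w0 m0 mF F0; apply: integral_ge_itv => //.
- exact: measurable_line_conv_integrand1.
- by move=> u; exact: line_conv_integrand_ge0.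
Qed.

Lemma line_conv_scale eta F s l : 0 <= l -> measurable_fun setT F -> (forall u, 0 <= F u) ->
  line_conv eta (fun u => l * F u) s = (l%:E * line_conv eta F s)%E.
Proof.
move=> l0 mF F0; rewrite -ge0_integralZl_EFin//; last 2 first.
- by move=> u _; exact: line_conv_integrand_ge0.
- exact: measurable_line_conv_integrand1.
by apply: eq_integral => u _; rewrite EFinM muleCA.
Qed.

Lemma le_line_conv eta F G s : measurable_fun setT F -> measurable_fun setT G ->
  (forall u, 0 <= F u) -> (forall u, F u <= G u) ->
  (line_conv eta F s <= line_conv eta G s)%E.
Proof.
move=> mF mG F0 FG; apply: ge0_le_integral => //.
- by move=> u _; exact: line_conv_integrand_ge0.
- exact: measurable_line_conv_integrand1.
- exact: measurable_line_conv_integrand1.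
- by move=> u _; apply: lee_wpmul2l; rewrite ?lee_fin// mule_ge0// lee_fin expR_ge0.
Qed.

Lemma line_convD eta F G s : measurable_fun setT F -> measurable_fun setT G ->
  (forall u, 0 <= F u) -> (forall u, 0 <= G u) ->
  line_conv eta (fun u => F u + G u) s = (line_conv eta F s + line_conv eta G s)%E.
Proof.
move=> mF mG F0 G0; rewrite -ge0_integralD//; last 4 first.
- by move=> u _; exact: line_conv_integrand_ge0.
- exact: measurable_line_conv_integrand1.
- by move=> u _; exact: line_conv_integrand_ge0.
- exact: measurable_line_conv_integrand1.
apply: eq_integral => u _; rewrite EFinD ge0_muleDr//; rewrite lee_fin//.
Qed.

(** * Boundedness of the convolution *)

(** Bounds e^(- eta v) H(v) for e = beta - |eta| and d = 1 - 2 tau. *)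
Definition majorant (C e d v : R) : R := C * (expR (- e * `|v|) * (1 + `|v| `^ (- d))).

Lemma majorant_ge0 C e d v : 0 <= C -> 0 <= majorant C e d v.
Proof. by move=> C0; rewrite /majorant; nonneg. Qed.

Lemma measurable_majorant C e d : measurable_fun setT (majorant C e d).
Proof. by rewrite /majorant; solve_measurable. Qed.

Lemma powR_norm_le1 d v : 0 <= d -> 1 <= `|v| -> `|v| `^ (- d) <= 1.
Proof.
move=> d0 v1; rewrite powRN invf_le1 ?powR_gt0 ?(lt_le_trans ltr01 v1)//.
by rewrite -[leLHS](powRr0 `|v|) ler_powR.
Qed.

Lemma integral_majorant C e d r : 0 <= C -> 0 < e -> 0 < r -> 0 < d -> r * d < 1 ->
  exists2 K, 0 <= K & (\int[mu]_v (majorant C e d v `^ r)%:E <= K%:E)%E.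
Proof.
move=> C0 e0 r0 d0 rd.
pose c := 1 - r * d.
have c0 : 0 < c by rewrite /c; lra.
pose A := C `^ r * 2 `^ r.
have A0 : 0 <= A by rewrite /A; nonneg.
exists (A * (2 / (r * e) + 2 / c)).
  by rewrite mulr_ge0// addr_ge0// divr_ge0 ?mulr_ge0// ltW.
apply: (@le_trans _ _ (\int[mu]_v (A * (expR (- (r * e) * `|v|) +
   \1_`]-oo, 1] `|v| * `|v| `^ (c - 1)))%:E)%E); last first.
  rewrite integralZ_real; [|by solve_measurable|by move=> v; nonneg|by []].
  rewrite integralD_real; [|by solve_measurable|by solve_measurable|by move=> v; nonneg|by move=> v; nonneg].
  rewrite integral_expR_abs ?mulr_gt0// integral_powR_near// powR1 mulr1.
  by rewrite -EFinD -EFinM.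
apply: le_integral_real.
- by have := measurable_majorant C e d => ?; solve_measurable.
- by solve_measurable.
- by move=> v; nonneg.
move=> v; rewrite /majorant powRM//.
rewrite /A -mulrA; apply: ler_wpM2l; first exact: powR_ge0.
rewrite powRM ?expR_ge0//.
rewrite powR_expR; set X := `|v| `^ (- d).
have X0 : 0 <= X := powR_ge0 _ _.
have [X1|X1] := leP X 1.
  rewrite mulrDr; apply: (@le_trans _ _ (2 `^ r * expR (- (r * e) * `|v|))); last first.
    by rewrite lerDl; nonneg.
  rewrite mulrC (_ : r * (- e * `|v|) = - (r * e) * `|v|); last by ring.
  rewrite ler_wpM2r ?expR_ge0// ge0_ler_powR ?nnegrE ?(ltW r0)//; lra.
have v1 : `|v| <= 1.
  by rewrite leNgt; apply/negP => /ltW/(powR_norm_le1 (ltW d0)); rewrite leNgt -/X X1.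
rewrite mulrDr; apply: (@le_trans _ _ (2 `^ r * (X `^ r))); last first.
  rewrite indicE mem_setE in_itv/= v1 mul1r /X -powRrM.
  rewrite (_ : - d * r = c - 1); last by rewrite /c; ring.
  by rewrite lerDr; nonneg.
rewrite -powRM//; apply: (@le_trans _ _ ((1 + X) `^ r)).
  rewrite ler_piMl ?powR_ge0// -[leRHS](expR0 R) ler_expR.
  have h : 0 <= r * (e * `|v|) by nonneg.
  by rewrite mulNr mulrN oppr_le0.
by rewrite ge0_ler_powR ?nnegrE ?(ltW r0)//; lra.
Qed.

(** The decaying factor is at most a multiple of x^(- d), by x^d <= 1 + x. *)
Lemma expR_powR_absorb (x e d : R) : 0 < x -> 0 < e -> 0 < d -> d <= 1 ->
  expR (- e * x) * (1 + x `^ (- d)) <= (2 + 2 * e^-1) * x `^ (- d).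
Proof.
move=> x0 e0 d0 d1.
have X0 : 0 < x `^ (- d) by rewrite powR_gt0.
have E1 : expR (- e * x) <= 1.
  by rewrite -[leRHS](expR0 R) ler_expR mulNr oppr_le0 mulr_ge0 ?ltW.
suff : expR (- e * x) <= (1 + 2 * e^-1) * x `^ (- d).
  move: (ler_piMl (ltW X0) E1); set X := _ `^ _; set E := expR _ => EX h.
  by rewrite mulrDr mulr1; lra.
have xd : x `^ d <= 1 + x.
  have [x1|x1] := leP x 1.
    have := ge0_ler_powR (ltW d0) (ltW x0 : x \is Num.nneg) (ler01 : 1 \is Num.nneg) x1.
    by rewrite powR1 => h; rewrite (le_trans h)// lerDl ltW.
  by apply: (@le_trans _ _ x); [rewrite ler1_powR// ltW|rewrite lerDr].
have xe : 1 + x <= (1 + 2 * e^-1) * expR (e * x).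
  have ei : 0 < e^-1 by rewrite invr_gt0.
  have h : 1 + e * x <= expR (e * x) := expR_ge1Dx _.
  apply: (@le_trans _ _ ((1 + 2 * e^-1) * (1 + e * x))).
    have eex : e^-1 * (e * x) = x by rewrite mulKf ?gt_eqF.
    have ex : 0 <= e * x := mulr_ge0 (ltW e0) (ltW x0).
    move: (e * x) (e^-1) ex ei eex => z w z0 w0 <-; rewrite mulrDl mul1r !mulrDr.
    have : 0 <= w * z := mulr_ge0 (ltW w0) z0.
    lra.
  by rewrite ler_wpM2l// addr_ge0// mulr_ge0// ltW.
rewrite powRN ler_pdivlMr ?powR_gt0// mulNr expRN mulrC ler_pdivrMr ?expR_gt0//.
exact: le_trans xd xe.
Qed.

Lemma kernel_majorant eta tau : 0 < tau -> tau < 2^-1 -> tau <= sigma ->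
  exists2 C, 0 < C & forall v, v != 0 -> ((expR (- eta * v))%:E * H v <=
    (majorant C (beta - `|eta|) (1 - 2 * tau) v)%:E)%E.
Proof.
move=> t0 t1 ts.
have [C C0 HC] := line_kernel_ub halpha hsigma0 hsigma t0 t1 ts.
exists C => // v v0.
apply: (@le_trans _ _ ((expR (`|eta| * `|v|))%:E *
   (C * (expR (- beta * `|v|) * (1 + `|v| `^ (2 * tau - 1))))%:E)%E).
  apply: lee_pmul => //.
    by rewrite lee_fin ler_expR -normrM (le_trans (ler_norm _))// mulNr normrN.
  exact: HC.
rewrite -EFinM lee_fin /majorant mulrCA ler_wpM2l ?(ltW C0)// mulrA -expRD.
rewrite le_eqVlt; apply/orP; left; apply/eqP; congr (expR _ * _); first by ring.
by rewrite opprB.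
Qed.

Lemma pick_tau rho : 0 <= rho -> rho < 1 -> rho < 2 * sigma ->
  exists tau, [/\ 0 < tau, tau < 2^-1, tau <= sigma & rho < 2 * tau].
Proof.
move=> r0 r1 rs; have [s1|s1] := ltP sigma 2^-1.
  by exists sigma; split.
by exists ((1 + rho) / 4); split; lra.
Qed.

(** Young's inequality with 1/r = 1 + 1/q - 1/p applies to the majorant if
1/p - 1/q < 2 tau, which can be arranged when 1/q - 1/p + 2 sigma > 0.  If this
number is 0, then sigma < 1/2 and tau = sigma is the borderline case; there the
exponential factor turns the majorant into a multiple of |v|^(2 sigma - 1). *)
Lemma line_conv_bounded_finite p q eta : 1 <= p -> p <= q -> `|eta| < beta ->
  0 <= q^-1 - p^-1 + 2 * sigma -> (q^-1 - p^-1 + 2 * sigma = 0 -> p != 1) ->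
  exists2 C, 0 <= C & forall F, measurable_fun setT F -> (forall u, 0 <= F u) ->
    (\int[mu]_u (F u `^ p)%:E <= 1)%E ->
    (\int[mu]_s (line_conv eta F s `^ q) <= C%:E)%E.
Proof.
move=> p1 pq etab e0 eN.
have p0 : 0 < p by lra.
have q0 : 0 < q by lra.
have pi1 : p^-1 <= 1 by rewrite invf_le1.
have qi0 : 0 < q^-1 by rewrite invr_gt0.
have qp : q^-1 <= p^-1 by rewrite lef_pV2.
have eps0 : 0 < beta - `|eta| by rewrite subr_gt0.
have reduce k K : measurable_fun setT k -> (forall v, 0 <= k v) ->
    (forall v, v != 0 -> ((expR (- eta * v))%:E * H v <= (k v)%:E)%E) ->
    (forall F, measurable_fun setT F -> (forall u, 0 <= F u) ->
      (\int[mu]_u (F u `^ p)%:E <= 1)%E -> (\int[mu]_s (conv k F s `^ q) <= K%:E)%E) ->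
    forall F, measurable_fun setT F -> (forall u, 0 <= F u) ->
    (\int[mu]_u (F u `^ p)%:E <= 1)%E ->
    (\int[mu]_s (line_conv eta F s `^ q) <= K%:E)%E.
  move=> mk k0 Hk kK F mF F0 F1; apply: le_trans (kK F mF F0 F1).
  apply: ge0_le_integral => //.
  - by move=> s _; exact: poweR_ge0.
  - exact: (measurableT_comp (measurable_poweR q) (measurable_line_conv eta mF F0)).
  - exact: (measurableT_comp (measurable_poweR q) (measurable_conv mk mF k0 F0)).
  - move=> s _; apply: gt0_ler_poweR; rewrite ?(ltW q0)// ?in_itv/= ?leey ?andbT.
    + exact: line_conv_ge0.
    + exact: conv_ge0.
    + exact: line_conv_le_conv.
have [e1|e1] := ltP 0 (q^-1 - p^-1 + 2 * sigma).
  have r0 : 0 <= p^-1 - q^-1 by lra.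
  have r1 : p^-1 - q^-1 < 1 by lra.
  have r2 : p^-1 - q^-1 < 2 * sigma by lra.
  have [tau [t0 t1 ts rt]] := pick_tau r0 r1 r2.
  have [C C0 HC] := kernel_majorant eta t0 t1 ts.
  pose r := (1 + q^-1 - p^-1)^-1.
  have ri : r^-1 = 1 + q^-1 - p^-1 by rewrite invrK.
  have rp : 0 < r by rewrite invr_gt0; lra.
  have [||K K0 HK] := @integral_majorant C (beta - `|eta|) (1 - 2 * tau) r (ltW C0) eps0 rp.
  - by lra.
  - by rewrite mulrC -ltr_pdivlMr// mul1r ri; lra.
  exists ((2 + K) `^ q * K); first by nonneg.
  apply: (reduce (majorant C (beta - `|eta|) (1 - 2 * tau))) => //.
  - exact: measurable_majorant.
  - by move=> v; exact: majorant_ge0 (ltW C0).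
  move=> F mF F0 F1; apply: (@young _ p q r) => //.
  - exact: measurable_majorant.
  - by move=> v; exact: majorant_ge0 (ltW C0).
have eE : q^-1 - p^-1 + 2 * sigma = 0 by apply/eqP; rewrite eq_le e1 e0.
have pp : 1 < p by rewrite lt_neqAle eq_sym eN.
have pi1' : p^-1 < 1 by rewrite invf_lt1.
have s1 : sigma < 2^-1 by lra.
have [C C0 HC] := kernel_majorant eta hsigma0 s1 (lexx _).
have th0 : 0 < 2 * sigma by hlra.
have qE : q^-1 = p^-1 - 2 * sigma by lra.
have [K K0 HK] := hardy_littlewood_sobolev pp th0 q0 qE.
set e := beta - `|eta| in eps0 HC.
pose C1 := C * (2 + 2 * e^-1).
have C10 : 0 < C1 by rewrite mulr_gt0// addr_gt0// mulr_gt0// invr_gt0.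
pose k v : R := C1 * `|v| `^ (2 * sigma - 1).
have k0 v : 0 <= k v by rewrite /k mulr_ge0 ?powR_ge0 ?ltW.
have mk : measurable_fun setT k by rewrite /k; solve_measurable.
exists (C1 `^ q * K); first by nonneg.
apply: (reduce k) => //.
  move=> v v0; apply: (le_trans (HC v v0)); rewrite lee_fin /majorant /k /C1 -mulrA.
  rewrite ler_wpM2l ?(ltW C0)// -/e (_ : - (1 - 2 * sigma) = 2 * sigma - 1); last by ring.
  have x0 : 0 < `|v| by rewrite normr_gt0.
  have d0 : 0 < 1 - 2 * sigma by lra.
  have d1 : 1 - 2 * sigma <= 1 by hlra.
  have dE : - (1 - 2 * sigma) = 2 * sigma - 1 by ring.
  by have := expR_powR_absorb x0 eps0 d0 d1; rewrite dE.
move=> F mF F0 F1.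
have kE s : (conv k F s = C1%:E * conv (fun v => `|v| `^ (2 * sigma - 1))%R F s)%E.
  rewrite /conv /k -integralZ_real; [|by solve_measurable|by move=> u; nonneg|exact: ltW].
  by apply: eq_integral => u _; rewrite mulrA.
under eq_integral do rewrite kE.
under eq_integral => s _.
  rewrite poweRM ?lee_fin ?(ltW C10)//; last by apply: conv_ge0 => // v; exact: powR_ge0.
  over.
rewrite poweR_EFin ge0_integralZl_EFin ?powR_ge0//; last 2 first.
- by move=> s _; exact: poweR_ge0.
- apply: (measurableT_comp (measurable_poweR q)).
  by apply: measurable_conv => //; solve_measurable.
rewrite EFinM lee_wpmul2l ?lee_fin ?powR_ge0//; exact: HK.
Qed.

(** The majorant is in L^r with 1/r = 1 - 1/p. *)
Lemma line_conv_bounded_infinite p eta : 1 < p -> `|eta| < beta -> p^-1 < 2 * sigma ->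
  exists2 C, 0 <= C & forall F, measurable_fun setT F -> (forall u, 0 <= F u) ->
    (\int[mu]_u (F u `^ p)%:E <= 1)%E -> forall s, (line_conv eta F s <= C%:E)%E.
Proof.
move=> p1 etab ps.
have p0 : 0 < p by lra.
have pi0 : 0 < p^-1 by rewrite invr_gt0.
have pi1 : p^-1 < 1 by rewrite invf_lt1.
have eps0 : 0 < beta - `|eta| by rewrite subr_gt0.
have [tau [t0 t1 ts rt]] := pick_tau (ltW pi0) pi1 ps.
have [C C0 HC] := kernel_majorant eta t0 t1 ts.
pose r := (1 - p^-1)^-1.
have ri : r^-1 = 1 - p^-1 by rewrite invrK.
have rp : 0 < r by rewrite invr_gt0; lra.
have [||K K0 HK] := @integral_majorant C (beta - `|eta|) (1 - 2 * tau) r (ltW C0) eps0 rp.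
- by lra.
- by rewrite mulrC -ltr_pdivlMr// mul1r ri; lra.
exists (K + 1); first by lra.
move=> F mF F0 F1 s.
have mm := measurable_majorant C (beta - `|eta|) (1 - 2 * tau).
have m0 v := majorant_ge0 (beta - `|eta|) (1 - 2 * tau) v (ltW C0).
apply: le_trans (line_conv_le_conv s mF F0 mm m0 HC) _.
by apply: (@conv_le_holder _ p r) => //; rewrite ri; ring.
Qed.

Lemma line_conv_bounded_L1 eta : `|eta| <= beta -> 2^-1 < sigma ->
  exists2 C, 0 <= C & forall F, measurable_fun setT F -> (forall u, 0 <= F u) ->
    (\int[mu]_u (F u)%:E <= 1)%E -> forall s, (line_conv eta F s <= C%:E)%E.
Proof.
move=> etab s1; have [C C0 HC] := line_kernel_ub_bounded halpha hsigma0 hsigma s1.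
exists C; first exact: ltW.
move=> F mF F0 F1 s.
apply: (@le_trans _ _ (conv (fun=> C) F s)).
  apply: line_conv_le_conv => //; first by move=> v; exact: ltW.
  move=> v _; apply: (@le_trans _ _ ((expR (`|eta| * `|v|))%:E * (C * expR (- beta * `|v|))%:E)%E).
    apply: lee_pmul => //.
      by rewrite lee_fin ler_expR -normrM (le_trans (ler_norm _))// mulNr normrN.
  rewrite -EFinM lee_fin mulrCA -expRD ler_piMr ?(ltW C0)//.
  by rewrite -[leRHS](expR0 R) ler_expR; have := normr_ge0 v; nra.
rewrite /conv integralZ_real ?(ltW C0)//.
by rewrite -[leRHS]mule1 lee_wpmul2l// lee_fin ltW.
Qed.

Lemma line_conv_bounded_one eta : `|eta| < beta ->
  exists2 C, 0 <= C & forall s, (line_conv eta (fun=> 1)%R s <= C%:E)%E.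
Proof.
move=> etab; have eps0 : 0 < beta - `|eta| by rewrite subr_gt0.
have s2 : 0 < 2 * sigma by hlra.
have [tau [t0 t1 ts rt]] := pick_tau (lexx 0) ltr01 s2.
have [C C0 HC] := kernel_majorant eta t0 t1 ts.
have [||K K0 HK] := @integral_majorant C (beta - `|eta|) (1 - 2 * tau) 1 (ltW C0) eps0 ltr01.
- by lra.
- by lra.
exists K => // s.
have mm := measurable_majorant C (beta - `|eta|) (1 - 2 * tau).
have m0 v := majorant_ge0 (beta - `|eta|) (1 - 2 * tau) v (ltW C0).
have m1 : measurable_fun setT (fun _ : R => 1 : R) by [].
apply: le_trans (line_conv_le_conv s m1 (fun=> ler01) mm m0 HC) _.
rewrite /conv; under eq_integral do rewrite mulr1.
rewrite integral_shift_reflect//; apply: le_trans HK.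
by rewrite le_eqVlt; apply/orP; left; apply/eqP; apply: eq_integral => v _; rewrite powRr1.
Qed.

(** For |eta| = beta the majorant of k is only bounded away from 0.  Multiplied by
e^(- |s|), the convolution nevertheless has a finite integral by Tonelli's
theorem.  The conclusion is in terms of x = e^s, as the density e^s ds carries
integrals, hence null sets, to the half-line. *)
Lemma line_conv_ae_finite eta G : `|eta| <= beta ->
  measurable_fun setT G -> (forall u, 0 <= G u) -> (\int[mu]_u (G u)%:E < +oo)%E ->
  {ae mu, forall x, Rplus x -> (line_conv eta G (ln x) < +oo)%E}.
Proof.
move=> etab mG G0 Gfin.
have s2 : 0 < 2 * sigma by hlra.
have [tau [t0 t1 ts _]] := pick_tau (lexx 0) ltr01 s2.
have [C C0 HC] := kernel_majorant eta t0 t1 ts.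
set d := 1 - 2 * tau in HC; set e := beta - `|eta| in HC.
have e0 : 0 <= e by rewrite subr_ge0.
have d0 : 0 < d by rewrite /d; lra.
pose n (v : R) : R := \1_`]-oo, 1] `|v| * `|v| `^ (2 * tau - 1).
have n0 v : 0 <= n v by rewrite /n; nonneg.
have mn : measurable_fun setT n by rewrite /n; solve_measurable.
pose w (s : R) : R := expR (- 1 * `|s|).
have w0 s : 0 <= w s by exact: expR_ge0.
have mw : measurable_fun setT w by rewrite /w; solve_measurable.
have w1 s : w s <= 1 by rewrite -[leRHS](expR0 R) ler_expR mulN1r oppr_le0.
have mm := measurable_majorant C e d.
have m0 v := majorant_ge0 e d v (ltW C0).
have Kfin : (\int[mu]_s ((w s)%:E * line_conv eta G s) < +oo)%E.
  apply: (@le_lt_trans _ _ (\int[mu]_s \int[mu]_u (C * (2 * w s + n (s - u)) * G u)%:E)%E).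
    apply: ge0_le_integral => //.
    - by move=> s _; rewrite mule_ge0 ?lee_fin ?line_conv_ge0.
    - by apply: emeasurable_funM; [exact/measurable_EFinP|exact: measurable_line_conv].
    - apply: (@measurable_fun_fubini_tonelli_F _ _ _ _ _ mu
        (fun z : R * R => (C * (2 * w z.1 + n (z.1 - z.2)) * G z.2)%:E)).
        by apply/measurable_EFinP; solve_measurable.
      by move=> z; rewrite lee_fin; have := ltW C0 => ?; nonneg.
    - move=> s _; apply: (@le_trans _ _ ((w s)%:E * conv (majorant C e d) G s)%E).
        by apply: lee_wpmul2l; rewrite ?lee_fin//; exact: line_conv_le_conv.
      rewrite /conv -integralZ_real; [|by solve_measurable|by move=> u; nonneg|by []].
      apply: le_integral_real; [by solve_measurable|by solve_measurable|by move=> u; nonneg|].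
      move=> u; rewrite mulrA ler_wpM2r// /majorant mulrCA ler_wpM2l ?(ltW C0)//.
      set v := s - u; rewrite mulrA.
      apply: (@le_trans _ _ (w s * (1 + `|v| `^ (- d)))).
        rewrite ler_wpM2r//.
        rewrite ler_piMr// -[leRHS](expR0 R) ler_expR.
        by have := normr_ge0 v; nra.
      have X0 : 0 <= `|v| `^ (- d) := powR_ge0 _ _.
      have [v1|v1] := leP `|v| 1.
        rewrite /n indicE mem_setE in_itv/= v1 mul1r (_ : 2 * tau - 1 = - d); last by rewrite /d; ring.
        by have := w0 s; have := w1 s; nra.
      have := powR_norm_le1 (ltW d0) (ltW v1); have := n0 v; have := w0 s; nra.
  rewrite (@tonelli _ (fun s u => C * (2 * w s + n (s - u)) * G u)); last 2 first.
  - by solve_measurable.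
  - by move=> s u; have := ltW C0 => ?; nonneg.
  pose K := C * (2 * (2 / 1) + 2 / (2 * tau) * 1 `^ (2 * tau)).
  rewrite (_ : (fun u => _) = fun u => (K * G u)%:E); last first.
    apply/funext => u.
    transitivity (\int[mu]_s ((C * G u) * (2 * w s + n (s - u)))%:E)%E.
      by apply: eq_integral => s _; congr (_%:E); ring.
    have CG : 0 <= C * G u by have := ltW C0 => ?; nonneg.
    rewrite integralZ_real//; [|by solve_measurable|by move=> s; nonneg].
    rewrite integralD_real; [|by solve_measurable|by solve_measurable|by move=> s; nonneg|by move=> s; nonneg].
    rewrite integralZ_real// integral_expR_abs// integral_shift// integral_powR_near//; last by lra.
    by apply: (congr1 EFin); rewrite /K; ring.
  have K0 : 0 <= K by have := ltW C0 => ?; have := ltW t0 => ?; rewrite /K; nonneg.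
  rewrite integralZ_real//.
  have := integral_real_ge0 G0; move: Gfin; case: integral => [g| |]// _ _.
  by rewrite -EFinM ltry.
pose g (s : R) : \bar R := ((expR (- s) * w s)%:E * line_conv eta G s)%E.
have mg : measurable_fun setT g.
  by apply: emeasurable_funM; [apply/measurable_EFinP; solve_measurable|exact: measurable_line_conv].
have g0 s : (0 <= g s)%E by rewrite mule_ge0 ?line_conv_ge0// lee_fin; nonneg.
have gfin : (\int[mu]_(x in Rplus) g (ln x) < +oo)%E.
  rewrite integral_ln_Rplus//.
  rewrite (_ : (fun s => _) = fun s => ((w s)%:E * line_conv eta G s)%E)//.
  apply/funext => s; rewrite /g muleAC -EFinM; congr (_%:E * _)%E.
  by rewrite mulrAC -expRD addNr expR0 mul1r.
have mgl : measurable_fun (@Rplus R) (fun x => g (ln x)).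
  by apply: measurable_funTS; exact: (measurableT_comp mg).
have gi : mu.-integrable (@Rplus R) (fun x => g (ln x)).
  apply/integrableP; split => //.
  by under eq_integral do rewrite gee0_abs//.
apply: filterS (integrable_ae _ gi); last exact: measurable_Rplus.
move=> x /= gx /gx; rewrite /g.
have := line_conv_ge0 eta (ln x) G0.
case: line_conv => [r| |]//; first by rewrite ltry.
by rewrite gt0_muley// lte_fin mulr_gt0 ?expR_gt0.
Qed.

End Transfer.

(** * Norms in logarithmic coordinates *)

Section Norms.
Context {R : realType}.
Local Notation mu := (@lebesgue_measure R).
Implicit Types (f F : R -> R) (a b c r s u v w x y l m : R) (p q : \bar R).

Lemma recip_fin r : recip r%:E = r^-1.
Proof.
rewrite /recip inver; case: eqP => [->|_] //=; by rewrite invr0.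
Qed.

Lemma recip_oo : recip (+oo%E : \bar R) = 0.
Proof. by rewrite /recip invey. Qed.

Lemma recip_conjugate p : (1 <= p)%E -> recip (hoelder_conjugate p) = 1 - recip p.
Proof.
case: p => [r| |]// r1; last first.
  by rewrite hoelder_conjugatey recip_fin recip_oo invr1 subr0.
rewrite lee_fin in r1.
rewrite recip_fin /hoelder_conjugate/=.
have rn0 : (r%:E == 0 :> \bar R) = false by rewrite eqe; apply/eqP; lra.
rewrite rn0 -EFinB inver subr_eq0; case: eqP => [->|/eqP rn1].
  by rewrite mul1e recip_oo invr1 subrr.
by rewrite -EFinM recip_fin; field; move/eqP: rn1 => rn1; apply/andP; split; apply/eqP; lra.
Qed.

Lemma conjugate_eq1 p : (1 <= p)%E -> (hoelder_conjugate p == 1%E) = (p == +oo%E).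
Proof.
case: p => [r| |]// r1; last by rewrite hoelder_conjugatey !eqxx.
apply/negP => /eqP h.
have := recip_conjugate r1; rewrite h !recip_fin invr1 => /eqP.
rewrite lee_fin in r1; have : 0 < r^-1 by rewrite invr_gt0; lra.
move=> ? /eqP; lra.
Qed.

(** Monotonicity from the definition by simple functions; it spares a proof that
the potential of a signed function is measurable. *)
Lemma le_integral_ge0 (g h : R -> \bar R) : (forall x, 0 <= g x)%E ->
  (forall x, g x <= h x)%E -> (\int[mu]_x g x <= \int[mu]_x h x)%E.
Proof.
move=> g0 gh; rewrite !ge0_integralTE//; last by move=> x; exact: le_trans (gh x).
apply: ereal_sup_le => _ [k kg <-].
by exists k => // x; exact: le_trans (kg x) (gh x).
Qed.

Lemma le_Lpnorm p (g h : R -> \bar R) : (0 < p)%E ->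
  (forall x, 0 < x -> (`|g x| <= `|h x|)%E) -> (Lpnorm p g <= Lpnorm p h)%E.
Proof.
move=> p1 gh.
have gh' x : (`|(g \_ (@Rplus R)) x| <= `|(h \_ (@Rplus R)) x|)%E.
  rewrite !patchE; case: ifPn => // /[!inE]; rewrite /Rplus/= in_itv/= andbT.
  exact: gh.
rewrite /Lpnorm unlock; case: p p1 => [r| |]// r0.
  rewrite lte_fin in r0.
  apply: gt0_ler_poweR; first by rewrite invr_ge0 ltW.
  - by rewrite in_itv/= leey andbT; apply: integral_ge0 => x _; exact: poweR_ge0.
  - by rewrite in_itv/= leey andbT; apply: integral_ge0 => x _; exact: poweR_ge0.
  apply: le_integral_ge0 => x; first exact: poweR_ge0.
  by apply: gt0_ler_poweR; rewrite ?(ltW r0) ?in_itv/= ?leey ?andbT.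
by case: ifPn => // _; apply: le_ess_sup; exact: nearW.
Qed.

Lemma le_poweR_fin (X : \bar R) l r : 0 < r -> 0 <= l -> (0 <= X)%E ->
  (X <= l%:E)%E = (X `^ r <= (l `^ r)%:E)%E.
Proof.
move=> r0 l0; case: X => [x| |]//; last by rewrite poweRyr ?gt_eqF// !leye_eq.
rewrite poweR_EFin !lee_fin => x0; apply/idP/idP => [xl|].
  by apply: ge0_ler_powR; rewrite ?nnegrE ?(ltW r0).
by apply: contraTT; rewrite -!ltNge => lx; apply: gt0_ltr_powR; rewrite ?nnegrE.
Qed.

(** The factor e^(s / r) is the Jacobian of x = e^s, moved inside the power. *)
Lemma Lpnorm_expR r (g : R -> \bar R) : 0 < r -> measurable_fun (@Rplus R) g ->
  (forall x, 0 < x -> (0 <= g x)%E) ->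
  (Lpnorm r%:E g `^ r = \int[mu]_s ((expR (r^-1 * s))%:E * g (expR s)) `^ r)%E.
Proof.
move=> r0 mg g0; rewrite /Lpnorm poweR_Lnorm ?gt_eqF//.
transitivity (\int[mu]_(x in Rplus) (g x `^ r))%E.
  rewrite [RHS]integral_mkcond; apply: eq_integral => x _.
  rewrite !patchE; case: ifPn => [|_]; last by rewrite abse0 poweR0r ?gt_eqF.
  by rewrite inE /Rplus/= in_itv/= andbT => x0; rewrite gee0_abs// g0.
rewrite integral_Rplus_expR; last 2 first.
- exact: (measurableT_comp (measurable_poweR r)).
- by move=> x x0; exact: poweR_ge0.
apply: eq_integral => s _; rewrite poweRM ?lee_fin ?expR_ge0 ?g0 ?expR_gt0//.
by rewrite poweR_EFin powR_expR mulrA divff ?mul1r ?gt_eqF// muleC.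
Qed.

Lemma abs_weightE a c f s : expR ((c - a) * s) * `|expR s `^ a * f (expR s)| = log_profile c f s.
Proof.
rewrite normrM powR_expR (ger0_norm (expR_ge0 _)) /log_profile mulrA -expRD.
by congr (expR _ * _); ring.
Qed.

Lemma Lpnorm_profile r a f : 0 < r -> measurable_fun (@Rplus R) f ->
  (Lpnorm r%:E (fun x => (x `^ a * f x)%:E) `^ r =
   \int[mu]_u (log_profile (a + r^-1) f u `^ r)%:E)%E.
Proof.
move=> r0 mf; have -> : (Lpnorm r%:E (fun x => (x `^ a * f x)%:E) = Lpnorm r%:E (fun x => `|x `^ a * f x|%:E))%E.
  by apply/eqP; rewrite eq_le; apply/andP; split; apply: le_Lpnorm => // x _; rewrite -!abse_EFin abse_id.
rewrite Lpnorm_expR; [|exact: r0| |by []].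
  by apply: eq_integral => s _; rewrite -EFinM -(abs_weightE a) addrAC subrr add0r poweR_EFin.
apply/measurable_EFinP; apply: (measurableT_comp (@normr_measurable _ _)).
apply: measurable_funM => //; apply: measurable_funTS; exact: measurable_powR.
Qed.

End Norms.

(** * Transfer between the potential and its convolution *)

Section PotentialNorm.
Context {R : realType}.
Local Notation mu := (@lebesgue_measure R).
Implicit Types (f F : R -> R) (G : R -> \bar R) (a b c r s u v w x y l m C : R) (p q : \bar R).

(** The nonnegative part of the unit ball of L^p(du); for p = +oo the bound holds
everywhere, which loses nothing for test profiles. *)
Definition unit_profile p F : Prop :=
  [/\ measurable_fun setT F, (forall u, 0 <= F u) &
    match p with
    | r%:E => (\int[mu]_u (F u `^ r)%:E <= 1)%E
    | _ => forall u, F u <= 1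
    end].

Definition bounded_profile q C G : Prop :=
  match q with
  | r%:E => (\int[mu]_s (G s `^ r) <= (C `^ r)%:E)%E
  | _ => forall s, (G s <= C%:E)%E
  end.

(** The inverse of log_profile c on nonnegative profiles. *)
Definition of_profile c F y : R := y `^ (- c) * F (ln y).

Lemma of_profile_ge0 c F y : (forall u, 0 <= F u) -> 0 <= of_profile c F y.
Proof. by move=> F0; rewrite mulr_ge0 ?powR_ge0. Qed.

Lemma measurable_of_profile c F : measurable_fun setT F ->
  measurable_fun (@Rplus R) (of_profile c F).
Proof.
move=> mF; apply: measurable_funTS; apply: measurable_funM; first exact: measurable_powR.
exact: (measurableT_comp mF (@measurable_ln R)).
Qed.

Lemma log_profileK c F : (forall u, 0 <= F u) -> log_profile c (of_profile c F) = F.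
Proof.
move=> F0; apply/funext => u; rewrite /log_profile ger0_norm ?of_profile_ge0//.
by rewrite /of_profile powR_expR expRK mulrA -expRD mulNr subrr expR0 mul1r.
Qed.

Lemma unit_of_profile p a F : (1 <= p)%E -> unit_profile p F ->
  weightedLp p a (of_profile (a + recip p) F) /\
  (Lpnorm p (fun x => (x `^ a * of_profile (a + recip p) F x)%:E) <= 1)%E.
Proof.
move=> p1 [mF F0 F1].
suff N1 : (Lpnorm p (fun x => (x `^ a * of_profile (a + recip p) F x)%:E) <= 1)%E.
  split => //; split; first exact: measurable_of_profile.
  exact: le_lt_trans N1 (ltry _).
case: p p1 F1 => [r| |]// p1 F1.
  have r0 : 0 < r by rewrite lee_fin in p1; lra.
  rewrite (le_poweR_fin r0)//; last exact: Lnorm_ge0.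
  rewrite powR1 Lpnorm_profile; [|exact: r0|exact: measurable_of_profile].
  by rewrite recip_fin log_profileK.
rewrite recip_oo addr0 /Lpnorm unlock; case: ifPn => // _.
apply/ess_supP; apply: nearW => x /=; rewrite patchE; case: ifPn => [|_]; last first.
  by rewrite abse0.
rewrite inE /Rplus/= in_itv/= andbT => x0.
rewrite lee_fin /of_profile mulrA powRN mulfV; last by rewrite gt_eqF// powR_gt0.
by rewrite mul1r ger0_norm.
Qed.

Lemma le_of_Lpnorm_oo x1 x2 m C (g : R -> \bar R) : 0 < x1 < x2 ->
  (forall x, x1 <= x <= x2 -> (m%:E <= `|g x|)%E) -> (Lpnorm +oo g <= C%:E)%E -> m <= C.
Proof.
move=> /andP[x10 x12] mg NC; rewrite leNgt; apply/negP => Cm.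
have m12 : measurable (`[x1, x2]%classic : set R) by exact: measurable_itv.
have I12 : (0 < mu `[x1, x2]%classic)%E.
  by rewrite lebesgue_measure_itv/= lte_fin x12 -EFinB lte_fin subr_gt0.
have muT : (0 < mu [set: R])%E.
  by apply: (lt_le_trans I12); apply: le_measure; rewrite ?inE.
move: NC; rewrite /Lpnorm unlock; case: ifPn => [_|]; last first.
  by move=> /negP[]; exact: muT.
move=> /ess_supP[N [mN N0 sub]].
have sI : `[x1, x2]%classic `<=` N.
  move=> x; rewrite /= in_itv/= => x1x; apply: sub => /=.
  have x0 : 0 < x by move/andP : x1x => [h _]; exact: lt_le_trans h.
  rewrite patchE mem_set ?/Rplus/= ?in_itv/= ?andbT//; apply/negP; rewrite -ltNge.
  by apply: (@lt_le_trans _ _ m%:E); [rewrite lte_fin|exact: mg].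
have : (mu `[x1, x2]%classic <= 0)%E by rewrite -N0; apply: le_measure => //; rewrite inE.
by rewrite leNgt I12.
Qed.

Variables alpha sigma : R.
Hypotheses (halpha : -1 < alpha) (hsigma0 : 0 < sigma) (hsigma : sigma < alpha + 1).
Local Notation line_conv := (line_conv alpha sigma).

Let W b c F s : \bar R :=
  ((expR ((2 * sigma - c - b) * s))%:E * line_conv (sigma + 2^-1 - c) F s)%E.

Let W_ge0 b c F s : (forall u, 0 <= F u) -> (0 <= W b c F s)%E.
Proof. by move=> F0; rewrite mule_ge0 ?lee_fin ?expR_ge0// line_conv_ge0. Qed.

Let measurable_W b c F : measurable_fun setT F -> (forall u, 0 <= F u) ->
  measurable_fun setT (W b c F).
Proof.
move=> mF F0; apply: emeasurable_funM; last exact: measurable_line_conv.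
by apply/measurable_EFinP; solve_measurable.
Qed.

Let weighted_potential_le b c f x : measurable_fun (@Rplus R) f -> 0 < x ->
  (`|(x `^ (- b))%:E * potential alpha sigma f x| <= W b c (log_profile c f) (ln x))%E.
Proof.
move=> mf x0; rewrite abseM abse_EFin (ger0_norm (powR_ge0 _ _)).
apply: (@le_trans _ _ ((x `^ (- b))%:E *
    \int[mu]_(y in Rplus) `|potential_kernel alpha sigma x y * (f y)%:E|)%E).
  apply: lee_wpmul2l; first by rewrite lee_fin powR_ge0.
  apply: le_abse_integral; first exact: measurable_Rplus.
  exact: measurable_potential_integrand.
rewrite -{1 2}(lnK (x := x))// (abs_potentialE _ _ _ c)// powR_expR muleA -EFinM -expRD.
by rewrite /W -mulrDl (addrC (- b)).
Qed.

Let weighted_potentialE b c F s : measurable_fun setT F -> (forall u, 0 <= F u) ->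
  ((expR s `^ (- b))%:E * potential alpha sigma (of_profile c F) (expR s) = W b c F s)%E.
Proof.
move=> mF F0; rewrite (potentialE _ _ _ c)//; last 2 first.
- exact: measurable_of_profile.
- by move=> x _; exact: of_profile_ge0.
by rewrite log_profileK// powR_expR muleA -EFinM -expRD /W -mulrDl (addrC (- b)).
Qed.

Let W_recip q b c F s :
  ((expR (recip q * s))%:E * W b c F s =
   (expR ((2 * sigma - c - b + recip q) * s))%:E * line_conv (sigma + 2^-1 - c) F s)%E.
Proof. by rewrite /W muleA -EFinM -expRD -mulrDl (addrC (recip q)). Qed.

Lemma Lpnorm_potential_le q b c C f : (1 <= q)%E -> 0 <= C -> measurable_fun (@Rplus R) f ->
  bounded_profile q C (fun s => ((expR ((2 * sigma - c - b + recip q) * s))%:E *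
    line_conv (sigma + 2^-1 - c) (log_profile c f) s)%E) ->
  (Lpnorm q (fun x => (x `^ (- b))%:E * potential alpha sigma f x) <= C%:E)%E.
Proof.
move=> q1 C0 mf bC; have L0 := @log_profile_ge0 R c f.
have mL := measurable_log_profile c mf.
have q0 : (0 < q)%E by exact: lt_le_trans q1.
apply: (@le_trans _ _ (Lpnorm q (fun x => W b c (log_profile c f) (ln x)))).
  apply: le_Lpnorm => // x x0; rewrite (gee0_abs (W_ge0 _ _ _ L0)).
  exact: weighted_potential_le.
case: q q1 q0 bC => [r| |]// q1 q0 bC.
  rewrite lte_fin in q0; rewrite (le_poweR_fin q0)//; last exact: Lnorm_ge0.
  rewrite Lpnorm_expR//; first last.
  - by move=> x _; exact: W_ge0.
  - by apply: measurable_funTS; exact: (measurableT_comp (measurable_W b c mL L0)).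
  apply: le_trans bC; rewrite le_eqVlt; apply/orP; left; apply/eqP.
  by apply: eq_integral => s _; rewrite expRK -W_recip recip_fin.
rewrite /Lpnorm unlock; case: ifPn => // _.
apply/ess_supP; apply: nearW => x /=; rewrite patchE; case: ifPn => [|_]; last first.
  by rewrite abse0.
move=> _; rewrite (gee0_abs (W_ge0 _ _ _ L0)).
by apply: le_trans (bC (ln x)); rewrite -W_recip recip_oo mul0r expR0 mul1e.
Qed.

Lemma integral_of_Lpnorm_potential r b c C F : 1 <= r -> 0 <= C ->
  measurable_fun setT F -> (forall u, 0 <= F u) ->
  (Lpnorm r%:E (fun x => (x `^ (- b))%:E * potential alpha sigma (of_profile c F) x) <= C%:E)%E ->
  (\int[mu]_s (((expR ((2 * sigma - c - b + r^-1) * s))%:E *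
      line_conv (sigma + 2^-1 - c) F s) `^ r) <= (C `^ r)%:E)%E.
Proof.
move=> r1 C0 mF F0; have r0 : 0 < r by lra.
have E x : 0 < x -> ((x `^ (- b))%:E * potential alpha sigma (of_profile c F) x =
    W b c F (ln x))%E.
  by move=> x0; rewrite -{1 2}(lnK (x := x))// weighted_potentialE.
rewrite (le_poweR_fin r0)//; last exact: Lnorm_ge0.
rewrite Lpnorm_expR//; first last.
- by move=> x x0; rewrite E// W_ge0.
- apply: (@eq_measurable_fun _ _ _ _ _ (fun x => W b c F (ln x))).
    by move=> x; rewrite inE /Rplus/= in_itv/= andbT => x0; rewrite E.
  by apply: measurable_funTS; exact: (measurableT_comp (measurable_W b c mF F0)).
apply: le_trans; rewrite le_eqVlt; apply/orP; left; apply/eqP.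
apply: eq_integral => s _; congr (_ `^ _)%E; rewrite -recip_fin -W_recip.
by congr (_ * _)%E; rewrite weighted_potentialE.
Qed.

(** The form in which most test profiles are used, common to finite and infinite
q: a lower bound m on an interval of length w forces a norm m w^(1/q). *)
Lemma interval_of_Lpnorm_potential q b c C F l w m : (1 <= q)%E -> 0 <= C ->
  measurable_fun setT F -> (forall u, 0 <= F u) ->
  (Lpnorm q (fun x => (x `^ (- b))%:E * potential alpha sigma (of_profile c F) x) <= C%:E)%E ->
  0 < w -> 0 <= m ->
  (forall s, l <= s <= l + w ->
    (m%:E <= (expR ((2 * sigma - c - b + recip q) * s))%:E *
      line_conv (sigma + 2^-1 - c) F s)%E) ->
  m * w `^ recip q <= C.
Proof.
move=> q1 C0 mF F0 NC w0 m0 lm; case: q q1 NC lm => [r| |]// q1 NC lm.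
  rewrite lee_fin in q1; have r0 : 0 < r by lra.
  rewrite recip_fin -lee_fin (le_poweR_fin r0)// ?lee_fin; last by nonneg.
  rewrite powRM ?powR_ge0// -powRrM mulVf ?gt_eqF// powRr1 ?(ltW w0)//.
  rewrite -lee_fin; apply: le_trans (integral_of_Lpnorm_potential q1 C0 mF F0 NC).
  apply: (@integral_ge_itv _ _ l w) => //; [exact: ltW|exact: powR_ge0| | |].
  - apply: (measurableT_comp (measurable_poweR r)).
    apply: emeasurable_funM; last exact: measurable_line_conv.
    by apply/measurable_EFinP; solve_measurable.
  - by move=> s; exact: poweR_ge0.
  move=> s ls; rewrite -poweR_EFin; apply: gt0_ler_poweR; rewrite ?(ltW r0)//.
  - by rewrite in_itv/= leey andbT lee_fin.
  - by rewrite in_itv/= leey andbT mule_ge0 ?lee_fin ?expR_ge0// line_conv_ge0.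
  by have := lm s ls; rewrite recip_fin.
rewrite recip_oo powRr0 mulr1.
apply: (@le_of_Lpnorm_oo (expR l) (expR (l + w)) m C _ _ _ NC).
- by rewrite expR_gt0 ltr_expR ltrDl.
move=> x /andP[lx xw]; have x0 : 0 < x by rewrite (lt_le_trans _ lx) ?expR_gt0.
have xE : expR (ln x) = x by rewrite lnK.
have ls : l <= ln x <= l + w by rewrite -(ler_expR l) -(ler_expR (ln x)) xE lx.
have := weighted_potentialE b c (ln x) mF F0; rewrite xE => ->.
rewrite (gee0_abs (W_ge0 _ _ _ F0)).
by have := lm _ ls; rewrite -W_recip recip_oo mul0r expR0 mul1e.
Qed.

End PotentialNorm.

(** * Test profiles *)

Section TestProfiles.
Context {R : realType}.
Local Notation mu := (@lebesgue_measure R).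
Implicit Types (f F : R -> R) (G : R -> \bar R) (c d k r s t u v w x y l m : R).

Lemma expR_bounded_le0 d m : (forall t, 0 <= t -> expR (d * t) <= m) -> d <= 0.
Proof.
move=> h; rewrite leNgt; apply/negP => d0.
have m1 : 1 <= m by have := h 0 (lexx _); rewrite mulr0 expR0.
have := h (m / d); rewrite divr_ge0 ?(ltW d0)//; last by lra.
move=> /(_ isT); rewrite mulrCA divff ?gt_eqF// mulr1.
by have := expR_ge1Dx m; lra.
Qed.

Lemma integral_inv_itv x y : 0 < x -> x <= y ->
  (\int[mu]_u (\1_`[x, y] u * u^-1)%:E = (ln y - ln x)%:E)%E.
Proof.
move=> x0 xy; have y0 : 0 < y := lt_le_trans x0 xy.
pose g s : \bar R := (\1_`[ln x, ln y] s * expR (- s))%:E.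
transitivity (\int[mu]_(u in Rplus) g (ln u))%E.
  rewrite [RHS]integral_mkcond; apply: eq_integral => u _.
  rewrite patchE; case: ifPn => [|/negP]; rewrite inE /Rplus/= in_itv/= andbT.
    move=> u0; rewrite /g !indicE !mem_setE !in_itv/=; congr (_%:E).
    by rewrite !ler_ln ?posrE// expRN lnK.
  move=> u0; rewrite indicE mem_setE in_itv/=.
  rewrite (_ : (x <= u <= y) = false) ?mul0r//.
  by apply/negP => /andP[xu _]; apply: u0; exact: lt_le_trans xu.
have mg : measurable_fun setT g.
  apply/measurable_EFinP; rewrite /g; apply: measurable_funM.
    by apply: (measurable_indic_itv `[ln x, ln y]); exact: measurable_id.
  by solve_measurable.
rewrite integral_ln_Rplus//; last first.
  by move=> s; rewrite lee_fin mulr_ge0 ?expR_ge0.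
transitivity (\int[mu]_s (\1_(`[ln x, ln y]%classic : set R) s)%:E)%E.
  apply: eq_integral => s _; rewrite /g -EFinM -mulrA -expRD addNr expR0 mulr1//.
rewrite integral_indic//= setIT lebesgue_measure_itv/= lte_fin ltr_ln ?posrE//.
case: ifPn => [//|]; rewrite -leNgt => yx.
by rewrite (_ : y = x) ?subrr//; apply/eqP; rewrite eq_le yx xy.
Qed.

Lemma le_of_recip (p q : \bar R) : (1 <= p)%E -> (1 <= q)%E -> recip q <= recip p -> (p <= q)%E.
Proof.
case: p => [r| |]// p1; case: q => [t| |]// q1; rewrite ?recip_fin ?recip_oo ?leey//.
- by rewrite !lee_fin in p1 q1 *; rewrite lef_pV2 ?posrE//; lra.
- by rewrite leNgt invr_gt0; rewrite lee_fin in q1; rewrite (lt_le_trans ltr01 q1).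
Qed.

Lemma unit_profile_reflect p F : unit_profile p F -> unit_profile p (F \o -%R).
Proof.
move=> [mF F0 F1]; split; [exact: measurableT_comp|by move=> u; exact: F0|].
case: p F1 => [r| |] F1; [|by move=> u; exact: F1|by move=> u; exact: F1].
apply: le_trans F1; rewrite -[leRHS](@integral_affine _ (-1) 0); last 3 first.
- by right.
- by apply/measurable_EFinP; apply: (measurableT_comp (measurable_powR r)).
- by move=> s; rewrite lee_fin powR_ge0.
rewrite le_eqVlt; apply/orP; left; apply/eqP.
by apply: eq_integral => u _; rewrite /= addr0 mulN1r.
Qed.

Lemma unit_profile_indic p l w k : (1 <= p)%E -> 0 < w -> 0 <= k -> k * w `^ recip p <= 1 ->
  unit_profile p (fun u => k * \1_`[l, l + w] u).
Proof.
move=> p1 w0 k0 kw; split.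
- apply: measurable_funM; first exact: measurable_cst.
  by apply: (measurable_indic_itv `[l, l + w]); exact: measurable_id.
- by move=> u; rewrite mulr_ge0.
case: p p1 kw => [r| |]// p1; last first.
  rewrite recip_oo powRr0 mulr1 => k1 u.
  by apply: le_trans k1; rewrite ler_piMr// indicE lern1 leq_b1.
rewrite recip_fin => kw; have r0 : 0 < r by rewrite lee_fin in p1; lra.
apply: (@le_trans _ _ (\int[mu]_u ((k `^ r)%:E * (\1_(`[l, l + w]%classic : set R) u)%:E))%E).
  rewrite le_eqVlt; apply/orP; left; apply/eqP; apply: eq_integral => u _.
  rewrite -EFinM; congr (_%:E); rewrite indicE; case: (_ \in _).
    by rewrite !mulr1.
  by rewrite !mulr0 powR0// gt_eqF.
rewrite ge0_integralZl_EFin ?powR_ge0//; last first.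
  by apply/measurable_EFinP; solve_measurable.
rewrite integral_indic//= setIT lebesgue_measure_itv/= lte_fin ltrDl w0 -EFinB.
rewrite addrAC subrr add0r -EFinM lee_fin.
have := @ge0_ler_powR R r (ltW r0) (k * w `^ r^-1) 1.
rewrite !nnegrE mulr_ge0 ?powR_ge0// ler01 => /(_ isT isT kw).
by rewrite powRM ?powR_ge0// -powRrM mulVf ?gt_eqF// powRr1 ?(ltW w0)// powR1.
Qed.

End TestProfiles.

(** * Lower bounds and decay at infinity *)

Section TailBounds.
Context {R : realType}.
Local Notation mu := (@lebesgue_measure R).
Implicit Types (f F : R -> R) (G : R -> \bar R) (c d eta k r s t u v w x y l m : R).
Variables alpha sigma : R.
Hypotheses (halpha : -1 < alpha) (hsigma0 : 0 < sigma) (hsigma : sigma < alpha + 1).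
Let beta := alpha + 1 - sigma.
Let H := line_kernel alpha sigma.
Ltac hlra := move: halpha hsigma0 hsigma => /= ? ? ?; lra.
Local Notation line_conv := (line_conv alpha sigma).

Let tilt_ge1 eta v : `|v| <= 1 -> expR (- `|eta|) <= expR (- eta * v).
Proof.
move=> v1; rewrite ler_expR mulNr lerN2 (le_trans (ler_norm _))// normrM.
by rewrite ler_piMr.
Qed.

Lemma tilted_kernel_lb eta : exists2 c, 0 < c &
  forall v, `|v| <= 1 -> (c%:E <= (expR (- eta * v))%:E * H v)%E.
Proof.
have [c c0 cH] := line_kernel_lb halpha hsigma0 hsigma.
exists (expR (- `|eta|) * (c * expR (- beta))); first by rewrite !mulr_gt0 ?expR_gt0.
move=> v v1; rewrite EFinM; apply: lee_pmul; rewrite ?lee_fin ?expR_ge0//.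
- by rewrite mulr_ge0 ?expR_ge0 ?ltW.
- exact: tilt_ge1.
apply: le_trans (cH v); rewrite lee_fin ler_wpM2l ?(ltW c0)// ler_expR.
have b0 : 0 < beta by rewrite /beta; hlra.
by rewrite -/beta mulNr lerN2 ler_piMr// ltW.
Qed.

(** The bound is uniform on [- d, d] since the exponent 2 sigma - 1 is negative. *)
Lemma tilted_kernel_lb_singular eta : sigma < 2^-1 -> exists2 c, 0 < c &
  forall d v, 0 < d -> d <= 1 -> `|v| <= d ->
    ((c * d `^ (2 * sigma - 1))%:E <= (expR (- eta * v))%:E * H v)%E.
Proof.
move=> s1; have [c c0 cH] := line_kernel_lb_singular halpha hsigma0 hsigma s1.
exists (expR (- `|eta|) * c); first by rewrite mulr_gt0 ?expR_gt0.
move=> d v d0 d1 vd; rewrite -mulrA EFinM; apply: lee_pmul; rewrite ?lee_fin ?expR_ge0//.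
- by rewrite mulr_ge0 ?powR_ge0 ?ltW.
- by apply: tilt_ge1; exact: le_trans d1.
have [v0|v0] := eqVneq v 0.
  apply: (@le_trans _ _ (H d)); last by rewrite v0; exact: line_kernel_le_center.
  by have := cH d; rewrite gt_eqF// gtr0_norm//; apply.
apply: le_trans (cH v v0 (le_trans vd d1)); rewrite lee_fin ler_wpM2l ?(ltW c0)//.
have x0 : 0 < `|v| by rewrite normr_gt0.
rewrite -opprB !powRN lef_pV2 ?posrE ?powR_gt0//.
by apply: ge0_ler_powR; rewrite ?nnegrE ?(ltW d0)//; lra.
Qed.

Lemma line_conv_indic_ge eta s l w k m : 0 <= w -> 0 <= k -> 0 <= m ->
  (forall u, l <= u <= l + w -> (m%:E <= (expR (- eta * (s - u)))%:E * H (s - u))%E) ->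
  ((m * k * w)%:E <= line_conv eta (fun u => k * \1_`[l, l + w] u)%R s)%E.
Proof.
move=> w0 k0 m0 mk; apply: (@line_conv_ge_itv _ _ _ halpha hsigma0 hsigma _ _ _ l) => //.
- by rewrite mulr_ge0.
- by solve_measurable.
- by move=> u; rewrite mulr_ge0.
move=> u lu; rewrite EFinM; apply: lee_pmul; rewrite ?lee_fin//; first exact: mk.
by rewrite indicE mem_setE in_itv/= lu mulr1.
Qed.

Let line_conv_infinite eta F s l m : measurable_fun setT F -> (forall u, 0 <= F u) -> 0 < m ->
  (forall u, l <= u -> (m%:E <= (expR (- eta * (s - u)))%:E * H (s - u) * (F u)%:E)%E) ->
  ~ (line_conv eta F s < +oo)%E.
Proof.
move=> mF F0 m0 lu; have := line_conv_ge0 halpha hsigma0 hsigma eta s F0.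
case E : (line_conv eta F s) => [z| |]//; rewrite lee_fin => z0 _.
have := @line_conv_ge_itv _ _ _ halpha hsigma0 hsigma eta F s l ((z + 1) / m) m.
rewrite E lee_fin mulrCA divff ?gt_eqF// mulr1 => /(_ _ (ltW m0) mF F0).
rewrite divr_ge0 ?(ltW m0)//; last by lra.
move=> /(_ isT); have h : z + 1 <= z -> False by lra.
by move=> /(_ _)/h; apply => u /andP[? _]; exact: lu.
Qed.

(** If eta > beta, the integrable profile e^(- (eta - beta) u) on u >= 0 keeps the
integrand of line_conv bounded below.  If p > 1 and eta >= beta, the integrand is
at least a multiple of F for large u, and the profile 1 / u on u >= 1 is in L^p
with a divergent integral. *)
Lemma tilt_bound p eta : (1 <= p)%E ->
  (forall F, unit_profile p F -> exists s, (line_conv eta F s < +oo)%E) ->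
  eta < beta ?<= if (p == 1%E).
Proof.
move=> p1 fin; have [c c0 cH] := line_kernel_lb halpha hsigma0 hsigma.
rewrite /Order.lteif; case: eqVneq => [pe|pn1]; [rewrite leNgt|rewrite ltNge]; apply/negP => be.
  pose e := eta - beta; have e0 : 0 < e by rewrite subr_gt0.
  pose F u : R := e * (\1_`[0, +oo[ u * expR (- e * u)).
  have mF : measurable_fun setT F by rewrite /F; solve_measurable.
  have F0 u : 0 <= F u by rewrite /F; have := ltW e0 => ?; nonneg.
  have [|s] := fin F.
    split => //; rewrite pe; under eq_integral do rewrite powRr1//.
    rewrite /F integralZ_real; [|by solve_measurable|by move=> u; nonneg|exact: ltW].
    by rewrite integral_expR_rtail// mulr0 expR0 mulr1 -EFinM divff// gt_eqF.
  apply: (@line_conv_infinite _ _ _ (Num.max 0 s) (c * e * expR (- e * s))) => //.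
    by rewrite !mulr_gt0 ?expR_gt0.
  move=> u; rewrite ge_max => /andP[u0 su].
  apply: (@le_trans _ _ ((expR (- eta * (s - u)))%:E * (c * expR (- beta * `|s - u|))%:E *
      (F u)%:E)%E); last first.
    by rewrite lee_wpmul2r ?lee_fin// lee_wpmul2l ?lee_fin ?expR_ge0.
  rewrite -!EFinM lee_fin /F indicE mem_setE in_itv/= u0 mul1r distrC ger0_norm ?subr_ge0//.
  rewrite [leRHS](_ : _ = c * e * (expR (- eta * (s - u)) * expR (- beta * (u - s)) * expR (- e * u))); last by ring.
  rewrite -!expRD le_eqVlt; apply/orP; left; apply/eqP; congr (_ * expR _).
  by rewrite /e; ring.
have [k [k0 kF]] : exists k : R, 0 < k /\
    unit_profile p (fun u => k * (\1_`[1, +oo[ u * u^-1)).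
  have mI : measurable_fun setT (fun u : R => \1_`[1, +oo[ u * u^-1 : R).
    by apply: measurable_funM; [exact: measurable_indic_itv|exact: measurable_inv].
  have I0 u : 0 <= \1_`[1, +oo[ u * u^-1 :> R.
    rewrite indicE mem_setE in_itv/= andbT; have [u1|u1] := leP 1 u; last by rewrite mul0r.
    by rewrite mul1r invr_ge0; lra.
  case: p p1 pn1 fin => [r| |]// p1 pn1 _; last first.
    exists 1; split => //; split; first by apply: measurable_funM.
      by move=> u; rewrite mul1r.
    move=> u; rewrite mul1r indicE mem_setE in_itv/= andbT; have [u1|u1] := leP 1 u.
      by rewrite mul1r invf_le1; lra.
    by rewrite mul0r.
  have r1 : 1 < r by rewrite lt_neqAle eq_sym; rewrite eqe in pn1; rewrite pn1; rewrite lee_fin in p1.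
  have r0 : 0 < r by lra.
  have d0 : 0 < (r - 1) / 2 by lra.
  exists (((r - 1) / 2) `^ r^-1); split; first exact: powR_gt0.
  split; first by apply: measurable_funM.
    by move=> u; rewrite mulr_ge0 ?powR_ge0.
  apply: (@le_trans _ _ (\int[mu]_u (((r - 1) / 2) *
     (\1_`[1, +oo[ `|u|%R * `|u| `^ (- (r - 1) - 1)))%:E)%E).
    apply: le_integral_real.
    - by apply: (measurableT_comp (measurable_powR r)); apply: measurable_funM.
    - by solve_measurable.
    - by move=> u; exact: powR_ge0.
    move=> u; rewrite powRM ?powR_ge0// -powRrM mulVf ?gt_eqF// powRr1 ?(ltW d0)//.
    rewrite ler_wpM2l ?(ltW d0)// !indicE !mem_setE !in_itv/= !andbT.
    have [u1|u1] := leP 1 u; last by rewrite mul0r powR0 ?gt_eqF//; nonneg.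
    rewrite ger0_norm; last by lra.
    rewrite u1 !mul1r (_ : - (r - 1) - 1 = - r); last by ring.
    by rewrite powRN -powR_inv1 -?powRrM ?mulN1r ?powRN//; lra.
  rewrite integralZ_real; [|by solve_measurable|by move=> u; nonneg|exact: ltW].
  rewrite integral_powR_far//; last by lra.
  by rewrite powR1 mulr1 -EFinM lee_fin le_eqVlt; apply/orP; left; apply/eqP; field; lra.
have [s] := fin _ kF; case: kF => [mF F0 _].
set F := (fun u => _) in mF F0 *.
have {}F0 : forall u, 0 <= F u := F0.
have := line_conv_ge0 halpha hsigma0 hsigma eta s F0.
case E : (line_conv eta F s) => [z| |]//; rewrite lee_fin => z0 _.
pose A := Num.max 1 s; have A1 : 1 <= A by rewrite le_max lexx.
have sA : s <= A by rewrite le_max lexx orbT.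
have A0 : 0 < A by lra.
pose B := A * expR ((z + 1) / (c * k)).
have AB : A <= B.
  rewrite ler_peMr ?(ltW A0)// -[leLHS](expR0 R) ler_expR divr_ge0 ?mulr_ge0 ?(ltW c0) ?(ltW k0)//; lra.
suff : ((z + 1)%:E <= line_conv eta F s)%E by rewrite E lee_fin; lra.
apply: (@le_trans _ _ (\int[mu]_u ((c * k) * (\1_`[A, B] u * u^-1))%:E)%E).
  rewrite integralZ_real; first last.
  - by rewrite mulr_ge0 ?ltW.
  - move=> u; rewrite indicE mem_setE in_itv/=; case: (boolP (_ && _)) => [/andP[Au _]|_].
      by rewrite mul1r invr_ge0; lra.
    by rewrite mul0r.
  - by apply: measurable_funM; [exact: measurable_indic_itv|exact: measurable_inv].
  rewrite integral_inv_itv// /B lnM ?posrE ?expR_gt0// expRK -EFinM lee_fin.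
  rewrite (addrC (ln A)) addrK mulrCA divff ?mulr1// gt_eqF// mulr_gt0//.
apply: ge0_le_integral => //.
- move=> u _; rewrite lee_fin indicE mem_setE in_itv/=; case: (boolP (_ && _)) => [/andP[Au _]|_].
    by rewrite mul1r !mulr_ge0 ?(ltW c0) ?(ltW k0)// invr_ge0; lra.
  by rewrite mul0r mulr0.
- apply/measurable_EFinP; apply: measurable_funM => //.
  by apply: measurable_funM; [exact: measurable_indic_itv|exact: measurable_inv].
- exact: measurable_line_conv_integrand1.
move=> u _; rewrite indicE mem_setE in_itv/=; case: (boolP (_ && _)) => [/andP[Au _]|_]; last first.
  by rewrite mul0r mulr0; exact: line_conv_integrand_ge0.
have u1 : 1 <= u by lra.
have su : s <= u by lra.
apply: (@le_trans _ _ ((expR (- eta * (s - u)))%:E * (c * expR (- beta * `|s - u|))%:E *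
    (F u)%:E)%E); last first.
  by rewrite lee_wpmul2r ?lee_fin// lee_wpmul2l ?lee_fin ?expR_ge0.
rewrite -!EFinM lee_fin /F indicE mem_setE in_itv/= u1 !mul1r distrC ger0_norm ?subr_ge0//.
rewrite [leRHS](_ : _ = c * k * u^-1 * (expR (- eta * (s - u)) * expR (- beta * (u - s)))); last by ring.
rewrite -expRD ler_peMr//; first by rewrite !mulr_ge0 ?(ltW c0) ?(ltW k0)// invr_ge0; lra.
rewrite -[leLHS](expR0 R) ler_expR (_ : _ + _ = (eta - beta) * (u - s)); last by ring.
by rewrite mulr_ge0// subr_ge0.
Qed.

Lemma abs_tilt_bound p eta : (1 <= p)%E ->
  (forall F, unit_profile p F -> exists s, (line_conv eta F s < +oo)%E) ->
  (eta < beta ?<= if (p == 1%E)) /\ (- beta < eta ?<= if (p == 1%E)).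
Proof.
move=> p1 fin; split; first exact: tilt_bound.
have : - eta < beta ?<= if (p == 1%E).
  apply: (tilt_bound p1) => F uF.
  have [s sF] := fin _ (unit_profile_reflect uF).
  case: uF => mF F0 _; exists (- s).
  by rewrite (line_convN halpha hsigma0 hsigma (- eta) (- s) mF F0) !opprK.
by rewrite /Order.lteif; case: (p == 1%E); lra.
Qed.

End TailBounds.

(** * Necessary conditions for boundedness *)

Section BoundednessNecessity.
Context {R : realType}.
Local Notation mu := (@lebesgue_measure R).
Implicit Types (f F : R -> R) (G : R -> \bar R) (d k r s t u v w x y l m : R).
Variables (alpha sigma a b C : R) (p q : \bar R).
Hypotheses (halpha : -1 < alpha) (hsigma0 : 0 < sigma) (hsigma : sigma < alpha + 1).
Hypotheses (p1 : (1 <= p)%E) (q1 : (1 <= q)%E) (C0 : 0 <= C).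
Let beta := alpha + 1 - sigma.
Ltac hlra := move: halpha hsigma0 hsigma => /= ? ? ?; lra.
Local Notation line_conv := (line_conv alpha sigma).
Let eta := sigma + 2^-1 - (a + recip p).
Let theta := 2 * sigma - (a + recip p) - b + recip q.
Hypothesis bounded : forall F, unit_profile p F ->
  (Lpnorm q (fun x => (x `^ (- b))%:E *
     potential alpha sigma (of_profile (a + recip p) F) x) <= C%:E)%E.

Lemma recip_ge0 (p' : \bar R) : (1 <= p')%E -> 0 <= recip p'.
Proof.
case: p' => [r| |]// r1.
by rewrite recip_fin invr_ge0; rewrite lee_fin in r1; lra.
Qed.

Lemma recip_le1 (p' : \bar R) : (1 <= p')%E -> recip p' <= 1.
Proof.
case: p' => [r| |]// r1.
by rewrite recip_fin invf_le1; rewrite lee_fin in r1; lra.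
Qed.

(** Translating the profile by N multiplies the weight e^(theta s) by e^(theta N),
for N of either sign. *)
Lemma scaling_balance : theta = 0.
Proof.
have [c c0 cH] := tilted_kernel_lb halpha hsigma0 hsigma eta.
pose e := expR (- `|theta|) * c; have e0 : 0 < e by rewrite mulr_gt0 ?expR_gt0.
have key N : expR (theta * N) <= C / e.
  rewrite ler_pdivlMr//.
  have u1 := @unit_profile_indic _ p N 1 1 p1 ltr01 ler01.
  rewrite powR1 mulr1 in u1; have {}u1 := u1 (lexx _).
  have := @interval_of_Lpnorm_potential _ alpha sigma halpha hsigma0 hsigma
    q b (a + recip p) C _ N 1 (expR (theta * N) * e) q1 C0.
  rewrite powR1 mulr1; move=> /(_ _ _ _ (bounded u1) ltr01).
  have [mF F0 _] := u1; move=> /(_ mF F0); apply; first by rewrite mulr_ge0 ?expR_ge0 ?ltW.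
  move=> s /andP[Ns sN]; rewrite mulrA EFinM; apply: lee_pmul.
  - by rewrite lee_fin mulr_ge0 ?expR_ge0.
  - by rewrite lee_fin ltW.
  - rewrite lee_fin -expRD ler_expR -/theta.
    have sN1 : `|s - N| <= 1 by rewrite ger0_norm; lra.
    have : - `|theta| <= theta * (s - N).
      rewrite lerNl (le_trans (ler_norm _))// normrN normrM ler_piMr//.
    by lra.
  have := @line_conv_indic_ge _ _ _ halpha hsigma0 hsigma eta s N 1 1 c ler01 ler01 (ltW c0).
  rewrite !mulr1; apply => u /andP[Nu uN]; apply: cH.
  by rewrite ler_norml; apply/andP; split; lra.
apply/eqP; rewrite eq_le; apply/andP; split.
  by apply: (@expR_bounded_le0 _ _ (C / e)) => t _; exact: key.
rewrite -oppr_le0; apply: (@expR_bounded_le0 _ _ (C / e)) => t _.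
by rewrite mulNr -mulrN; exact: key.
Qed.

Lemma interval_bound F l w m : unit_profile p F -> 0 < w -> 0 <= m ->
  (forall s, l <= s <= l + w -> (m%:E <= line_conv eta F s)%E) -> m * w `^ recip q <= C.
Proof.
move=> uF w0 m0 lm; have [mF F0 _] := uF.
apply: (@interval_of_Lpnorm_potential _ _ _ halpha hsigma0 hsigma _ _ _ _ _ l _ _
  q1 C0 mF F0 (bounded uF) w0 m0).
by move=> s ls; rewrite -/theta scaling_balance mul0r expR0 mul1e; exact: lm.
Qed.

Lemma weights_sumE : a + b = 2 * sigma - recip p + recip q.
Proof. by have := scaling_balance; rewrite /theta; lra. Qed.

(** A unit profile spread over [0, N] has a convolution of order N^(- 1/p) on all
of [0, N], so that N^(1/q - 1/p) stays bounded. *)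
Lemma exponents_monotone : recip q <= recip p.
Proof.
have [c c0 cH] := tilted_kernel_lb halpha hsigma0 hsigma eta.
rewrite -subr_le0; apply: (@expR_bounded_le0 _ _ (C / c)) => t t0.
rewrite ler_pdivlMr//; pose N := expR t; have N0 : 0 < N := expR_gt0 _.
have N1 : 1 <= N by rewrite -[leLHS](expR0 R) ler_expR.
have k0 : 0 <= N `^ (- recip p) := powR_ge0 _ _.
have uF := @unit_profile_indic _ p 0 N (N `^ (- recip p)) p1 N0 k0.
have {}uF : unit_profile p (fun u => N `^ (- recip p) * \1_`[0, 0 + N] u).
  by apply: uF; rewrite powRN mulVf// gt_eqF// powR_gt0.
have := @interval_bound _ 0 N (c * N `^ (- recip p)) uF N0.
rewrite mulr_ge0 ?(ltW c0)// => /(_ isT).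
have -> : c * N `^ (- recip p) * N `^ recip q = expR ((recip q - recip p) * t) * c.
  by rewrite /N !powR_expR -mulrA -expRD mulrC; congr (expR _ * _); ring.
apply => s /andP[s0 sN].
have [mF F0 _] := uF.
rewrite -[_ * _]mulr1; apply: (@line_conv_ge_itv _ _ _ halpha hsigma0 hsigma _ _ _ (Num.min s (N - 1))) => //.
  by rewrite mulr_ge0 // ltW.
move=> u; case: (leP s (N - 1)) => sN1 /andP[su us].
  have uI : 0 <= u <= 0 + N by apply/andP; split; lra.
  rewrite indicE mem_setE in_itv/= uI mulr1 EFinM lee_wpmul2r ?lee_fin//; apply: cH.
  by rewrite ler_norml; apply/andP; split; lra.
have uI : 0 <= u <= 0 + N by apply/andP; split; lra.
rewrite indicE mem_setE in_itv/= uI mulr1 EFinM lee_wpmul2r ?lee_fin//; apply: cH.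
by rewrite ler_norml; apply/andP; split; lra.
Qed.

Lemma indic_unit d : 0 < d ->
  unit_profile p (fun u => d `^ (- recip p) * \1_`[0, 0 + d] u).
Proof.
move=> d0; apply: unit_profile_indic => //; first exact: powR_ge0.
by rewrite powRN mulVf// gt_eqF// powR_gt0.
Qed.

(** If a + b < 0 then sigma < 1/2, and a unit profile on [0, d] has a convolution
of order at least d^(2 sigma - 1/p) there; its norm is then at least of order
d^(a + b), which is unbounded as d tends to 0. *)
Lemma weights_sum_ge0 : 0 <= a + b.
Proof.
rewrite leNgt; apply/negP => ab0.
have s1 : sigma < 2^-1.
  by have := recip_le1 p1; have := recip_ge0 q1; have := weights_sumE; lra.
have [c c0 cH] := tilted_kernel_lb_singular halpha hsigma0 hsigma eta s1.
suff : - (a + b) <= 0 by lra.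
apply: (@expR_bounded_le0 _ _ (C / c)) => t t0.
rewrite ler_pdivlMr//; pose d := expR (- t); have d0 : 0 < d := expR_gt0 _.
have d1 : d <= 1 by rewrite -[leRHS](expR0 R) ler_expR oppr_le0.
have k0 : 0 <= d `^ (- recip p) := powR_ge0 _ _.
have m0 : 0 <= c * d `^ (2 * sigma - 1) by rewrite mulr_ge0 ?powR_ge0 ?ltW.
have := @interval_bound _ 0 d (c * d `^ (2 * sigma - 1) * d `^ (- recip p) * d) (indic_unit d0) d0.
rewrite !mulr_ge0 ?(ltW d0) ?powR_ge0 ?(ltW c0)// => /(_ isT).
have -> : c * d `^ (2 * sigma - 1) * d `^ (- recip p) * d * d `^ recip q =
    expR (- (a + b) * t) * c.
  rewrite /d !powR_expR -!mulrA -!expRD mulrC; congr (expR _ * _).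
  by rewrite weights_sumE; ring.
apply => s /andP[s0 sd].
apply: (@line_conv_indic_ge _ _ _ halpha hsigma0 hsigma) => //; first exact: ltW.
move=> u /andP[u0 ud]; apply: cH => //.
by rewrite ler_norml; apply/andP; split; lra.
Qed.

(** Here a + b = 0 means sigma = 1/2: convolving an approximate identity with the
unbounded kernel gives unbounded functions. *)
Lemma weights_sum_neq0_L1_Loo : p = 1%E -> q = +oo%E -> a + b != 0.
Proof.
move=> pE qE; apply/eqP => ab0.
have sE : sigma = 2^-1.
  by have := weights_sumE; rewrite ab0 pE qE recip_fin recip_oo invr1; lra.
pose M := expR `|eta| * (C + 1).
have M0 : 0 <= M by rewrite mulr_ge0 ?expR_ge0// addr_ge0.
have [e e0 eH] := line_kernel_blowup halpha hsigma0 hsigma sE M.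
pose d := Num.min e 1.
have d0 : 0 < d by rewrite lt_min e0 ltr01.
have d1 : d <= 1 by rewrite ge_min lexx orbT.
have de : d <= e by rewrite ge_min lexx.
have := @interval_bound _ 0 d (C + 1) (indic_unit d0) d0.
rewrite qE recip_oo powRr0 mulr1 addr_ge0// => /(_ isT) h.
have : C + 1 <= C; last by lra.
apply: h => s /andP[s0 sd].
have -> : C + 1 = (C + 1) * d `^ (- recip p) * d.
  by rewrite pE recip_fin invr1 powRN powRr1 ?(ltW d0)// mulfVK// gt_eqF.
apply: (@line_conv_indic_ge _ _ _ halpha hsigma0 hsigma) => //.
- exact: ltW.
- exact: powR_ge0.
- by rewrite addr_ge0.
move=> u /andP[u0 ud].
have vd : `|s - u| <= d by rewrite ler_norml; apply/andP; split; lra.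
apply: (@le_trans _ _ ((expR (- `|eta|))%:E * M%:E)%E).
  by rewrite -EFinM lee_fin /M mulrA -expRD addNr expR0 mul1r.
apply: lee_pmul; rewrite ?lee_fin ?expR_ge0//; last by apply: eH; exact: le_trans de.
rewrite ler_expR mulNr lerN2 (le_trans (ler_norm _))// normrM.
by rewrite ler_piMr// (le_trans vd).
Qed.

(** Here a + b = 0 means 2 sigma - 1 = - 1/q: approximate identities would put
|v|^(- 1/q) into L^q near 0, where the integral of 1 / |v| diverges. *)
Lemma weights_sum_neq0_L1 : p = 1%E -> q != +oo%E -> a + b != 0.
Proof.
move=> pE qn; apply/eqP => ab0.
have [r qE] : exists r, q = r%:E by case: (q) q1 qn => [r| |]// _ _; exists r.
have r1 : 1 <= r by rewrite -lee_fin -qE.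
have r0 : 0 < r by lra.
have rE : r^-1 = 1 - 2 * sigma.
  by have := weights_sumE; rewrite ab0 pE qE !recip_fin invr1; lra.
have ri0 : 0 < r^-1 by rewrite invr_gt0.
have s1 : sigma < 2^-1 by lra.
have [c c0 cH] := tilted_kernel_lb_singular halpha hsigma0 hsigma eta s1.
have cr0 : 0 < c `^ r by rewrite powR_gt0.
pose t := C `^ r / c `^ r + 1.
have t0 : 0 <= t by rewrite addr_ge0// divr_ge0 ?powR_ge0.
pose d := expR (- t); have d0 : 0 < d := expR_gt0 _.
have d1 : d <= 1 by rewrite -[leRHS](expR0 R) ler_expR oppr_le0.
have uF := indic_unit d0; have [mF F0 _] := uF.
have bd := bounded uF; rewrite qE in bd.
have := integral_of_Lpnorm_potential halpha hsigma0 hsigma r1 C0 mF F0 bd.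
apply/negP; rewrite -ltNge.
apply: (@lt_le_trans _ _ (\int[mu]_s (c `^ r * (\1_`[d, 1] s * s^-1))%:E)%E).
  rewrite integralZ_real ?(ltW cr0)//; first last.
  - move=> s; rewrite indicE mem_setE in_itv/=; case: (boolP (_ && _)) => [/andP[ds _]|_].
      by rewrite mul1r invr_ge0; lra.
    by rewrite mul0r.
  - by apply: measurable_funM; [exact: measurable_indic_itv|exact: measurable_inv].
  rewrite integral_inv_itv// ln1 sub0r /d expRK opprK -EFinM lte_fin /t mulrDr mulr1.
  by rewrite mulrCA divff ?gt_eqF// mulr1 ltrDl.
apply: ge0_le_integral => //.
- move=> s _; rewrite lee_fin indicE mem_setE in_itv/=; case: (boolP (_ && _)) => [/andP[ds _]|_].
    by rewrite mul1r mulr_ge0 ?(ltW cr0)// invr_ge0; lra.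
  by rewrite mul0r mulr0.
- apply/measurable_EFinP; apply: measurable_funM => //.
  by apply: measurable_funM; [exact: measurable_indic_itv|exact: measurable_inv].
- apply: (measurableT_comp (measurable_poweR r)).
  apply: emeasurable_funM; last exact: measurable_line_conv.
  by apply/measurable_EFinP; solve_measurable.
move=> s _; rewrite indicE mem_setE in_itv/=; case: (boolP (_ && _)) => [/andP[ds s1']|_]; last first.
  by rewrite mul0r mulr0; exact: poweR_ge0.
have th0 : 2 * sigma - (a + recip p) - b + r^-1 = 0.
  by have := scaling_balance; rewrite /theta qE recip_fin.
rewrite th0 mul0r expR0 mul1e mul1r -/eta.
have s0 : 0 < s by lra.
have -> : c `^ r * s^-1 = (c * s `^ (2 * sigma - 1)) `^ r.
  rewrite powRM ?powR_ge0 ?(ltW c0)//; congr (_ * _).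
  rewrite -powRrM (_ : (2 * sigma - 1) * r = -1); last first.
    by rewrite -[2 * sigma - 1]opprB -rE mulNr mulVf ?gt_eqF.
  by rewrite powRN powRr1// ltW.
rewrite -poweR_EFin; apply: gt0_ler_poweR; rewrite ?(ltW r0)//.
- by rewrite in_itv/= leey andbT lee_fin mulr_ge0 ?powR_ge0 ?ltW.
- by rewrite in_itv/= leey andbT line_conv_ge0.
have -> : c * s `^ (2 * sigma - 1) = c * s `^ (2 * sigma - 1) * d `^ (- recip p) * d.
  by rewrite pE recip_fin invr1 powRN powRr1 ?(ltW d0)// mulfVK// gt_eqF.
apply: (@line_conv_indic_ge _ _ _ halpha hsigma0 hsigma) => //.
- exact: ltW.
- exact: powR_ge0.
- by rewrite mulr_ge0 ?powR_ge0 ?ltW.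
move=> u /andP[u0 ud]; apply: cH => //.
by rewrite ler_norml; apply/andP; split; lra.
Qed.

(** Here a + b = 0 means 2 sigma = 1/p.  The profile u^(- 1/p) on [d, 1] has norm
t^(1/p) with t = ln (1 / d), while its convolution on [0, d] is at least of
order t. *)
Lemma weights_sum_neq0_Loo : p != 1%E -> q = +oo%E -> a + b != 0.
Proof.
move=> pn qE; apply/eqP => ab0.
have [pE|[r pE]] : p = +oo%E \/ exists r, p = r%:E.
- by case: (p) p1 => [r| |]// _; [right; exists r|left].
- by have := weights_sumE; rewrite ab0 qE pE recip_oo; hlra.
have r1 : 1 < r.
  by rewrite -lte_fin -pE lt_neqAle eq_sym pn.
have r0 : 0 < r by lra.
have ri0 : 0 < r^-1 by rewrite invr_gt0.
have ri1 : r^-1 < 1 by rewrite invf_lt1.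
have sE : 2 * sigma = r^-1 by have := weights_sumE; rewrite ab0 qE pE recip_fin recip_oo; lra.
have s1 : sigma < 2^-1 by lra.
have [c c0 cH] := tilted_kernel_lb_singular halpha hsigma0 hsigma eta s1.
suff : 1 - r^-1 <= 0 by lra.
apply: (@expR_bounded_le0 _ _ (C / c)) => z z0; rewrite ler_pdivlMr//.
pose t := expR z; have t0 : 0 < t := expR_gt0 _.
pose d := expR (- t); have d0 : 0 < d := expR_gt0 _.
have d1 : d <= 1 by rewrite -[leRHS](expR0 R) ler_expR oppr_le0 ltW.
pose F u : R := t `^ (- r^-1) * (\1_`[d, 1] u * u `^ (- r^-1)).
have mF : measurable_fun setT F by rewrite /F; solve_measurable.
have F0 u : 0 <= F u by rewrite /F; nonneg.
have tr : (t `^ (- r^-1)) `^ r = t^-1.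
  by rewrite -powRrM mulNr mulVf ?gt_eqF// powRN powRr1// ltW.
have inv0 u : 0 <= \1_`[d, 1] u * u^-1 :> R.
  rewrite indicE mem_setE in_itv/=; case: (boolP (_ && _)) => [/andP[du _]|_].
    by rewrite mul1r invr_ge0; lra.
  by rewrite mul0r.
have minv : measurable_fun setT (fun u : R => \1_`[d, 1] u * u^-1 : R).
  by apply: measurable_funM; [exact: measurable_indic_itv|exact: measurable_inv].
have Iinv : (\int[mu]_u (\1_`[d, 1] u * u^-1)%:E = t%:E)%E.
  by rewrite integral_inv_itv// ln1 sub0r /d expRK opprK.
have uF : unit_profile p F.
  rewrite pE; split => //; apply: (@le_trans _ _ (\int[mu]_u (t^-1 * (\1_`[d, 1] u * u^-1))%:E)%E).
    rewrite le_eqVlt; apply/orP; left; apply/eqP; apply: eq_integral => u _.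
    rewrite /F powRM ?powR_ge0//; last by nonneg.
    rewrite tr; congr ((_ * _)%:E).
    rewrite indicE mem_setE in_itv/=; case: (boolP (_ && _)) => [/andP[du _]|_].
      rewrite !mul1r -powRrM mulNr mulVf ?gt_eqF// powRN powRr1//; lra.
    by rewrite !mul0r powR0// gt_eqF.
  rewrite integralZ_real//; last by rewrite invr_ge0 ltW.
  by rewrite Iinv -EFinM mulVf// gt_eqF.
have := @interval_bound F 0 d (c * t `^ (- r^-1) * t) uF d0.
rewrite !mulr_ge0 ?(ltW t0) ?powR_ge0 ?(ltW c0)// => /(_ isT).
rewrite qE recip_oo powRr0 mulr1.
have -> : c * t `^ (- r^-1) * t = expR ((1 - r^-1) * z) * c.
  rewrite /t powR_expR -mulrA -expRD mulrC; congr (expR _ * _); by ring.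
apply => s /andP[s0 sd]; rewrite add0r in sd.
have -> : expR ((1 - r^-1) * z) * c = c * t `^ (- r^-1) * t.
  rewrite /t powR_expR -mulrA -expRD mulrC; congr (_ * expR _); by ring.
have ct0 : 0 <= c * t `^ (- r^-1) by rewrite mulr_ge0 ?powR_ge0 ?ltW.
rewrite EFinM -Iinv -integralZ_real//.
apply: ge0_le_integral => //.
- by move=> u _; rewrite lee_fin mulr_ge0.
- by apply/measurable_EFinP; apply: measurable_funM.
- exact: measurable_line_conv_integrand1.
move=> u _; rewrite /F indicE mem_setE in_itv/=; case: (boolP (_ && _)) => [/andP[du u1]|_]; last first.
  by rewrite !mul0r !mulr0 mule0.
have u0 : 0 < u by lra.
have -> : c * t `^ (- r^-1) * (1 * u^-1) =
    c * u `^ (2 * sigma - 1) * (t `^ (- r^-1) * (1 * u `^ (- r^-1))).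
  rewrite !mul1r sE.
  have -> : u^-1 = u `^ (r^-1 - 1) * u `^ (- r^-1).
    rewrite -powRD; last by rewrite (gt_eqF u0) implybT.
    rewrite (_ : r^-1 - 1 + - r^-1 = - 1); last by ring.
    by rewrite powRN powRr1// ltW.
  by ring.
rewrite EFinM lee_wpmul2r ?lee_fin//; first by rewrite mul1r; nonneg.
apply: cH => //; rewrite ler_norml; apply/andP; split; lra.
Qed.

(** If |eta| = beta then k does not decay on one side, and the convolution of the
indicator of [0, 1] is bounded below on a half-line. *)
Lemma tilt_neq : q != +oo%E -> `|eta| != beta.
Proof.
move=> qn; apply/eqP => eb.
have [c c0 cH] := line_kernel_lb halpha hsigma0 hsigma.
have rq0 : 0 < recip q.
  case: q q1 qn => [r| |]// r1 _; rewrite recip_fin invr_gt0.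
  by rewrite lee_fin in r1; lra.
suff : recip q <= 0 by lra.
apply: (@expR_bounded_le0 _ _ (C / c)) => t t0; rewrite ler_pdivlMr//.
pose N := expR t; have N0 : 0 < N := expR_gt0 _.
have u1 := @unit_profile_indic _ p 0 1 1 p1 ltr01 ler01.
rewrite powR1 mulr1 in u1; have {}u1 := u1 (lexx _).
rewrite -powR_expR mulrC -/N.
have conv_ge s : (forall u, 0 <= u <= 0 + 1 -> eta * (s - u) = - `|eta| * `|s - u|) ->
    (c%:E <= line_conv eta (fun u => 1 * \1_`[0, 0 + 1] u)%R s)%E.
  move=> hs; have := @line_conv_indic_ge _ _ _ halpha hsigma0 hsigma eta s 0 1 1 c ler01 ler01 (ltW c0).
  rewrite !mulr1; apply => u uI.
  apply: (@le_trans _ _ ((expR (- eta * (s - u)))%:E * (c * expR (- beta * `|s - u|))%:E)%E).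
    rewrite -EFinM lee_fin mulNr hs// -eb mulNr opprK mulrCA -expRD subrr expR0 mulr1//.
  by rewrite lee_wpmul2l ?lee_fin ?expR_ge0.
have [e0|e0] := leP 0 eta.
  apply: (@interval_bound _ (- N) N c u1 N0 (ltW c0)) => s /andP[sN s0].
  apply: conv_ge => u /andP[u0 _]; rewrite addNr in s0.
  by rewrite ger0_norm// ler0_norm; [ring|lra].
apply: (@interval_bound _ 1 N c u1 N0 (ltW c0)) => s /andP[s1 sN].
apply: conv_ge => u /andP[_ u1']; rewrite add0r in u1'.
by rewrite ltr0_norm// ger0_norm; [ring|lra].
Qed.

End BoundednessNecessity.

(** * Sufficient conditions *)

Section Sufficiency.
Context {R : realType}.
Local Notation mu := (@lebesgue_measure R).
Implicit Types (f F : R -> R) (G : R -> \bar R) (a b d k r s t u v w x y l m C N : R) (p q : \bar R).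
Variables (alpha sigma : R).
Hypotheses (halpha : -1 < alpha) (hsigma0 : 0 < sigma) (hsigma : sigma < alpha + 1).
Let beta := alpha + 1 - sigma.
Local Notation line_conv := (line_conv alpha sigma).

(** The potential of f is compared with that of N x^(- a), whose profile is constant;
the exceptional null set stays on the half-line, inside the integral in y. *)
Lemma line_conv_profile_Loo a f N s : measurable_fun (@Rplus R) f -> 0 <= N ->
  (Lpnorm +oo (fun x => (x `^ a * f x)%:E) <= N%:E)%E ->
  (line_conv (sigma + 2^-1 - a) (log_profile a f) s <=
   N%:E * line_conv (sigma + 2^-1 - a) (fun=> 1)%R s)%E.
Proof.
move=> mf N0; rewrite /Lpnorm unlock; case: ifPn => [_ /ess_supP fN|]; last first.
  move=> /negP[]; apply: (@lt_le_trans _ _ (mu `[0, 1]%classic)).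
    by rewrite lebesgue_measure_itv/= lte_fin ltr01 sube0 lte01.
  by apply: le_measure; rewrite ?inE//; exact: measurable_itv.
pose g y : R := N * y `^ (- a).
have mg : measurable_fun (@Rplus R) g.
  apply: measurable_funTS; apply: measurable_funM => //; exact: measurable_powR.
have gE : log_profile a g = (fun=> N * 1).
  apply/funext => u; rewrite /log_profile /g powR_expR ger0_norm ?mulr_ge0 ?expR_ge0//.
  by rewrite mulrCA -expRD mulNr subrr expR0.
rewrite -line_conv_scale// -gE -(@lee_pmul2l _ (expR ((2 * sigma - a) * s))%:E)//; last first.
  by rewrite lte_fin expR_gt0.
rewrite -!abs_potentialE//; apply: ae_ge0_le_integral.
- exact: measurable_Rplus.
- by move=> y _; exact: abse_ge0.
- apply: (@measurableT_comp _ _ _ _ _ _ (@abse R)) => //.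
  by apply: measurable_potential_integrand => //; exact: expR_gt0.
- by move=> y _; exact: abse_ge0.
- apply: (@measurableT_comp _ _ _ _ _ _ (@abse R)) => //.
  by apply: measurable_potential_integrand => //; exact: expR_gt0.
apply: filterS fN => y /=; rewrite patchE => + yR; rewrite (mem_set yR).
move: yR; rewrite /Rplus/= in_itv/= andbT => y0.
rewrite lee_fin normrM (ger0_norm (powR_ge0 _ _)) => fN.
rewrite abseM [X in (_ <= X)%E]abseM; apply: lee_wpmul2l; first exact: abse_ge0.
rewrite !abse_EFin lee_fin /g [X in _ <= X]ger0_norm; last by rewrite mulr_ge0 ?powR_ge0.
by rewrite powRN ler_pdivlMr ?powR_gt0// mulrC.
Qed.

Lemma ae_imply (P Q : R -> Prop) : (\forall x \ae mu, P x) -> (forall x, P x -> Q x) ->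
  \forall x \ae mu, Q x.
Proof.
move=> [M [mM M0 sub]] PQ; exists M; split => // x nq.
by apply: sub => h; apply: nq; exact: PQ.
Qed.

(** For 1 < p < oo, F <= 1 + F^p bounds the convolution by a bounded one and one
with an integrable profile. *)
Lemma weightedLp_subset_Dom p a : (1 <= p)%E ->
  `|sigma + 2^-1 - (a + recip p)| < beta ?<= if (p == 1%E) ->
  weightedLp p a `<=` Dom alpha sigma.
Proof.
move=> p1 etab f [mf Nfin].
have etab' : `|sigma + 2^-1 - (a + recip p)| <= beta.
  by move: etab; rewrite /Order.lteif; case: ifPn => // _ /ltW.
pose F := log_profile (a + recip p) f.
have mF : measurable_fun setT F by exact: measurable_log_profile.
have F0 u : 0 <= F u by exact: log_profile_ge0.
suff : {ae mu, forall x, Rplus x ->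
    (line_conv (sigma + 2^-1 - (a + recip p)) F (ln x) < +oo)%E}.
  move=> fin; apply: (ae_imply fin) => x h xR; have := h xR; have x0 : 0 < x by move: xR; rewrite /Rplus/= in_itv/= andbT.
  by move=> /(integrable_potentialP halpha hsigma0 hsigma (a + recip p) mf x0).
case: p p1 Nfin @F mF F0 etab etab' => [r| |]// p1 Nfin F mF F0 etab etab'; last first.
  apply: nearW => x _; rewrite /F recip_oo addr0.
  move: Nfin; have := @Lnorm_ge0 _ _ _ mu +oo%E ((fun x => (x `^ a * f x)%:E) \_ (@Rplus R)).
  rewrite -/(Lpnorm _ _); case E : (Lpnorm _ _) => [N| |]//; rewrite lee_fin => N0 _.
  move: etab; rewrite /F recip_oo addr0 /Order.lteif /= => etab.
  have [C C0 HC] := line_conv_bounded_one halpha hsigma0 hsigma etab.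
  apply: (@le_lt_trans _ _ (N * C)%:E); last exact: ltry.
  apply: le_trans (line_conv_profile_Loo _ mf N0 _) _; first by rewrite E.
  by rewrite EFinM lee_wpmul2l.
rewrite lee_fin in p1; have r0 : 0 < r by lra.
have Ffin : (\int[mu]_u (F u `^ r)%:E < +oo)%E.
  by rewrite /F recip_fin -Lpnorm_profile// poweR_lty.
have mFr : measurable_fun setT (fun u => F u `^ r).
  exact: (measurableT_comp (measurable_powR r)).
have fin := line_conv_ae_finite halpha hsigma0 hsigma etab' mFr (fun u => powR_ge0 _ _) Ffin.
apply: (ae_imply fin) => x /[apply] h.
have [rE|rn1] := eqVneq r 1.
  by move: h; congr (line_conv _ _ _ < _)%E; apply/funext => u; rewrite rE powRr1.
move: etab; rewrite /Order.lteif eqe (negbTE rn1) => etab.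
have [C C0 HC] := line_conv_bounded_one halpha hsigma0 hsigma etab.
apply: (@le_lt_trans _ _ (line_conv (sigma + 2^-1 - (a + recip r%:E))
    (fun u => 1 + F u `^ r)%R (ln x))).
  apply: le_line_conv => //; first exact: measurable_funD.
  move=> u; have [Fu|Fu] := leP (F u) 1; first by rewrite (le_trans Fu)// lerDl powR_ge0.
  rewrite (@le_trans _ _ (F u `^ r))//; last by rewrite lerDr.
  by rewrite le1r_powR// ltW.
rewrite line_convD//; last by move=> u; exact: powR_ge0.
by rewrite lte_add_pinfty// (le_lt_trans (HC _))// ltry.
Qed.

Lemma line_conv_bounded r q eta : 1 <= r -> (r%:E <= q)%E ->
  0 < recip q - r^-1 + 2 * sigma ?<= if ~~ ((r == 1) || (q == +oo%E)) ->
  `|eta| < beta ?<= if ((r == 1) && (q == +oo%E)) ->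
  exists2 C, 0 < C & forall F, unit_profile r%:E F -> bounded_profile q C (line_conv eta F).
Proof.
move=> r1 rq; have r0 : 0 < r by lra.
case: q rq => [z| |]//; last first.
  move=> _; rewrite recip_oo eqxx orbT andbT /= add0r => e0 etab.
  have [C C0 HC] : exists2 C, 0 <= C & forall F, unit_profile r%:E F ->
      forall s, (line_conv eta F s <= C%:E)%E.
    have [rE|rn1] := eqVneq r 1.
      move: etab; rewrite rE eqxx /= => etab.
      have s1 : 2^-1 < sigma by move: e0; rewrite rE invr1; lra.
      have [C C0 HC] := line_conv_bounded_L1 halpha hsigma0 hsigma etab s1.
      exists C => // F [mF F0 F1]; apply: HC => //.
      by apply: le_trans F1; under eq_integral do rewrite -[F _]powRr1//.
    move: etab; rewrite (negbTE rn1) /= => etab.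
    have r1' : 1 < r by rewrite lt_neqAle eq_sym rn1.
    have rs : r^-1 < 2 * sigma by lra.
    have [C C0 HC] := line_conv_bounded_infinite halpha hsigma0 hsigma r1' etab rs.
    by exists C => // F [mF F0 F1]; exact: HC.
  exists (C + 1); first by lra.
  by move=> F /HC h s; apply: le_trans (h s) _; rewrite lee_fin lerDl.
rewrite lee_fin => rz; rewrite recip_fin orbF andbF => e0 /= etab.
have e0' : 0 <= z^-1 - r^-1 + 2 * sigma.
  by move: e0; rewrite /Order.lteif; case: ifPn => // _ /ltW.
have eN : z^-1 - r^-1 + 2 * sigma = 0 -> r != 1.
  by move=> E; apply/eqP => rE; move: e0; rewrite E rE eqxx /= ltxx.
have [C C0 HC] := line_conv_bounded_finite halpha hsigma0 hsigma r1 rz etab e0' eN.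
have z0 : 0 < z by lra.
exists ((C + 1) `^ z^-1); first by rewrite powR_gt0; lra.
move=> F [mF F0 F1]; rewrite /bounded_profile -powRrM mulVf ?gt_eqF// powRr1; last by lra.
by apply: (le_trans (HC F mF F0 F1)); rewrite lee_fin lerDl.
Qed.

(** By homogeneity: f is divided by numbers l larger than its norm, so that a
vanishing norm is not a special case. *)
Lemma Lpnorm_potential_bounded r q a b C f : 1 <= r -> (1 <= q)%E -> 0 < C ->
  2 * sigma - (a + r^-1) - b + recip q = 0 ->
  (forall F, unit_profile r%:E F -> bounded_profile q C (line_conv (sigma + 2^-1 - (a + r^-1)) F)) ->
  weightedLp r%:E a f ->
  (Lpnorm q (fun x => (x `^ (- b))%:E * potential alpha sigma f x) <=
   C%:E * Lpnorm r%:E (fun x => (x `^ a * f x)%:E))%E.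
Proof.
move=> r1 q1 C0 th0 HC [mf Nfin]; have r0 : 0 < r by lra.
set eta := sigma + 2^-1 - (a + r^-1) in HC.
have NE := Lpnorm_profile a r0 mf.
move: Nfin NE; have := @Lnorm_ge0 _ _ _ mu r%:E ((fun x => (x `^ a * f x)%:E) \_ (@Rplus R)).
rewrite -/(Lpnorm _ _); case: (Lpnorm _ _) => [N| |]//; rewrite lee_fin => N0 _ NE.
rewrite -EFinM mulrC; apply: lee_forall_gt => // l Nl.
have l0 : 0 < l by exact: le_lt_trans Nl.
pose F := log_profile (a + r^-1) f.
have mF : measurable_fun setT F by exact: measurable_log_profile.
have F0 u : 0 <= F u by exact: log_profile_ge0.
have li0 : 0 <= l^-1 by rewrite invr_ge0 ltW.
have uF : unit_profile r%:E (fun u => l^-1 * F u).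
  split; [exact: measurable_funM|by move=> u; exact: mulr_ge0|].
  apply: (@le_trans _ _ (\int[mu]_u ((l^-1) `^ r * F u `^ r)%:E)%E).
    by rewrite le_eqVlt; apply/orP; left; apply/eqP; apply: eq_integral => u _; rewrite powRM.
  rewrite integralZ_real; [|exact: (measurableT_comp (measurable_powR r))|
    by move=> u; exact: powR_ge0|exact: powR_ge0].
  rewrite -NE poweR_EFin -EFinM -powRM// lee_fin.
  have lN : l^-1 * N <= 1 by rewrite mulrC ler_pdivrMr// mul1r ltW.
  have := ge0_ler_powR (ltW r0) (mulr_ge0 li0 N0 : _ \is Num.nneg) (ler01 : 1 \is Num.nneg) lN.
  by rewrite powR1.
have FE s : line_conv eta F s = (l%:E * line_conv eta (fun u => l^-1 * F u)%R s)%E.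
  rewrite -line_conv_scale//; [|exact: ltW|exact: measurable_funM|by move=> u; exact: mulr_ge0].
  by congr (line_conv _ _ _); apply/funext => u; rewrite mulVKf// gt_eqF.
apply: (@Lpnorm_potential_le _ alpha sigma halpha hsigma0 hsigma q b (a + r^-1)) => //.
  by rewrite mulr_ge0 ?ltW.
have hC := HC _ uF.
have [qE|[z qE]] : q = +oo%E \/ exists z, q = z%:E.
- by case: (q) q1 => [z| |]// _; [right; exists z|left].
- rewrite qE /bounded_profile in th0 hC * => s; rewrite th0 mul0r expR0 mul1e FE EFinM lee_wpmul2l ?lee_fin ?(ltW l0)//.
rewrite qE /bounded_profile in q1 th0 hC *.
have z0 : 0 < z by rewrite lee_fin in q1; lra.
under eq_integral => s _.
  rewrite th0 mul0r expR0 mul1e FE poweRM; last 2 first.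
  - by rewrite lee_fin ltW.
  - by apply: line_conv_ge0 => // u; exact: mulr_ge0.
  over.
rewrite poweR_EFin ge0_integralZl_EFin ?powR_ge0//; last 2 first.
- by move=> s _; exact: poweR_ge0.
- apply: (measurableT_comp (measurable_poweR z)).
  by apply: measurable_line_conv => //; [exact: measurable_funM|move=> u; exact: mulr_ge0].
by rewrite powRM ?(ltW l0) ?(ltW C0)// EFinM lee_wpmul2l ?lee_fin ?powR_ge0.
Qed.

Lemma Lpnorm_potential_bounded_Loo a b : `|sigma + 2^-1 - a| < beta -> 2 * sigma - a - b = 0 ->
  exists2 C, 0 < C & forall f, weightedLp +oo a f ->
  (Lpnorm +oo (fun x => (x `^ (- b))%:E * potential alpha sigma f x) <=
   C%:E * Lpnorm +oo (fun x => (x `^ a * f x)%:E))%E.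
Proof.
move=> etab th0; have [C C0 HC] := line_conv_bounded_one halpha hsigma0 hsigma etab.
exists (C + 1); first by lra.
move=> f [mf Nfin].
have := line_conv_profile_Loo (a := a) _ mf.
move: Nfin; have := @Lnorm_ge0 _ _ _ mu +oo%E ((fun x => (x `^ a * f x)%:E) \_ (@Rplus R)).
rewrite -/(Lpnorm _ _); case: (Lpnorm _ _) => [N| |]//; rewrite lee_fin => N0 _ h.
rewrite -EFinM; apply: (@Lpnorm_potential_le _ alpha sigma halpha hsigma0 hsigma +oo b a).
- exact: leey.
- by rewrite mulr_ge0//; lra.
- exact: mf.
move=> s; rewrite recip_oo addr0 th0 mul0r expR0 mul1e.
apply: le_trans (h N s N0 (lexx _)) _.
rewrite mulrC EFinM lee_wpmul2l// (le_trans (HC s))// lee_fin lerDl//.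
Qed.

End Sufficiency.

(** * The theorem *)

Section Assembly.
Context {R : realType}.
Local Notation mu := (@lebesgue_measure R).
Variables (alpha sigma : R).
Hypotheses (halpha : -1 < alpha) (hsigma0 : 0 < sigma) (hsigma : sigma < alpha + 1).

Lemma ae_Rplus_exists (P : R -> Prop) : (\forall x \ae mu, Rplus x -> P x) ->
  exists2 x, 0 < x & P x.
Proof.
move=> [M [mM M0 sub]]; apply: contrapT => nP.
have IM : `[1, 2]%classic `<=` M.
  move=> x; rewrite /= in_itv/= => /andP[x1 _]; apply: sub => /= h; apply: nP.
  have x0 : 0 < x by lra.
  by exists x => //; apply: h; rewrite /Rplus/= in_itv/= x0.
have : (mu (`[1%R, 2%R]%classic : set R) <= 0)%E.
  by rewrite -M0; apply: le_measure => //; rewrite inE//; exact: measurable_itv.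
apply/negP; rewrite -ltNge lebesgue_measure_itv/= lte_fin ifT; last by lra.
by rewrite -EFinB lte_fin; lra.
Qed.

Lemma Dom_tilt_bound (p : \bar R) (a : R) : (1 <= p)%E ->
  weightedLp p a `<=` Dom alpha sigma ->
  let eta := sigma + 2^-1 - (a + recip p) in
  (eta < alpha + 1 - sigma ?<= if (p == 1%E)) /\
  (- (alpha + 1 - sigma) < eta ?<= if (p == 1%E)).
Proof.
move=> p1 sub eta; apply: (abs_tilt_bound halpha hsigma0 hsigma p1) => F uF.
have [fL _] := unit_of_profile a p1 uF.
have [mF F0 _] := uF.
have [x x0 fx] := ae_Rplus_exists (sub _ fL).
exists (ln x).
have := (integrable_potentialP halpha hsigma0 hsigma (a + recip p)
  (measurable_of_profile (a + recip p) mF) x0).1 fx.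
by rewrite log_profileK.
Qed.

End Assembly.

Theorem theorem2p10 (R : realType) (alpha sigma a b : R) (p q : \bar R)
    (halpha : -1 < alpha) (hsigma0 : 0 < sigma) (hsigma : sigma < alpha + 1)
    (hp : (1 <= p)%E) (hq : (1 <= q)%E) :
  let p' := hoelder_conjugate p in
  let q' := hoelder_conjugate q in
  (weightedLp p a `<=` Dom alpha sigma <->
     (2 * sigma - recip p - alpha - 2^-1 < a ?<= if (p == 1%E)) /\
     (a < recip p' + alpha + 2^-1 ?<= if (p == 1%E)))
  /\
  ((exists C : R, 0 < C /\
      forall f : R -> R, weightedLp p a f ->
        Dom alpha sigma f /\
        (Lpnorm q (fun x => (x `^ (- b))%:E * potential alpha sigma f x)
           <= C%:E * Lpnorm p (fun x => (x `^ a * f x)%:E))%E)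
   <->
   [/\ (p <= q)%E,
       recip q = recip p + a + b - 2 * sigma,
       a < recip p' + alpha + 2^-1 ?<= if ((p == 1%E) && (q' == 1%E)),
       b < recip q + alpha + 2^-1 ?<= if ((p == 1%E) && (q' == 1%E)) &
       0 < a + b ?<= if (~~ ((p == 1%E) || (q == +oo%E)))]).
Proof.
move=> p' q'; rewrite /p' /q' recip_conjugate// conjugate_eq1//.
(* The two conditions on a in (i) are - beta < eta and eta < beta; given the
   balance of (b), they are also (c) and (d). *)
pose eta := sigma + 2^-1 - (a + recip p).
pose beta := alpha + 1 - sigma.
have dom_iff : weightedLp p a `<=` Dom alpha sigma <->
    (2 * sigma - recip p - alpha - 2^-1 < a ?<= if (p == 1%E)) /\
     (a < 1 - recip p + alpha + 2^-1 ?<= if (p == 1%E)).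
  split => [/(Dom_tilt_bound halpha hsigma0 hsigma hp)[]|[]].
    by rewrite /Order.lteif; case: (p == 1%E) => h1 h2; split; lra.
  move=> h1 h2; apply: weightedLp_subset_Dom => //.
  move: h1 h2; rewrite /Order.lteif; case: (p == 1%E) => h1 h2.
    by rewrite ler_norml; apply/andP; split; lra.
  by rewrite ltr_norml; apply/andP; split; lra.
split=> //; split.
  move=> [C [C0 HC]].
  have dom : weightedLp p a `<=` Dom alpha sigma by move=> f /HC[].
  have bounded F : unit_profile p F ->
      (Lpnorm q (fun x => (x `^ (- b))%:E *
         potential alpha sigma (of_profile (a + recip p) F) x) <= C%:E)%E.
    move=> uF; have [fL f1] := unit_of_profile a hp uF.
    have [_ h] := HC _ fL; apply: (le_trans h).
    by rewrite -[leRHS]mule1 lee_wpmul2l// lee_fin ltW.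
  have th0 := scaling_balance halpha hsigma0 hsigma hp hq (ltW C0) bounded.
  have rqp := exponents_monotone halpha hsigma0 hsigma hp hq (ltW C0) bounded.
  have ab0 := weights_sum_ge0 halpha hsigma0 hsigma hp hq (ltW C0) bounded.
  have strict : ~~ (((p == 1%E) && (q == +oo%E))) ->
      2 * sigma - recip p - alpha - 2^-1 < a /\ a < 1 - recip p + alpha + 2^-1.
    move=> npq; have := dom_iff.1 dom; rewrite /Order.lteif.
    case: ifPn => [pe|_]//; move: npq; rewrite pe /= => qn [h1 h2].
    have := tilt_neq halpha hsigma0 hsigma hp hq (ltW C0) bounded qn.
    rewrite -/eta => etab.
    suff : - beta < eta < beta by rewrite /eta /beta => /andP[? ?]; split; lra.
    rewrite -ltr_norml lt_neqAle etab /=.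
    by rewrite ler_norml /eta /beta; apply/andP; split; lra.
  split.
  - exact: le_of_recip.
  - lra.
  - rewrite /Order.lteif; case: ifPn => [/andP[pe _]|/strict[]//].
    by have := dom_iff.1 dom; rewrite pe /= => -[].
  - rewrite /Order.lteif; case: ifPn => [/andP[pe _]|/strict[]]; last by lra.
    by have := dom_iff.1 dom; rewrite pe /= => -[]; lra.
  - rewrite /Order.lteif; case: ifPn => //; rewrite negbK => pq.
    rewrite lt_neqAle eq_sym ab0 andbT.
    have [pe|pn] := eqVneq p 1%E.
      have [qe|qn] := eqVneq q +oo%E.
        exact: (weights_sum_neq0_L1_Loo halpha hsigma0 hsigma hp hq (ltW C0) bounded).
      exact: (weights_sum_neq0_L1 halpha hsigma0 hsigma hp hq (ltW C0) bounded).
    move: pq; rewrite (negbTE pn) /= => /eqP qe.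
    exact: (weights_sum_neq0_Loo halpha hsigma0 hsigma hp hq (ltW C0) bounded).
move=> [pq bal ha hb hab].
have dom : weightedLp p a `<=` Dom alpha sigma.
  apply/dom_iff; move: ha hb; rewrite /Order.lteif; case: (p == 1%E) => /=; last by split; lra.
  by case: (q == +oo%E) => h1 h2; split; lra.
have etab : `|eta| < beta ?<= if ((p == 1%E) && (q == +oo%E)).
  move: ha hb; rewrite /Order.lteif; case: ifP => _ h1 h2.
    by rewrite ler_norml /eta /beta; apply/andP; split; lra.
  by rewrite ltr_norml /eta /beta; apply/andP; split; lra.
have th0 : 2 * sigma - (a + recip p) - b + recip q = 0 by lra.
have [pE|[r pE]] : p = +oo%E \/ exists r, p = r%:E.
- by case: (p) hp => [r| |]// _; [right; exists r|left].
- have qE : q = +oo%E by move: pq; rewrite pE leye_eq => /eqP.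
  move: th0 etab; rewrite /eta pE qE !recip_oo !addr0 /= => th0 etab.
  have [C C0 HC] := Lpnorm_potential_bounded_Loo halpha hsigma0 hsigma etab th0.
  exists C; split => // f fL; split; last exact: HC.
  by apply: dom; rewrite pE.
have r1 : 1 <= r by rewrite -lee_fin -pE.
rewrite pE in pq.
have [C C0 HC] : exists2 C, 0 < C & forall F, unit_profile r%:E F ->
    bounded_profile q C (line_conv alpha sigma eta F).
  apply: line_conv_bounded => //.
    have -> : recip q - r^-1 + 2 * sigma = a + b.
      by move: bal; rewrite pE recip_fin; lra.
    by move: hab; rewrite pE eqe.
  by move: etab; rewrite pE eqe.
exists C; split => // f fL; split; first exact: dom.
rewrite pE in fL *.
have th1 : 2 * sigma - (a + r^-1) - b + recip q = 0 by move: th0; rewrite pE recip_fin.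
have HC' F : unit_profile r%:E F ->
    bounded_profile q C (line_conv alpha sigma (sigma + 2^-1 - (a + r^-1)) F).
  by move=> /HC; rewrite /eta pE recip_fin.
exact: (Lpnorm_potential_bounded halpha hsigma0 hsigma r1 hq C0 th1 HC' fL).
Qed.
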